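(* Let $\psi=(\psi^1,\dots,\psi^N)\in\mathbb C^N$ be a fixed unit vector, let $V$ be a fixed $N\times N$ unitary matrix whose first column is $\psi$, and let $(U_t)_{t\ge0}$ be the unitary Brownian motion started at $U_0=V$. For $j,k\in\{1,\dots,N\}$ and $t\ge0$ let $f_j(t)=\mathbb E[|U_t^{j1}|^2]$ and $f_{jk}(t)=\mathbb E[|U_t^{j1}|^2|U_t^{k1}|^2]$. Then for all $j\ne k$ the function $f_{jk}$ satisfies the first order ordinary differential equation $$f_{jk}'=\frac1N(f_j+f_k)-\Big(2+\frac2N\Big)f_{jk},$$ which admits the solution $$f_{jk}(t)=\Big[f_{jk}(0)-\frac{1}{N+2}\Big(f_j(0)+f_k(0)-\frac2N\Big)-\frac{1}{N(N+1)}\Big]e^{-t(2+2/N)}+\frac{1}{N+2}\Big[f_j(0)+f_k(0)-\frac2N\Big]e^{-t}+\frac{1}{N(N+1)},$$ with $f_j(0)=|\psi^j|^2$, $f_k(0)=|\psi^k|^2$ and $f_{jk}(0)=|\psi^j|^2|\psi^k|^2$.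
   Context: Hermitian Brownian motion $(H_t)_{t\ge0}$: the continuous centered Gaussian process in the real vector space of $N\times N$ Hermitian matrices, with $H_0=0$, such that $\mathbb E[\langle A,H_s\rangle\langle B,H_t\rangle]=\min(s,t)\langle A,B\rangle$ for all Hermitian $A,B$, where $\langle A,B\rangle=N\,\mathrm{Tr}(AB)$. The unitary Brownian motion started at a unitary matrix $V$ is the solution of the It\^o stochastic differential equation $dU_t=i(dH_t)U_t-\frac12U_t\,dt$, $U_0=V$; it takes values in the group of $N\times N$ unitary matrices. $U_t^{jk}$ denotes the $(j,k)$ entry of $U_t$. *)

(* Defs.v *)
From HB Require Import structures.
From mathcomp Require Import all_boot all_order all_algebra.
From mathcomp Require Import all_classical all_reals all_analysis.
From mathcomp Require Export complex.

Set Implicit Arguments.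
Unset Strict Implicit.
Unset Printing Implicit Defensive.
Import Order.TTheory GRing.Theory Num.Theory.
Import numFieldNormedType.Exports.

Local Open Scope classical_set_scope.
Local Open Scope ring_scope.

Definition sqmod (R : realType) (z : R[i]) : R := ComplexField.Normc.normc z ^+ 2.

(* Squared Frobenius norm. *)
Definition frob2 (R : realType) (m : nat) (A : 'M[R[i]]_m) : R :=
  \sum_j \sum_k sqmod (A j k).

(* <A, B> = N Tr(AB); on Hermitian matrices the trace is real, so taking the
   real part loses nothing. *)
Definition herm_dot (R : realType) (m : nat) (A B : 'M[R[i]]_m) : R :=
  m%:R * complex.Re (\tr (A *m B)).

Section stochastic.
Context (d : measure_display) (T : measurableType d) (R : realType)
        (P : probability T R) (m : nat).
Local Notation M := 'M[R[i]]_m.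
Implicit Types (X Y : T -> M) (H U : R -> T -> M) (F : R -> set (set T)).

Definition sigma_mx X : set (set T) :=
  <<s [set A | exists j k (B : set R), measurable B /\
        (A = (fun w => complex.Re (X w j k)) @^-1` B \/
         A = (fun w => complex.Im (X w j k)) @^-1` B)] >>.

Definition continuous_paths H : Prop :=
  forall w j k,
    {within `[0, +oo[, continuous (fun t : R => complex.Re (H t w j k))} /\
    {within `[0, +oo[, continuous (fun t : R => complex.Im (H t w j k))}.

(* The degenerate law (variance 0) counts as Gaussian; it needs its own clause
   because normal_prob 0 0 is the uniform law on [0, 1], not the Dirac mass. *)
Definition centered_gaussian (X : T -> R) : Prop :=
  measurable_fun setT X /\
  ({ae P, forall w, X w = 0} \/
   exists2 s : R, s != 0 & forall B : set R, measurable B ->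
     P (X @^-1` B) = normal_prob 0 s B).

Record hermitian_brownian_motion H : Prop := HermitianBM {
  hbm_herm : forall (t : R) w, 0 <= t -> H t w \is hermsymmx;
  hbm_init : {ae P, forall w, H 0 w = 0};
  hbm_cont : continuous_paths H;
  hbm_gauss : forall (p : nat) (t : 'I_p -> R) (A : 'I_p -> M),
    (forall i, 0 <= t i) -> (forall i, A i \is hermsymmx) ->
    centered_gaussian (fun w => \sum_i herm_dot (A i) (H (t i) w));
  hbm_cov : forall (A B : M) (s t : R),
    A \is hermsymmx -> B \is hermsymmx -> 0 <= s -> 0 <= t ->
    ('E_P[fun w => (herm_dot A (H s w) * herm_dot B (H t w))%R] =
      (Num.min s t * herm_dot A B)%R%:E)%E
}.

Record filtration F : Prop := Filtration {
  filtration_sigma : forall t : R, 0 <= t -> sigma_algebra setT (F t);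
  filtration_measurable : forall t : R, 0 <= t -> F t `<=` measurable;
  filtration_mono : forall s t : R, 0 <= s -> s <= t -> F s `<=` F t
}.

Definition adapted F H : Prop := forall t : R, 0 <= t -> sigma_mx (H t) `<=` F t.

Definition independent_increments F H : Prop :=
  forall (s t : R) (A B : set T), 0 <= s -> s <= t ->
    sigma_mx (fun w => H t w - H s w) A -> F s B ->
    P (A `&` B) = (P A * P B)%E.

(* The process equal to [value k] on [knot k, knot k.+1[ for k < pieces. *)
Record elementary := Elementary {
  pieces : nat;
  knot : nat -> R;
  value : nat -> T -> M
}.

Record elementary_process F (t : R) (phi : elementary) : Prop := ElementaryProcess {
  elementary_start : knot phi 0 = 0;
  elementary_end : knot phi (pieces phi) = t;
  elementary_mono : forall k, (k < pieces phi)%N -> knot phi k <= knot phi k.+1;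
  elementary_adapted : forall k, (k < pieces phi)%N ->
    sigma_mx (value phi k) `<=` F (knot phi k);
  elementary_L2 : forall k, (k < pieces phi)%N ->
    (\int[P]_w (frob2 (value phi k w))%:E < +oo)%E
}.

Definition elementary_at (phi : elementary) (s : R) (w : T) : M :=
  \sum_(k < pieces phi | knot phi k <= s < knot phi k.+1) value phi k w.

Definition elementary_integral H (phi : elementary) (w : T) : M :=
  \sum_(k < pieces phi) (H (knot phi k.+1) w - H (knot phi k) w) *m value phi k w.

(* Y is a version of the Ito integral of (dH_s) U_s over [0, t]: the L^2 limit
   of the integrals of elementary processes converging to U in L^2(P x ds).
   When H is a Brownian motion relative to F, the Ito isometry makes the limit
   independent of the approximating sequence up to a null set. *)
Definition is_ito_integral F H U (t : R) Y : Prop :=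
  sigma_mx Y `<=` measurable /\
  exists phi : nat -> elementary,
    [/\ forall n, elementary_process F t (phi n),
        (\int[P]_w \int[lebesgue_measure]_(s in `[0%R, t])
           (frob2 (U s w - elementary_at (phi n) s w)%R)%:E)%E @[n --> \oo] --> 0%E &
        (\int[P]_w (frob2 (Y w - elementary_integral H (phi n) w)%R)%:E)%E
           @[n --> \oo] --> 0%E].

Definition time_integral U (t : R) (w : T) : M :=
  \matrix_(j, k)
    Complex (\int[lebesgue_measure]_(s in `[0, t]) complex.Re (U s w j k))
            (\int[lebesgue_measure]_(s in `[0, t]) complex.Im (U s w j k)).

(* dU = i (dH) U - U/2 dt with U_0 = V, in integrated form; adaptedness and
   the Ito integral are relative to F. *)
Record unitary_brownian_motion F H (V : M) U : Prop := UnitaryBM {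
  ubm_hbm : hermitian_brownian_motion H;
  ubm_filtration : filtration F;
  ubm_driver_adapted : adapted F H;
  ubm_driver_indep : independent_increments F H;
  ubm_adapted : adapted F U;
  ubm_cont : continuous_paths U;
  ubm_init : {ae P, forall w, U 0 w = V};
  ubm_sde : forall t : R, 0 <= t -> exists2 Y : T -> M,
    is_ito_integral F H U t Y &
    {ae P, forall w,
      U t w = V + (Complex 0 1 : R[i]) *: Y w - 2^-1 *: time_integral U t w}
}.

End stochastic.

Section moments.
Context (d : measure_display) (T : measurableType d) (R : realType)
        (P : probability T R) (n : nat).
Implicit Types (U : R -> T -> 'M[R[i]]_n.+1) (j k : 'I_n.+1).

(* The first column of the N x N matrix, N = n.+1, has index ord0. *)
Definition moment1 U j (t : R) : R :=
  fine 'E_P[fun w => sqmod (U t w j ord0)].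

Definition moment2 U j k (t : R) : R :=
  fine 'E_P[fun w => (sqmod (U t w j ord0) * sqmod (U t w k ord0))%R].

End moments.

(* Main.v *)
(* Fix t > 0 and run the explicit Euler scheme Z' = (1 + i dH - h/2) Z on a grid
   of [0, t] of mesh h = t / k^2.  As dH is Hermitian, <z, dH z> is real, so the
   squared length of a column z of Z changes only by terms of order h with mean
   of order h^2; it stays within O(1/k) of 1 in L^2.  Together with
   E[dH_ab dH_cd] = (h / N) [a = d, b = c] this makes E|z_j|^2 and
   E|z_j|^2|z_k|^2 approximate Euler schemes of a linear system, hence within
   O(1/k) of its explicit solution.  On the other hand E|U_t - Z|^2 = O(h): the
   Ito isometry for elementary processes, passed to the limit, bounds the error
   at time s by the integrated error on [0, s] plus O(h), and Gronwall applies.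
   Letting k tend to infinity, the first column of U_t has length 1 almost
   surely, so products of its entries are bounded and converge in mean: the
   moments of U_t are the explicit solution, and the differential equation
   follows by differentiating it. *)
Require Import Defs.
From HB Require Import structures.
From mathcomp Require Import all_boot all_order all_algebra.
From mathcomp Require Import all_classical all_reals all_analysis.
From mathcomp Require Import measurable_realfun ring lra.

Set Implicit Arguments.
Unset Strict Implicit.
Unset Printing Implicit Defensive.
Import Order.TTheory GRing.Theory Num.Theory.
Import numFieldNormedType.Exports.

Local Open Scope classical_set_scope.
Local Open Scope ring_scope.

(** The equation describes U only through L^2 limits: its unitarity is not given, nor the finiteness
    of E|U^j1|^2|U^k1|^2, so an Ito formula could not be applied to these products directly. The
    scheme avoids it, since a step is a polynomial in an increment independent of the past. Its
    terms of order h cancel: the drift -1/2 offsets the growth caused by the noise both in E|z|^2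
    and in E|z|^4. The correlation of dH_jk with dH_kj is the origin of the 2/N in the rate. The
    mesh t/k^2 makes the square root of the mesh a multiple of 1/k: terms of size |dH|^3 are handled
    by Young's inequality with weight 1/k, at a cost of order h/k per step and 1/k in total. The
    limit system is triangular with rates 1 and 2 + 2/N; subtracting from the pair moment 1/(N+2)
    times the centred first moments and the constant 1/(N(N+1)) diagonalises it, so that every
    quantity obeys a scalar recursion. The error constants are crude; only their independence of k
    matters. *)

Local Notation Re := complex.Re.
Local Notation Im := complex.Im.

(** * Integrable random variables and independence *)

Section integrable_variables.
Context (d : measure_display) (T : measurableType d) (R : realType)
        (P : probability T R).
Implicit Types X Y : T -> R.

Definition L1 X := P.-integrable setT (EFin \o X).
Definition L2 X := measurable_fun setT X /\ L1 (fun w => X w ^+ 2).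
(** Unlike [L1] and [L2], this class is closed under products, so every polynomial in Gaussian
    increments and earlier values of the scheme is integrable without further estimates. *)
Definition all_moments X :=
  measurable_fun setT X /\ forall p : nat, L1 (fun w => `|X w| ^+ p).

Definition mean X : R := \int[P]_w (X w).

Lemma L1_measurable X : L1 X -> measurable_fun setT X.
Proof. by move=> /measurable_int /measurable_EFinP. Qed.

Lemma L1_cst c : L1 (fun=> c).
Proof. exact: finite_measure_integrable_cst. Qed.

Lemma L1D X Y : L1 X -> L1 Y -> L1 (fun w => X w + Y w).
Proof. by move=> hX hY; apply: (integrableD measurableT hX hY). Qed.

Lemma L1Z c X : L1 X -> L1 (fun w => c * X w).
Proof. by move=> hX; apply: (integrableZl measurableT c hX). Qed.

Lemma L1N X : L1 X -> L1 (fun w => - X w).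
Proof.
move=> hX; have -> : (fun w => - X w) = (fun w => (-1) * X w); last exact: L1Z.
by apply/funext => w; rewrite mulN1r.
Qed.

Lemma L1B X Y : L1 X -> L1 Y -> L1 (fun w => X w - Y w).
Proof. by move=> hX hY; apply: L1D => //; apply: L1N. Qed.

Lemma L1_sum I (s : seq I) (Q : pred I) (X : I -> T -> R) :
  (forall i, Q i -> L1 (X i)) -> L1 (fun w => \sum_(i <- s | Q i) X i w).
Proof.
move=> hX; elim: s => [|i s ih].
  by under eq_fun do rewrite big_nil; exact: L1_cst.
case: (boolP (Q i)) => Qi; under eq_fun do rewrite big_cons ?Qi ?(negbTE Qi) //.
  by apply: L1D => //; exact: hX.
exact: ih.
Qed.

Lemma L1_le X Y : measurable_fun setT X -> (forall w, `|X w| <= Y w) -> L1 Y -> L1 X.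
Proof.
move=> mX le hY; apply: (le_integrable measurableT _ _ hY) => [|w _ /=].
  exact/measurable_EFinP.
by rewrite lee_fin (le_trans (le w))// ler_norm.
Qed.

Lemma L1_norm X : L1 X -> L1 (fun w => `|X w|).
Proof. by move=> hX; apply: (integrable_abse hX). Qed.

Lemma meanD X Y : L1 X -> L1 Y -> mean (fun w => X w + Y w) = mean X + mean Y.
Proof. by move=> hX hY; rewrite /mean RintegralD. Qed.

Lemma meanZ c X : L1 X -> mean (fun w => c * X w) = c * mean X.
Proof. by move=> hX; rewrite /mean RintegralZl. Qed.

Lemma meanB X Y : L1 X -> L1 Y -> mean (fun w => X w - Y w) = mean X - mean Y.
Proof. by move=> hX hY; rewrite /mean RintegralB. Qed.

Lemma mean_cst c : mean (fun=> c) = c.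
Proof. by rewrite /mean /Rintegral integral_cst//= probability_setT mule1. Qed.

Lemma mean_sum I (s : seq I) (Q : pred I) (X : I -> T -> R) :
  (forall i, Q i -> L1 (X i)) ->
  mean (fun w => \sum_(i <- s | Q i) X i w) = \sum_(i <- s | Q i) mean (X i).
Proof.
move=> hX; elim: s => [|i s ih].
  by rewrite /mean; under eq_Rintegral do rewrite big_nil; rewrite big_nil Rintegral_cst// mul0r.
rewrite /mean; under eq_Rintegral do rewrite big_cons.
rewrite big_cons; case: ifPn => Qi //; rewrite -/(mean _).
by rewrite meanD ?ih//; [exact: hX|exact: L1_sum].
Qed.

Lemma mean_le X Y : L1 X -> L1 Y -> (forall w, X w <= Y w) -> mean X <= mean Y.
Proof. by move=> hX hY le; apply: le_Rintegral. Qed.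

Lemma mean_ge0 X : (forall w, 0 <= X w) -> 0 <= mean X.
Proof. by move=> X0; apply: Rintegral_ge0. Qed.

Lemma mean_norm X : L1 X -> `|mean X| <= mean (fun w => `|X w|).
Proof. by move=> hX; apply: le_normr_Rintegral. Qed.

Lemma mean_EFin X : L1 X -> (\int[P]_w (X w)%:E)%E = (mean X)%:E.
Proof. by move=> hX; rewrite /mean /Rintegral fineK//; apply: integrable_fin_num. Qed.

Lemma L1_ge0 X : measurable_fun setT X -> (forall w, 0 <= X w) ->
  (\int[P]_w (X w)%:E < +oo)%E -> L1 X.
Proof.
move=> mX X0 fin; apply/integrableP; split; first exact/measurable_EFinP.
by under eq_integral do rewrite /= ger0_norm//.
Qed.

Lemma L2_measurable X : L2 X -> measurable_fun setT X. Proof. by case. Qed.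

Lemma L2M X Y : L2 X -> L2 Y -> L1 (fun w => X w * Y w).
Proof.
move=> [mX hX] [mY hY].
apply: (@L1_le _ (fun w => X w ^+ 2 + Y w ^+ 2)); last exact: L1D.
  exact: measurable_funM.
move=> w; rewrite normrM -(real_normK (num_real (X w))) -(real_normK (num_real (Y w))).
have := normr_ge0 (X w); have := normr_ge0 (Y w); move: `|X w| `|Y w| => a b; nra.
Qed.

Lemma L2D X Y : L2 X -> L2 Y -> L2 (fun w => X w + Y w).
Proof.
move=> hX hY; split; first by apply: measurable_funD; apply: L2_measurable.
have -> : (fun w => (X w + Y w) ^+ 2) =
   (fun w => (X w ^+ 2 + Y w ^+ 2) + 2 * (X w * Y w)) by apply/funext => w; ring.
by apply: L1D; [apply: L1D; [case: hX|case: hY] | apply/L1Z/L2M].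
Qed.

Lemma L2_cst c : L2 (fun=> c).
Proof. by split => //; exact: L1_cst. Qed.

Lemma L2_sum I (s : seq I) (Q : pred I) (X : I -> T -> R) :
  (forall i, Q i -> L2 (X i)) -> L2 (fun w => \sum_(i <- s | Q i) X i w).
Proof.
move=> hX; elim: s => [|i s ih].
  by under eq_fun do rewrite big_nil; exact: L2_cst.
case: (boolP (Q i)) => Qi; under eq_fun do rewrite big_cons ?Qi ?(negbTE Qi) //.
  by apply: L2D => //; exact: hX.
exact: ih.
Qed.

Lemma L2_L1 X : L2 X -> L1 X.
Proof.
move=> hX; have -> : X = (fun w => X w * 1) by apply/funext => w; rewrite mulr1.
exact: L2M (L2_cst 1).
Qed.

Lemma all_moments_L1 X : all_moments X -> L1 X.
Proof. by move=> [mX /(_ 1)]; apply: L1_le => // w; rewrite expr1. Qed.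

Lemma all_moments_L2 X : all_moments X -> L2 X.
Proof.
move=> [mX /(_ 2)]; split => //; apply: L1_le; last by eassumption.
  exact: measurable_funX.
by move=> w; rewrite normrX.
Qed.

Lemma all_moments_cst c : all_moments (fun=> c).
Proof. by split => // p; apply: L1_cst. Qed.

Lemma all_momentsM X Y : all_moments X -> all_moments Y ->
  all_moments (fun w => X w * Y w).
Proof.
move=> [mX hX] [mY hY]; split; first exact: measurable_funM.
move=> p; apply: (@L1_le _ (fun w => `|X w| ^+ (2 * p) + `|Y w| ^+ (2 * p))).
- by apply: measurable_funX; apply: measurableT_comp => //; exact: measurable_funM.
- move=> w; rewrite ger0_norm ?exprn_ge0// normrM exprMn !(mulnC 2) !exprM.
  have := exprn_ge0 p (normr_ge0 (X w)); have := exprn_ge0 p (normr_ge0 (Y w)).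
  move: (`|X w| ^+ p) (`|Y w| ^+ p) => a b; nra.
- exact: L1D.
Qed.

Lemma all_momentsD X Y : all_moments X -> all_moments Y ->
  all_moments (fun w => X w + Y w).
Proof.
move=> [mX hX] [mY hY]; split; first exact: measurable_funD.
move=> p; apply: (@L1_le _ (fun w => 2 ^+ p * (`|X w| ^+ p + `|Y w| ^+ p))).
- by apply: measurable_funX; apply: measurableT_comp => //; exact: measurable_funD.
- move=> w; rewrite ger0_norm ?exprn_ge0//.
  have [h|/ltW h] := leP `|X w| `|Y w|.
    apply: (@le_trans _ _ ((2 * `|Y w|) ^+ p)).
      by rewrite lerXn2r ?nnegrE ?mulr_ge0// (le_trans (ler_normD _ _))// mulrDl !mul1r lerD2r.
    by rewrite exprMn ler_pM2l ?exprn_gt0// lerDr exprn_ge0.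
  apply: (@le_trans _ _ ((2 * `|X w|) ^+ p)).
    by rewrite lerXn2r ?nnegrE ?mulr_ge0// (le_trans (ler_normD _ _))// mulrDl !mul1r lerD2l.
  by rewrite exprMn ler_pM2l ?exprn_gt0// lerDl exprn_ge0.
- by apply: L1Z; apply: L1D.
Qed.

Lemma all_momentsN X : all_moments X -> all_moments (fun w => - X w).
Proof.
move=> hX; have -> : (fun w => - X w) = (fun w => (-1) * X w).
  by apply/funext => w; rewrite mulN1r.
by apply: all_momentsM => //; exact: all_moments_cst.
Qed.

Lemma all_momentsB X Y : all_moments X -> all_moments Y ->
  all_moments (fun w => X w - Y w).
Proof. by move=> hX hY; apply: all_momentsD => //; apply: all_momentsN. Qed.

Lemma all_momentsX p X : all_moments X -> all_moments (fun w => X w ^+ p).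
Proof.
move=> hX; elim: p => [|p ih].
  by under eq_fun do rewrite expr0; exact: all_moments_cst.
by under eq_fun do rewrite exprS; exact: all_momentsM.
Qed.

Lemma all_moments_sum I (s : seq I) (Q : pred I) (X : I -> T -> R) :
  (forall i, Q i -> all_moments (X i)) ->
  all_moments (fun w => \sum_(i <- s | Q i) X i w).
Proof.
move=> hX; elim: s => [|i s ih].
  by under eq_fun do rewrite big_nil; exact: all_moments_cst.
case: (boolP (Q i)) => Qi; under eq_fun do rewrite big_cons ?Qi ?(negbTE Qi) //.
  by apply: all_momentsD => //; exact: hX.
exact: ih.
Qed.

End integrable_variables.

Section independence.
Context (d : measure_display) (T : measurableType d) (R : realType)
        (P : probability T R).
Implicit Types (X Y : T -> R) (G : set (set T)).

Definition mfun_wrt G X := measurable_fun setT (X : g_sigma_algebraType G -> R).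

Definition indep_classes G1 G2 :=
  forall A B, <<s G1 >> A -> <<s G2 >> B -> P (A `&` B) = (P A * P B)%E.

Lemma mfun_wrt_sub G X : <<s G >> `<=` measurable -> mfun_wrt G X ->
  measurable_fun setT X.
Proof. by move=> sG mX _ B mB; apply: sG; apply: mX. Qed.

Lemma mfun_wrt_mono G1 G2 X : <<s G1 >> `<=` <<s G2 >> -> mfun_wrt G1 X -> mfun_wrt G2 X.
Proof. by move=> sG mX _ B mB; apply: sG; apply: mX. Qed.

Variables (G1 G2 : set (set T)).
Hypotheses (sG1 : <<s G1 >> `<=` measurable) (sG2 : <<s G2 >> `<=` measurable).
Hypothesis indG : indep_classes G1 G2.

(** The sample space itself, once with each of the two coarser sigma-algebras, is the target of the
    identity map. By independence the joint law of the two maps is the product of their laws, so the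
    mean of a product is computed by Fubini on [T1 * T2]. *)
Let T1 := g_sigma_algebraType G1.
Let T2 := g_sigma_algebraType G2.
Let id1 : T -> T1 := id.
Let id2 : T -> T2 := id.
Let mid1 : measurable_fun setT id1.
Proof. by move=> _ B mB; rewrite setTI; apply: sG1. Qed.
Let mid2 : measurable_fun setT id2.
Proof. by move=> _ B mB; rewrite setTI; apply: sG2. Qed.
Let diag : T -> T1 * T2 := fun w => (id1 w, id2 w).
Let mdiag : measurable_fun setT diag.
Proof. exact: measurable_fun_pair. Qed.
HB.instance Definition _ := @isMeasurableFun.Build _ _ T T1 id1 mid1.
HB.instance Definition _ := @isMeasurableFun.Build _ _ T T2 id2 mid2.
HB.instance Definition _ := @isMeasurableFun.Build _ _ T (T1 * T2)%type diag mdiag.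
Let P1 := distribution P id1.
Let P2 := distribution P id2.
Let P12 := distribution P diag.

Let joint_law A : measurable A -> (P1 \x P2)%E A = P12 A.
Proof.
apply: product_measure_unique => A1 A2 mA1 mA2.
rewrite /P12 /P1 /P2 /distribution /pushforward -indG//.
Qed.

Lemma indep_mul X Y : mfun_wrt G1 X -> mfun_wrt G2 Y -> L1 P X -> L1 P Y ->
  L1 P (fun w => X w * Y w) /\
  mean P (fun w => X w * Y w) = mean P X * mean P Y.
Proof.
move=> mX mY hX hY.
pose f (z : T1 * T2) := X z.1 * Y z.2.
have mf : measurable_fun setT f.
  by apply: measurable_funM; apply: measurableT_comp.
have mEf : measurable_fun setT (EFin \o f) by exact/measurable_EFinP.
have eqm (g : T1 * T2 -> \bar R) : (\int[(P1 \x P2)%E]_z g z = \int[P12]_z g z)%E.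
  by apply: eq_measure_integral => A mA _; exact: joint_law.
(* Tonelli: the double integral of the absolute value factors into E|X| E|Y|. *)
have intf : ((P1 \x P2)%E).-integrable setT (EFin \o f).
  apply/(integrable12ltyP _ _ mEf).
  have -> : (\int[P1]_x \int[P2]_y `|(EFin \o f) (x, y)| =
     (\int[P1]_x (`|X x|%:E * \int[P2]_y `|Y y|%:E)))%E.
    apply: eq_integral => x _.
    rewrite -ge0_integralZl//; last first.
      by apply/measurable_EFinP; apply: measurableT_comp.
    by apply: eq_integral => y _; rewrite /f /= normrM EFinM.
  have YE : (\int[P2]_y `|Y y|%:E = (mean P (fun w => `|Y w|))%:E)%E.
    rewrite ge0_integral_distribution//=; last by apply/measurable_EFinP/measurableT_comp.
    by rewrite -mean_EFin//; exact: L1_norm.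
  have XE : (\int[P1]_y `|X y|%:E = (mean P (fun w => `|X w|))%:E)%E.
    rewrite ge0_integral_distribution//=; last by apply/measurable_EFinP/measurableT_comp.
    by rewrite -mean_EFin//; exact: L1_norm.
  rewrite YE ge0_integralZr//; last 2 first.
  - by apply/measurable_EFinP; apply: measurableT_comp.
  - by rewrite lee_fin mean_ge0.
  by rewrite XE -EFinM ltry.
have intf' : P.-integrable setT (EFin \o (fun w => X w * Y w)).
  have : P12.-integrable setT (EFin \o f).
    apply/integrableP; split => //; rewrite -eqm.
    by case/integrableP : intf.
  move=> /integrableP[_ h]; apply/integrableP; split.
    apply/measurable_EFinP.
    exact: measurable_funM (L1_measurable hX) (L1_measurable hY).
  apply: le_lt_trans h.
  rewrite ge0_integral_distribution//=.
  exact: (measurableT_comp (@abse_measurable _ setT) mEf).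
split => //.
have PX1 : P1.-integrable setT (EFin \o (X : T1 -> R)).
  apply/integrableP; split; first exact/measurable_EFinP.
  rewrite ge0_integral_distribution//; last first.
    by apply/measurableT_comp => //; exact/measurable_EFinP.
  by case/integrableP : hX.
have PY2 : P2.-integrable setT (EFin \o (Y : T2 -> R)).
  apply/integrableP; split; first exact/measurable_EFinP.
  rewrite ge0_integral_distribution//; last first.
    by apply/measurableT_comp => //; exact/measurable_EFinP.
  by case/integrableP : hY.
have YE : (\int[P2]_y (Y y)%:E = (mean P Y)%:E)%E.
  rewrite integral_distribution//= -?mean_EFin//.
  exact/measurable_EFinP.
have XE : (\int[P1]_y (X y)%:E = (mean P X)%:E)%E.
  rewrite integral_distribution//= -?mean_EFin//.
  exact/measurable_EFinP.
have h : (\int[P]_w (X w * Y w)%:E = \int[P1]_x fubini_F P2 (EFin \o f) x)%E.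
  by rewrite (integral12_prod_meas1 intf) eqm integral_distribution.
rewrite {1}/mean /Rintegral h.
have -> : (\int[P1]_x fubini_F P2 (EFin \o f) x =
    \int[P1]_x ((mean P Y)%:E * (X x)%:E))%E.
  apply: eq_integral => x _; rewrite /fubini_F /= muleC -YE -integralZl//.
by rewrite integralZl// XE -EFinM /= mulrC.
Qed.

End independence.

(** * Moments of Gaussian variables *)

Section density.
Context d (T : measurableType d) (R : realType).
Variables (mu nu : {measure set T -> \bar R}) (g : T -> R).
Hypothesis mg : measurable_fun setT g.
Hypothesis g0 : forall x, 0 <= g x.
Hypothesis nuE : forall A, measurable A -> nu A = (\int[mu]_(x in A) (g x)%:E)%E.

Import HBNNSimple.

Let nnsfun_density (h : {nnsfun T >-> R}) :
  (\int[nu]_x (h x)%:E = \int[mu]_x ((h x)%:E * (g x)%:E))%E.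
Proof.
under [RHS]eq_integral => x _.
  rewrite fimfunE -fsumEFin// ge0_mule_fsuml; last first.
    by move=> r; rewrite EFinM nnfun_muleindic_ge0.
  over.
rewrite [RHS]ge0_integral_fsum//; last 2 first.
  - move=> r; apply: emeasurable_funM; last exact/measurable_EFinP.
    by apply/measurable_EFinP; exact: measurable_funM.
  - move=> r x _; apply: mule_ge0; last by rewrite lee_fin.
    by rewrite EFinM nnfun_muleindic_ge0.
under [LHS]eq_integral do rewrite fimfunE -fsumEFin//.
rewrite [LHS]ge0_integral_fsum//; last 2 first.
  - by move=> r; apply/measurable_EFinP; exact: measurable_funM.
  - by move=> r x _; rewrite EFinM nnfun_muleindic_ge0.
apply: eq_fsbigr => r; rewrite inE => -[z _ <-{r}].
rewrite integralZl_indic_nnsfun//= integral_indic// setIT nuE//.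
rewrite -ge0_integralZl//; last 3 first.
- by apply/measurable_EFinP; exact: measurable_funTS.
- by move=> x _; rewrite lee_fin.
- by rewrite lee_fin.
rewrite [LHS]integral_mkcond; apply: eq_integral => x _.
rewrite patchE indicE; case: (boolP (x \in _)) => _ /=; first by rewrite mulr1.
by rewrite mulr0 mul0e.
Qed.

(** Linearity settles simple functions, monotone convergence the rest. It turns integrals against a
    normal law into Lebesgue integrals against its density. *)
Lemma ge0_integral_density (f : T -> \bar R) : measurable_fun setT f ->
  (forall x, 0 <= f x)%E -> (\int[nu]_x f x = \int[mu]_x (f x * (g x)%:E))%E.
Proof.
move=> mf f0.
pose f_ := nnsfun_approx measurableT mf.
transitivity (lim (\int[nu]_x (f_ n x)%:E @[n --> \oo])%E).
  rewrite -monotone_convergence//=.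
  - apply: eq_integral => x _; apply/esym/cvg_lim => //=.
    exact: cvg_nnsfun_approx.
  - by move=> n; exact/measurable_EFinP.
  - by move=> n x _; rewrite lee_fin.
  - by move=> x _ a b ab; rewrite lee_fin; exact/lefP/nd_nnsfun_approx.
rewrite (_ : (fun n => (\int[nu]_x (f_ n x)%:E)%E) =
    (fun n => (\int[mu]_x ((f_ n x)%:E * (g x)%:E))%E)); last first.
  by apply/funext => n; exact: nnsfun_density.
rewrite -monotone_convergence//=.
- apply: eq_integral => x _; apply/cvg_lim => //=.
  by apply: cvgeZr => //; exact: cvg_nnsfun_approx.
- move=> n; apply: emeasurable_funM; exact/measurable_EFinP.
- by move=> n x _; rewrite mule_ge0// lee_fin.
- move=> x _ a b ab; apply: lee_wpmul2r; rewrite lee_fin//.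
  exact/lefP/nd_nnsfun_approx.
Qed.

End density.

Section gaussian_moments.
Context (R : realType).
Local Notation mu := (@lebesgue_measure R).

Lemma powr_le_expR (p : nat) (y : R) : 0 <= y -> y ^+ p <= p`!%:R * expR y.
Proof.
move=> y0; case: p => [|p]; first by rewrite expr0 fact0 mul1r -expR0 ler_expR.
rewrite -ler_pdivrMl ?ltr0n ?fact_gt0// mulrC.
by apply: le_trans (expR_ge1Dxn p y0); rewrite lerDr.
Qed.

(** Half of the exponent absorbs the power: with y = x^2 / (4 s^2) the density is a multiple of
    exp(-2y), y^p <= p! exp(y), and the remaining exp(-y) belongs to the variance 2 s^2. The factor
    2 bounds the quotient sqrt 2 of the two normalisations. *)
Lemma normal_pdf_moment_le (p : nat) (s x : R) : s != 0 ->
  x ^+ (2 * p) * normal_pdf 0 s x <=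
  (4 * s ^+ 2) ^+ p * p`!%:R * 2 * normal_pdf 0 (Num.sqrt 2 * s) x.
Proof.
move=> s0; have s2 : 0 < s ^+ 2 by rewrite exprn_even_gt0.
have q0 : Num.sqrt 2 * s != 0 by rewrite mulf_neq0// gt_eqF// sqrtr_gt0.
rewrite !normal_pdfE// /normal_fun !subr0.
rewrite [(Num.sqrt 2 * s) ^+ 2]exprMn sqr_sqrtr//.
have -> : normal_peak s = Num.sqrt 2 * normal_peak (Num.sqrt 2 * s).
  rewrite /normal_peak.
  have -> : (Num.sqrt 2 * s) ^+ 2 * pi *+ 2 = 2 * (s ^+ 2 * pi *+ 2).
    by rewrite exprMn sqr_sqrtr//; ring.
  rewrite [in RHS]sqrtrM// invfM.
  by rewrite mulrA divff ?mul1r// gt_eqF// sqrtr_gt0.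
set pk := normal_peak _; have pk0 : 0 <= pk by exact: normal_peak_ge0.
pose y := x ^+ 2 / (4 * s ^+ 2).
have y0 : 0 <= y by rewrite divr_ge0// ?sqr_ge0// mulr_ge0// ltW.
have -> : - x ^+ 2 / (s ^+ 2 *+ 2) = - y - y.
  by rewrite /y -mulr_natr; field; rewrite s0.
have -> : - x ^+ 2 / (2 * s ^+ 2 *+ 2) = - y.
  by rewrite /y -mulr_natr; field; rewrite s0.
have -> : x ^+ (2 * p) = (4 * s ^+ 2) ^+ p * y ^+ p.
  by rewrite -exprMn exprM /y mulrCA divff ?mulr1// mulf_neq0// gt_eqF.
have h := powr_le_expR p y0.
have sq2 : Num.sqrt 2 <= 2 :> R.
  by rewrite -[X in _ <= X]ger0_norm// -sqrtr_sqr ler_sqrt// expr2; nra.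
have c0 : 0 < (4 * s ^+ 2) ^+ p by apply: exprn_gt0; apply: mulr_gt0.
rewrite expRD -!mulrA ler_pM2l//.
have e1 : expR y * expR (- y) = 1 by rewrite -expRD subrr expR0.
have ey := expR_gt0 (- y).
apply: (@le_trans _ _ (p`!%:R * expR y * (Num.sqrt 2 * (pk * (expR (- y) * expR (- y)))))).
  by apply: ler_wpM2r => //; rewrite !mulr_ge0// ?sqrtr_ge0// ltW.
rewrite (_ : p`!%:R * expR y * (Num.sqrt 2 * (pk * (expR (- y) * expR (- y)))) =
   p`!%:R * (Num.sqrt 2 * (pk * ((expR y * expR (- y)) * expR (- y))))); last by ring.
rewrite e1 mul1r; apply: ler_wpM2l => //.
by apply: ler_wpM2r => //; rewrite mulr_ge0// ltW.
Qed.

End gaussian_moments.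

Section gaussian_variables.
Context (d : measure_display) (T : measurableType d) (R : realType)
        (P : probability T R).
Local Notation mu := (@lebesgue_measure R).
Variables (X : T -> R) (s : R).
Hypotheses (mX : measurable_fun setT X) (s0 : s != 0).
Hypothesis lawX : forall B : set R, measurable B -> P (X @^-1` B) = normal_prob 0 s B.

Lemma normal_law_integral (f : R -> R) : measurable_fun setT f -> (forall x, 0 <= f x) ->
  (\int[P]_w (f (X w))%:E = \int[mu]_x (f x * normal_pdf 0 s x)%:E)%E.
Proof.
move=> mf f0.
have mX' : measurable_fun setT (X : T -> measurableTypeR R) by exact: mX.
have mf' : measurable_fun setT (f : measurableTypeR R -> R) by exact: mf.
pose mXm := isMeasurableFun.Build _ _ _ _ (X : T -> measurableTypeR R) mX'.
pose X' : {mfun T >-> measurableTypeR R} := HB.pack (X : T -> measurableTypeR R) mXm.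
transitivity (\int[distribution P X']_y (f y)%:E)%E.
  by rewrite ge0_integral_distribution//; exact/measurable_EFinP.
transitivity (\int[normal_prob 0 s]_y (f y)%:E)%E.
  by apply: eq_measure_integral => A mA _; rewrite /= -lawX.
rewrite (@ge0_integral_density _ _ _ mu _ (normal_pdf 0 s))//.
- exact: measurable_normal_pdf.
- by move=> x; exact: normal_pdf_ge0.
- exact/measurable_EFinP.
Qed.

Lemma normal_law_even_moment (p : nat) :
  (\int[P]_w (X w ^+ (2 * p))%:E <= ((4 * s ^+ 2) ^+ p * p`!%:R * 2)%:E)%E.
Proof.
rewrite (@normal_law_integral (fun x => x ^+ (2 * p))); last 2 first.
- exact: measurable_funX.
- by move=> x; rewrite exprM exprn_ge0// sqr_ge0.
set c := (X in X%:E).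
have c0 : 0 <= c by rewrite /c !mulr_ge0// exprn_ge0// mulr_ge0// sqr_ge0.
apply: (@le_trans _ _ (\int[mu]_x (c%:E * (normal_pdf 0 (Num.sqrt 2 * s) x)%:E)))%E.
  apply: ge0_le_integral => //.
  - by move=> x _; rewrite lee_fin mulr_ge0 ?normal_pdf_ge0// exprM exprn_ge0// sqr_ge0.
  - apply/measurable_EFinP; apply: measurable_funM; first exact: measurable_funX.
    exact: measurable_normal_pdf.
  - by apply/measurable_EFinP; apply: measurable_funM => //; exact: measurable_normal_pdf.
  - by move=> x _; rewrite -EFinM lee_fin; exact: normal_pdf_moment_le.
rewrite ge0_integralZl//.
- by rewrite integral_normal_pdf mule1.
- by apply/measurable_EFinP; exact: measurable_normal_pdf.
- by move=> x _; rewrite lee_fin normal_pdf_ge0.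
Qed.

Lemma normal_law_all_moments : all_moments P X.
Proof.
split => // p; apply: (@L1_le _ _ _ _ _ (fun w => 1 + X w ^+ (2 * p))).
- by apply: measurable_funX; apply: measurableT_comp.
- move=> w; rewrite ger0_norm ?exprn_ge0// mulnC exprM -(real_normK (num_real (X w ^+ p))).
  rewrite normrX; move: (`|X w| ^+ p) => a; nra.
- apply: L1D; first exact: L1_cst.
  apply: L1_ge0; first exact: measurable_funX.
    by move=> w; rewrite exprM exprn_ge0// sqr_ge0.
  by apply: le_lt_trans (normal_law_even_moment p) _; rewrite ltry.
Qed.

(** At most half of the mass lies within |s|/2 of the origin, because the density is at most 1/(|s|
    sqrt(2 pi)) and sqrt(2 pi) >= 2; elsewhere x^2 >= s^2/4. The covariance of the Brownian motion
    speaks of expectations and not of [s], hence this comparison. *)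
Lemma normal_law_variance_ge : s ^+ 2 / 8 <= mean P (fun w => X w ^+ 2).
Proof.
rewrite -lee_fin -mean_EFin; last first.
  by apply: all_moments_L1; apply: all_momentsX; exact: normal_law_all_moments.
rewrite (@normal_law_integral (fun x => x ^+ 2)); last 2 first.
- exact: measurable_funX.
- by move=> x; rewrite sqr_ge0.
pose I : set R := `[- (`|s| / 2), `|s| / 2]%classic.
have mI : measurable I by exact: measurable_itv.
have sn : 0 < `|s| by rewrite normr_gt0.
pose c := s ^+ 2 / 4; have c0 : 0 < c by rewrite divr_gt0// exprn_even_gt0.
have mpdf : measurable_fun setT (normal_pdf 0 s) by exact: measurable_normal_pdf.
have intI : (\int[mu]_(x in I) (normal_pdf 0 s x)%:E <= (2^-1)%:E)%E.
  apply: (@le_trans _ _ (\int[mu]_(x in I) (normal_peak s)%:E))%E.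
    apply: ge0_le_integral => //.
    - by move=> x _; rewrite lee_fin normal_pdf_ge0.
    - by apply/measurable_EFinP; exact: measurable_funTS.
    - by move=> x _; rewrite lee_fin normal_pdf_ub.
  rewrite /I integral_cst//= lebesgue_measure_itv /= lte_fin.
  have -> : - (`|s| / 2) < `|s| / 2 by lra.
  rewrite -EFinD -EFinM lee_fin /normal_peak opprK -splitr.
  rewrite mulrC ler_pdivrMr; last first.
    by rewrite sqrtr_gt0 pmulrn_lgt0// mulr_gt0 ?pi_gt0// exprn_even_gt0.
  have -> : s ^+ 2 * pi *+ 2 = s ^+ 2 * (pi * 2) by ring.
  rewrite sqrtrM ?sqr_ge0// sqrtr_sqr mulrCA ler_pMr//.
  have : Num.sqrt 4 <= Num.sqrt (pi * 2 : R).
    by rewrite ler_sqrt ?mulr_ge0 ?pi_ge0//; have := pi_ge2 R; lra.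
  have -> : Num.sqrt 4 = 2 :> R by rewrite (_ : 4 = 2 ^+ 2) ?sqrtr_sqr ?ger0_norm//; ring.
  by lra.
have intIc : ((2^-1)%:E <= \int[mu]_(x in ~` I) (normal_pdf 0 s x)%:E)%E.
  have := integral_normal_pdf 0 s.
  rewrite -(setUv I) ge0_integral_setU//; last 4 first.
  - exact: measurableC.
  - by rewrite setUv; exact/measurable_EFinP.
  - by move=> x _; rewrite lee_fin normal_pdf_ge0.
  - exact/disj_setPCl.
  move: intI; case: (\int[mu]_(x in I) _)%E => [a| |]; case: (\int[mu]_(x in ~` I) _)%E => [b| |] //=.
  by rewrite -EFinD => h [h2]; move: h; rewrite !lee_fin; lra.
apply: (@le_trans _ _ (c%:E * \int[mu]_(x in ~` I) (normal_pdf 0 s x)%:E))%E.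
  rewrite (_ : (s ^+ 2 / 8)%:E = (c%:E * (2^-1)%:E)%E).
    by rewrite lee_pmul2l.
  by rewrite -EFinM /c; congr (_%:E); field.
rewrite -ge0_integralZl//; last 4 first.
- exact: measurableC.
- by apply/measurable_EFinP; exact: measurable_funTS.
- by move=> x _; rewrite lee_fin normal_pdf_ge0.
- by rewrite lee_fin ltW.
rewrite integral_mkcond; apply: ge0_le_integral => //.
- by move=> x _; apply: erestrict_ge0 => y _; rewrite mule_ge0// lee_fin ?normal_pdf_ge0// ltW.
- apply/(measurable_restrictT _ _).1; first exact: measurableC.
  by apply/measurable_EFinP; apply: measurable_funM => //; exact: measurable_funTS.
- by apply/measurable_EFinP; apply: measurable_funM => //; exact: measurable_funX.
move=> x _; rewrite patchE; case: ifPn => [|_]; last first.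
  by rewrite lee_fin mulr_ge0 ?sqr_ge0 ?normal_pdf_ge0.
rewrite inE /I /= in_itv /= => /negP xI; rewrite -EFinM lee_fin.
apply: ler_wpM2r; first exact: normal_pdf_ge0.
rewrite /c (_ : s ^+ 2 / 4 = (`|s| / 2) ^+ 2); last first.
  by rewrite exprMn real_normK ?num_real//; congr (_ * _); field.
have {xI} : ~~ (`|x| <= `|s| / 2) by rewrite ler_norml.
rewrite -ltNge => /ltW h.
by rewrite -(real_normK (num_real x)) lerXn2r// ?nnegrE ?divr_ge0.
Qed.

(** By symmetry of the density, E|X| is twice the integral over the positive half line, which is E(X
    + |X|). The detour keeps all integrands nonnegative, as [normal_law_integral] requires. *)
Lemma normal_law_mean : mean P X = 0.
Proof.
have hX := all_moments_L1 normal_law_all_moments.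
have haX := L1_norm hX.
have mabs : measurable_fun setT (fun x : R => `|x|) by exact: measurableT_comp.
have e1 := normal_law_integral mabs (fun x => normr_ge0 x).
have e2 : (\int[P]_w ((X w + `|X w|) / 2)%:E =
    \int[mu]_x (((x + `|x|) / 2) * normal_pdf 0 s x)%:E)%E.
  apply: (@normal_law_integral (fun x => (x + `|x|) / 2)).
    by apply: measurable_funM => //; apply: measurable_funD.
  by move=> x; rewrite divr_ge0// -lerBlDl sub0r -normrN ler_norm.
have e3 : (\int[mu]_x (((x + `|x|) / 2) * normal_pdf 0 s x)%:E =
    \int[mu]_(x in [set x | (0 <= x)%R]) (`|x| * normal_pdf 0 s x)%:E)%E.
  rewrite [RHS]integral_mkcond; apply: eq_integral => x _; rewrite patchE.
  case: ifPn; rewrite ?notin_setE ?inE /= => x0.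
    by rewrite ger0_norm// mulrDl -splitr.
  by rewrite ltr0_norm ?subrr ?mul0r// ltNge; apply/negP.
have e4 := @ge0_symfun_integralT R (fun x => `|x| * normal_pdf 0 s x).
rewrite e4 in e1; last 3 first.
- by move=> x; rewrite mulr_ge0// normal_pdf_ge0.
- move=> x; apply: cvgM; first exact: norm_continuous.
  exact: continuous_normal_pdf.
- by move=> x /=; rewrite normrN !normal_pdfE// /normal_fun !subr0 sqrrN.
rewrite -e3 -e2 mean_EFin// in e1.
have e5 : L1 P (fun w => (X w + `|X w|) / 2).
  have -> : (fun w => (X w + `|X w|) / 2) = (fun w => 2^-1 * (X w + `|X w|)).
    by apply/funext => w; rewrite mulrC.
  by apply: L1Z; apply: L1D.
rewrite mean_EFin// -EFinM in e1; case: e1 => e1.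
have e6 : mean P (fun w => (X w + `|X w|) / 2) = 2^-1 * (mean P X + mean P (fun w => `|X w|)).
  rewrite -meanD// -meanZ; last exact: L1D.
  by apply: eq_Rintegral => w _; rewrite mulrC.
rewrite e6 in e1; lra.
Qed.

(* The sharp constant is 3. *)
Lemma normal_law_fourth_moment :
  mean P (fun w => X w ^+ 4) <= 4096 * mean P (fun w => X w ^+ 2) ^+ 2.
Proof.
(* (4 s^2)^2 * 2! * 2 = 64 s^4, and s^2 is at most 8 times the variance, whence 64 * 8^2 = 4096. *)
have h4 : mean P (fun w => X w ^+ 4) <= 64 * s ^+ 4.
  rewrite -lee_fin -mean_EFin; last first.
    by apply: all_moments_L1; apply: all_momentsX; exact: normal_law_all_moments.
  apply: le_trans (normal_law_even_moment 2) _.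
  by rewrite lee_fin exprMn -exprM !factS fact0 /=; nra.
have h2 := normal_law_variance_ge.
apply: le_trans h4 _.
have : 0 <= s ^+ 2 by rewrite sqr_ge0.
have -> : s ^+ 4 = (s ^+ 2) ^+ 2 by rewrite -exprM.
move: h2; move: (s ^+ 2) (mean _ _) => a b; nra.
Qed.

End gaussian_variables.

Lemma centered_gaussian_moments (d : measure_display) (T : measurableType d) (R : realType)
    (P : probability T R) (X : T -> R) : centered_gaussian P X ->
  [/\ all_moments P X, mean P X = 0 &
  mean P (fun w => X w ^+ 4) <= 4096 * mean P (fun w => X w ^+ 2) ^+ 2].
Proof.
move=> [mX [X0|[s s0 law]]]; last first.
  by split; [exact: normal_law_all_moments law | exact: normal_law_mean law
            | exact: normal_law_fourth_moment law].
(* The degenerate case reduces to integrals of f(X) with f(0) = 0, which vanish. *)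
have int0 (f : R -> R) : measurable_fun setT f -> f 0 = 0 -> (forall x, 0 <= f x) ->
   (\int[P]_w (f (X w))%:E = 0)%E.
  move=> mf f0 fge0; rewrite (@ge0_ae_eq_integral _ _ _ _ _ _ (cst 0%E))//.
  - by rewrite integral0.
  - exact/measurable_EFinP/measurableT_comp.
  - by move=> w _; rewrite lee_fin.
  - by case: X0 => N [mN N0 sN]; exists N; split => // w /= h; apply: sN => /= Xw; apply: h; rewrite Xw f0.
have hX : all_moments P X.
  split => // -[|p]; first by under eq_fun do rewrite expr0; exact: L1_cst.
  apply: L1_ge0; first by apply: measurable_funX; apply: measurableT_comp.
    by move=> w; rewrite exprn_ge0.
  rewrite (int0 (fun x => `|x| ^+ p.+1)) ?ltry//.
  - by apply: measurable_funX.
  - by rewrite normr0 expr0n.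
split => //.
  apply/normr0_eq0/eqP; rewrite eq_le normr_ge0 andbT.
  apply: (le_trans (mean_norm (all_moments_L1 hX))).
  by rewrite /mean /Rintegral (int0 (fun x => `|x|)) ?normr0.
rewrite /mean /Rintegral (int0 (fun x => x ^+ 4)) /=.
- by apply: mulr_ge0; [exact: ler0n|exact: sqr_ge0].
- exact: measurable_funX.
- by rewrite expr0n.
- by move=> x; rewrite -[4%N]/(2 * 2)%N exprM sqr_ge0.
Qed.

(** * Elementary integrals of scalar Brownian motion *)

Section brownian_integral.
Context (d : measure_display) (T : measurableType d) (R : realType)
        (P : probability T R) (F : R -> set (set T)).
Hypothesis hF : filtration F.
Implicit Types (X Y : T -> R).

Lemma filtration_sigmaE t : 0 <= t -> <<s F t >> = F t.
Proof. by move=> t0; apply: sigma_algebra_id; exact: filtration_sigma. Qed.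

Lemma filtration_sigma_sub t : 0 <= t -> <<s F t >> `<=` measurable.
Proof. by move=> t0; rewrite filtration_sigmaE//; exact: filtration_measurable. Qed.

Lemma mfun_wrt_le s t X : 0 <= s -> s <= t -> mfun_wrt (F s) X -> mfun_wrt (F t) X.
Proof.
move=> s0 st; apply: mfun_wrt_mono.
rewrite !filtration_sigmaE//; last exact: le_trans st.
exact: filtration_mono.
Qed.

(** The sigma-algebra [G] is kept as a witness so that powers of a variable measurable for it
    inherit the independence from the past. *)
Definition indep_future s Y :=
  exists G, [/\ <<s G >> `<=` measurable, indep_classes P G (F s) & mfun_wrt G Y].

Lemma indep_future_mul s X Y : 0 <= s -> indep_future s X -> mfun_wrt (F s) Y ->
  L1 P X -> L1 P Y ->
  L1 P (fun w => X w * Y w) /\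
  mean P (fun w => X w * Y w) = mean P X * mean P Y.
Proof.
move=> s0 [G [sG iG mX]] mY; apply: (indep_mul sG _ iG) => //.
exact: filtration_sigma_sub.
Qed.

Lemma indep_future_L2 s X Y : 0 <= s -> indep_future s X -> mfun_wrt (F s) Y ->
  L2 P X -> L2 P Y -> L2 P (fun w => X w * Y w).
Proof.
move=> s0 [G [sG iG mX]] mY [mX' hX] [mY' hY].
split; first exact: measurable_funM.
have -> : (fun w => (X w * Y w) ^+ 2) = (fun w => X w ^+ 2 * Y w ^+ 2).
  by apply/funext => w; rewrite exprMn.
apply: (indep_mul sG _ iG _ _ hX hY).1 => //; first exact: filtration_sigma_sub.
- exact: (@measurable_funX _ (g_sigma_algebraType G)).
- exact: (@measurable_funX _ (g_sigma_algebraType (F s))).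
Qed.

(** Gaussianity is replaced by what the isometry consumes: adaptedness, independence of the past,
    moments, mean and variance of increments. The rate [c] is free, as the entries of H do not have
    rate 1 in general. *)
Record brownian_motion (c : R) (B : R -> T -> R) : Prop := BrownianMotion {
  brownian_adapted : forall t, 0 <= t -> mfun_wrt (F t) (B t);
  brownian_indep : forall s t, 0 <= s -> s <= t ->
    indep_future s (fun w => B t w - B s w);
  brownian_moments : forall s t, 0 <= s -> s <= t ->
    all_moments P (fun w => B t w - B s w);
  brownian_mean : forall s t, 0 <= s -> s <= t ->
    mean P (fun w => B t w - B s w) = 0;
  brownian_variance : forall s t, 0 <= s -> s <= t ->
    mean P (fun w => (B t w - B s w) ^+ 2) = c * (t - s)
}.

(** The length of the intersection of [a, b] and [a', b'], thus the covariance of the two increments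
    at unit rate. *)
Definition overlap (a b a' b' : R) : R := Num.max 0 (Num.min b b' - Num.max a a').

Variables (c : R) (B : R -> T -> R).
Hypothesis hB : brownian_motion c B.

Let incr_L2 s t : 0 <= s -> s <= t -> L2 P (fun w => B t w - B s w).
Proof. by move=> s0 st; apply/all_moments_L2/(brownian_moments hB). Qed.

Let incr_wrt s t : 0 <= s -> s <= t -> mfun_wrt (F t) (fun w => B t w - B s w).
Proof.
move=> s0 st; apply: (@measurable_funB _ (g_sigma_algebraType (F t))).
  by apply: (brownian_adapted hB); exact: le_trans st.
by apply: (mfun_wrt_le s0 st); exact: (brownian_adapted hB).
Qed.

Lemma brownian_piece_L2 s t X : 0 <= s -> s <= t -> mfun_wrt (F s) X -> L2 P X ->
  L2 P (fun w => (B t w - B s w) * X w).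
Proof.
move=> s0 st mX hX; apply: (indep_future_L2 s0) => //.
- exact: (brownian_indep hB).
- exact: incr_L2.
Qed.

Let future_zero s t Z : 0 <= s -> s <= t -> mfun_wrt (F s) Z -> L1 P Z ->
  mean P (fun w => (B t w - B s w) * Z w) = 0.
Proof.
move=> s0 st mZ hZ.
have [_ ->] := indep_future_mul s0 (brownian_indep hB s0 st) mZ
  (L2_L1 (incr_L2 s0 st)) hZ.
by rewrite (brownian_mean hB)// mul0r.
Qed.

Let mulwrt t X Y : mfun_wrt (F t) X -> mfun_wrt (F t) Y -> mfun_wrt (F t) (fun w => X w * Y w).
Proof. exact: (@measurable_funM _ (g_sigma_algebraType (F t))). Qed.

Let piece_wrt s t u X : 0 <= s -> s <= t -> t <= u -> mfun_wrt (F s) X ->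
  mfun_wrt (F u) (fun w => (B t w - B s w) * X w).
Proof.
move=> s0 st tu mX; apply: (@mfun_wrt_le t) => //; first exact: le_trans st.
apply: mulwrt; first exact: incr_wrt.
exact: (mfun_wrt_le s0 st).
Qed.

(* Both increments start at [s], so the part of the longer one beyond the end
   of the shorter one is independent of everything else. *)
Let same_start s b b' X Y : 0 <= s -> s <= b -> b <= b' ->
  mfun_wrt (F s) X -> mfun_wrt (F s) Y -> L2 P X -> L2 P Y ->
  mean P (fun w => ((B b w - B s w) * X w) * ((B b' w - B s w) * Y w)) =
  c * (b - s) * mean P (fun w => X w * Y w).
Proof.
move=> s0 sb bb' mX mY hX hY.
have b0 := le_trans s0 sb.
have hXY := L2M hX hY.
have [h1 e1] : L1 P (fun w => (B b w - B s w) ^+ 2 * (X w * Y w)) /\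
  mean P (fun w => (B b w - B s w) ^+ 2 * (X w * Y w)) =
  c * (b - s) * mean P (fun w => X w * Y w).
  rewrite -(brownian_variance hB)//; apply: (indep_future_mul s0) => //.
  - have [G [sG iG mG]] := brownian_indep hB s0 sb; exists G; split => //.
    exact: (@measurable_funX _ (g_sigma_algebraType G)).
  - exact: mulwrt.
  - by case: (incr_L2 s0 sb).
have hZ : L1 P (fun w => ((B b w - B s w) * X w) * Y w).
  by apply: L2M => //; apply: brownian_piece_L2.
have e2 := @future_zero b b' (fun w => ((B b w - B s w) * X w) * Y w) b0 bb'.
rewrite -e1 -[RHS]addr0 -e2//; last first.
  apply: mulwrt; last exact: (mfun_wrt_le s0 sb).
  exact: piece_wrt.
rewrite -meanD//; last first.
  have := indep_future_mul b0 (brownian_indep hB b0 bb') _ (L2_L1 (incr_L2 b0 bb')) hZ.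
  case=> //; apply: mulwrt; last exact: (mfun_wrt_le s0 sb).
  exact: piece_wrt.
by apply: eq_Rintegral => w _; ring.
Qed.

(** Cut the first increment at a'. What precedes is known at time a', hence uncorrelated with the
    second increment; the rest starts where the second one does, and [same_start] applies. *)
Let pair_le a b a' b' X Y : 0 <= a -> a <= b -> a <= a' -> a' <= b' ->
  mfun_wrt (F a) X -> mfun_wrt (F a') Y -> L2 P X -> L2 P Y ->
  mean P (fun w => ((B b w - B a w) * X w) * ((B b' w - B a' w) * Y w)) =
  c * overlap a b a' b' * mean P (fun w => X w * Y w).
Proof.
move=> a0 ab aa' a'b' mX mY hX hY; have a'0 := le_trans a0 aa'.
rewrite /overlap (max_idPr aa').
have [ba'|a'b] := leP b a'.
  rewrite (min_idPl (le_trans ba' a'b')) (max_idPl _) ?subr_le0// mulr0 mul0r.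
  rewrite -[RHS](@future_zero a' b' (fun w => ((B b w - B a w) * X w) * Y w) a'0 a'b').
  - by apply: eq_Rintegral => w _; ring.
  - by apply: mulwrt => //; exact: piece_wrt.
  - by apply: L2M => //; exact: brownian_piece_L2.
have {}a'b := ltW a'b.
have mX' := mfun_wrt_le a0 aa' mX.
have -> : Num.max 0 (Num.min b b' - a') = Num.min b b' - a'.
  by rewrite (max_idPr _)// subr_ge0 le_min a'b.
have hP := brownian_piece_L2 a'0 a'b' mY hY.
have h1 : L1 P (fun w => ((B a' w - B a w) * X w) * ((B b' w - B a' w) * Y w)).
  by apply: L2M => //; exact: brownian_piece_L2.
have h2 : L1 P (fun w => ((B b w - B a' w) * X w) * ((B b' w - B a' w) * Y w)).
  by apply: L2M => //; exact: brownian_piece_L2.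
have e1 : mean P (fun w => ((B a' w - B a w) * X w) * ((B b' w - B a' w) * Y w)) = 0.
  rewrite -[RHS](@future_zero a' b' (fun w => ((B a' w - B a w) * X w) * Y w) a'0 a'b').
  - by apply: eq_Rintegral => w _; ring.
  - by apply: mulwrt => //; exact: piece_wrt.
  - by apply: L2M => //; exact: brownian_piece_L2.
transitivity (mean P (fun w => ((B b w - B a' w) * X w) * ((B b' w - B a' w) * Y w))).
  rewrite -[RHS]add0r -e1 -meanD//.
  by apply: eq_Rintegral => w _; ring.
have [bb'|/ltW b'b] := leP b b'; first exact: same_start.
rewrite -(_ : mean P (fun w => Y w * X w) = mean P (fun w => X w * Y w)); last first.
  by apply: eq_Rintegral => w _; ring.
rewrite -(@same_start a' b' b)//.
by apply: eq_Rintegral => w _; ring.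
Qed.

Lemma brownian_pieces a b a' b' X Y : 0 <= a -> a <= b -> 0 <= a' -> a' <= b' ->
  mfun_wrt (F a) X -> mfun_wrt (F a') Y -> L2 P X -> L2 P Y ->
  mean P (fun w => ((B b w - B a w) * X w) * ((B b' w - B a' w) * Y w)) =
  c * overlap a b a' b' * mean P (fun w => X w * Y w).
Proof.
move=> a0 ab a'0 a'b' mX mY hX hY; have [aa'|/ltW a'a] := leP a a'.
  exact: pair_le.
rewrite (_ : overlap a b a' b' = overlap a' b' a b); last first.
  by rewrite /overlap (minC b) (maxC a).
rewrite -(_ : mean P (fun w => Y w * X w) = mean P (fun w => X w * Y w)); last first.
  by apply: eq_Rintegral => w _; ring.
rewrite -pair_le//.
by apply: eq_Rintegral => w _; ring.
Qed.

(** The intervals may overlap in any way: two elementary integrals with different knots can then be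
    compared directly, without a common refinement. *)
Lemma brownian_isometry (I : finType) (a b : I -> R) (X : I -> T -> R) :
  (forall i, 0 <= a i) -> (forall i, a i <= b i) ->
  (forall i, mfun_wrt (F (a i)) (X i)) -> (forall i, L2 P (X i)) ->
  mean P (fun w => (\sum_i (B (b i) w - B (a i) w) * X i w) ^+ 2) =
  c * mean P (fun w => \sum_i \sum_j overlap (a i) (b i) (a j) (b j) * (X i w * X j w)).
Proof.
move=> a0 ab mX hX.
have -> : (fun w => (\sum_i (B (b i) w - B (a i) w) * X i w) ^+ 2) =
  (fun w => \sum_i \sum_j ((B (b i) w - B (a i) w) * X i w) *
                          ((B (b j) w - B (a j) w) * X j w)).
  apply/funext => w; rewrite expr2 mulr_suml; apply: eq_bigr => i _.
  by rewrite mulr_sumr.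
have hXX i j : L1 P (fun w => overlap (a i) (b i) (a j) (b j) * (X i w * X j w)).
  by apply: L1Z; exact: L2M.
have hP i j : L1 P (fun w => ((B (b i) w - B (a i) w) * X i w) *
                          ((B (b j) w - B (a j) w) * X j w)).
  by apply: L2M; exact: brownian_piece_L2.
rewrite !mean_sum; try by move=> i _; apply: L1_sum.
rewrite mulr_sumr; apply: eq_bigr => i _.
rewrite !mean_sum// mulr_sumr; apply: eq_bigr => j _.
by rewrite brownian_pieces// meanZ ?mulrA//; exact: L2M.
Qed.

End brownian_integral.

(** * Time integrals of squared step functions *)

Section step_functions.
Context (R : realType).
Local Notation mu := (@lebesgue_measure R).

Definition on_interval (a b s : R) : R := (a <= s < b)%R%:R.

Lemma on_interval_indic a b : on_interval a b = \1_(`[a, b[%classic).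
Proof.
apply/funext => s; rewrite /on_interval indicE.
by rewrite (_ : (s \in _) = (a <= s < b)%R)// mem_setE in_itv.
Qed.

Lemma measurable_on_interval a b : measurable_fun setT (on_interval a b).
Proof. by rewrite on_interval_indic; exact: measurable_indic. Qed.

Lemma on_intervalM a b a' b' s : on_interval a b s * on_interval a' b' s =
  on_interval (Num.max a a') (Num.min b b') s.
Proof.
rewrite /on_interval -natrM mulnb; congr (_%:R).
by rewrite ge_max lt_min; case: (a <= s); case: (a' <= s); case: (s < b); case: (s < b').
Qed.

Lemma integral_on_interval a b r : 0 <= a -> b <= r ->
  mu.-integrable `[0, r]%classic (EFin \o on_interval a b) /\
  (\int[mu]_(s in `[0%R, r]) (on_interval a b s)%:E = (Num.max 0 (b - a))%:E)%E.
Proof.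
move=> a0 br.
have e : (\int[mu]_(s in `[0%R, r]) (on_interval a b s)%:E = (Num.max 0 (b - a))%:E)%E.
  rewrite on_interval_indic integral_indic// setIidl; last first.
    move=> s /=; rewrite !in_itv /= => /andP[h1 h2].
    by rewrite (le_trans a0 h1) (le_trans (ltW h2) br).
  rewrite /= lebesgue_measure_itv /= lte_fin.
  by case: ltP => h; [rewrite (max_idPr _) ?subr_ge0 ?ltW// | rewrite (max_idPl _) ?subr_le0].
split => //.
apply/integrableP; split.
  apply/measurable_EFinP; apply: measurable_funTS; exact: measurable_on_interval.
under eq_integral do rewrite /= ger0_norm ?ler0n//.
by rewrite e ltry.
Qed.

(** Products of indicators of intervals are indicators of intersections, so the quadratic form in
    the overlaps is the one of [brownian_isometry]; equating the two gives the Ito isometry. *)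
Lemma integral_step_square (I : finType) (a b x : I -> R) r :
  (forall i, 0 <= a i) -> (forall i, b i <= r) ->
  (\int[mu]_(s in `[0%R, r]) ((\sum_i on_interval (a i) (b i) s * x i) ^+ 2)%:E =
   (\sum_i \sum_j overlap (a i) (b i) (a j) (b j) * (x i * x j))%:E)%E.
Proof.
move=> a0 br.
have ij i j := @integral_on_interval (Num.max (a i) (a j)) (Num.min (b i) (b j)) r.
have mI : measurable (`[0, r]%classic : set (measurableTypeR R)) by exact: measurable_itv.
have int1 i j : mu.-integrable `[0, r]%classic
    (EFin \o (fun s => on_interval (Num.max (a i) (a j)) (Num.min (b i) (b j)) s)).
  by case: (ij i j) => //; rewrite ?le_max ?a0// ge_min br.
have int2 i j : mu.-integrable `[0, r]%classic
    (fun s => ((x i * x j) * on_interval (Num.max (a i) (a j)) (Num.min (b i) (b j)) s)%:E).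
  have h := integrableZl mI (x i * x j) (int1 i j).
  by apply: eq_integrable h => // s _; rewrite /= EFinM.
have -> : (\int[mu]_(s in `[0%R, r]) ((\sum_i on_interval (a i) (b i) s * x i) ^+ 2)%:E =
  \int[mu]_(s in `[0%R, r]) (\sum_i \sum_j
   ((x i * x j) * on_interval (Num.max (a i) (a j)) (Num.min (b i) (b j)) s)%:E))%E.
  apply: eq_integral => s _; rewrite expr2 mulr_suml -sumEFin; apply: eq_bigr => i _.
  rewrite mulr_sumr -sumEFin; apply: eq_bigr => j _.
  by rewrite -on_intervalM; congr (_%:E); ring.
rewrite integral_sum//; last by move=> i; apply: integrable_sum.
rewrite -sumEFin; apply: eq_bigr => i _.
rewrite integral_sum// -sumEFin; apply: eq_bigr => j _.
have -> : (overlap (a i) (b i) (a j) (b j) * (x i * x j))%:E =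
   ((x i * x j)%:E * (overlap (a i) (b i) (a j) (b j))%:E)%E.
  by rewrite -EFinM mulrC.
have [||_ e] := ij i j; rewrite ?le_max ?a0// ?ge_min ?br//.
rewrite /overlap -e.
under eq_integral do rewrite EFinM.
exact: (integralZl mI (int1 i j)).
Qed.

End step_functions.

(** * Complex entries and the Frobenius norm *)

Section complex_entries.
Context (R : realType).
Implicit Types (x y z : R[i]).

Lemma ReD x y : Re (x + y) = Re x + Re y. Proof. by case: x; case: y. Qed.
Lemma ImD x y : Im (x + y) = Im x + Im y. Proof. by case: x; case: y. Qed.
Lemma ReN x : Re (- x) = - Re x. Proof. by case: x. Qed.
Lemma ImN x : Im (- x) = - Im x. Proof. by case: x. Qed.
Lemma ReB x y : Re (x - y) = Re x - Re y. Proof. by rewrite ReD ReN. Qed.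
Lemma ImB x y : Im (x - y) = Im x - Im y. Proof. by rewrite ImD ImN. Qed.
Lemma Re_mul x y : Re (x * y) = Re x * Re y - Im x * Im y.
Proof. by case: x; case: y. Qed.
Lemma Im_mul x y : Im (x * y) = Re x * Im y + Im x * Re y.
Proof. by case: x => a b; case: y => a' b' /=; rewrite addrC [b * _]mulrC addrC. Qed.
Lemma Re_sum I (s : seq I) (Q : pred I) (x : I -> R[i]) :
  Re (\sum_(i <- s | Q i) x i) = \sum_(i <- s | Q i) Re (x i).
Proof.
elim: s => [|i s ih]; first by rewrite !big_nil.
by rewrite !big_cons; case: ifP => _ //; rewrite ReD ih.
Qed.
Lemma Im_sum I (s : seq I) (Q : pred I) (x : I -> R[i]) :
  Im (\sum_(i <- s | Q i) x i) = \sum_(i <- s | Q i) Im (x i).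
Proof.
elim: s => [|i s ih]; first by rewrite !big_nil.
by rewrite !big_cons; case: ifP => _ //; rewrite ImD ih.
Qed.

Lemma complex_ext x y : Re x = Re y -> Im x = Im y -> x = y.
Proof. by case: x => a b; case: y => a' b' /= -> ->. Qed.

Lemma conjCE z : Num.conj z = Complex (Re z) (- Im z).
Proof. by case: z. Qed.

Lemma sqmodE z : sqmod z = Re z ^+ 2 + Im z ^+ 2.
Proof.
case: z => a b; rewrite /sqmod /ComplexField.Normc.normc sqr_sqrtr//.
by rewrite addr_ge0// sqr_ge0.
Qed.

Lemma sqmod_ge0 z : 0 <= sqmod z. Proof. exact: sqr_ge0. Qed.

Lemma sqmodM x y : sqmod (x * y) = sqmod x * sqmod y.
Proof. by rewrite !sqmodE Re_mul Im_mul; ring. Qed.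

Lemma sqmodD x y : sqmod (x + y) <= 2 * (sqmod x + sqmod y).
Proof.
rewrite !sqmodE ReD ImD; have := sqr_ge0 (Re x - Re y); have := sqr_ge0 (Im x - Im y).
nra.
Qed.

(** Cauchy-Schwarz against the constant 1, from the sum of (x_i - x_j)^2 over all pairs. *)
Lemma sqr_sum_le (I : finType) (x : I -> R) :
  (\sum_i x i) ^+ 2 <= #|I|%:R * \sum_i x i ^+ 2.
Proof.
have h : 0 <= \sum_i \sum_j (x i - x j) ^+ 2.
  by apply: sumr_ge0 => i _; apply: sumr_ge0 => j _; exact: sqr_ge0.
have e : \sum_i \sum_j (x i - x j) ^+ 2 =
   2 * (#|I|%:R * \sum_i x i ^+ 2 - (\sum_i x i) ^+ 2).
  have -> : \sum_i \sum_j (x i - x j) ^+ 2 =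
     \sum_i ((#|I|%:R * x i ^+ 2 + \sum_j x j ^+ 2) + (- 2 * \sum_j x j) * x i).
    apply: eq_bigr => i _.
    rewrite (eq_bigr (fun j => (x i ^+ 2 + x j ^+ 2) + (- 2 * x i) * x j)); last first.
      by move=> j _; ring.
    by rewrite !big_split /= sumr_const -mulr_sumr -[_ *+ #|_|]mulr_natl; ring.
  rewrite !big_split /= -!mulr_sumr sumr_const -mulr_natl; ring.
by move: h; rewrite e; lra.
Qed.

End complex_entries.

Section frobenius.
Context (R : realType) (m : nat).
Local Notation M := 'M[R[i]]_m.
Implicit Types (A B : M).

Lemma frob2_ge0 A : 0 <= frob2 A.
Proof. by apply: sumr_ge0 => a _; apply: sumr_ge0 => b _; exact: sqmod_ge0. Qed.

Lemma frob2D A B : frob2 (A + B) <= 2 * (frob2 A + frob2 B).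
Proof.
rewrite /frob2 -big_split /= mulr_sumr; apply: ler_sum => a _.
rewrite -big_split /= mulr_sumr; apply: ler_sum => b _.
by rewrite mxE; exact: sqmodD.
Qed.

Lemma frob2Z z A : frob2 (z *: A) = sqmod z * frob2 A.
Proof.
rewrite /frob2 mulr_sumr; apply: eq_bigr => a _.
by rewrite mulr_sumr; apply: eq_bigr => b _; rewrite mxE sqmodM.
Qed.

Lemma frob2N A : frob2 (- A) = frob2 A.
Proof. by rewrite -scaleN1r frob2Z sqmodE /= oppr0 sqrrN expr1n expr0n addr0 mul1r. Qed.

Lemma frob2B A B : frob2 (A - B) <= 2 * (frob2 A + frob2 B).
Proof. by rewrite -(frob2N B); exact: frob2D. Qed.

Lemma frob2_sub_sym A B : frob2 (A - B) = frob2 (B - A).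
Proof. by rewrite -frob2N opprB. Qed.

Lemma sqmod_le_frob2 A a b : sqmod (A a b) <= frob2 A.
Proof.
rewrite /frob2 (bigD1 a)//= (bigD1 b)//= -addrA lerDl addr_ge0//.
  by apply: sumr_ge0 => c _; exact: sqmod_ge0.
by apply: sumr_ge0 => c _; apply: sumr_ge0 => e _; exact: sqmod_ge0.
Qed.

Lemma frob2_real A : frob2 A = \sum_a \sum_b (Re (A a b) ^+ 2 + Im (A a b) ^+ 2).
Proof. by apply: eq_bigr => a _; apply: eq_bigr => b _; rewrite sqmodE. Qed.

Lemma hermsymm_entries A a b : A \is hermsymmx ->
  Re (A a b) = Re (A b a) /\ Im (A a b) = - Im (A b a).
Proof.
by move=> /is_hermitianmxP; rewrite expr0 scale1r => {1 3}->; rewrite !mxE conjCE.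
Qed.

Lemma hermsymm_intro A :
  (forall a b, Re (A a b) = Re (A b a)) -> (forall a b, Im (A a b) = - Im (A b a)) ->
  A \is hermsymmx.
Proof.
move=> hr hi; apply/is_hermitianmxP; rewrite expr0 scale1r; apply/matrixP => a b.
by rewrite !mxE conjCE; apply: complex_ext => /=.
Qed.

(** Pairing a Hermitian matrix with these reads off 2 m times the real or the imaginary part of an
    entry. The law of H is given through such pairings only. *)
Definition herm_re (a b : 'I_m) : M := delta_mx a b + delta_mx b a.
Definition herm_im (a b : 'I_m) : M :=
  (Complex 0 1 : R[i]) *: (delta_mx a b - delta_mx b a).

Lemma delta_mx_Re (a b c e : 'I_m) :
  Re ((delta_mx a b : M) c e) = ((c == a) && (e == b))%:R.
Proof. by rewrite mxE; case: (_ && _). Qed.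

Lemma delta_mx_Im (a b c e : 'I_m) : Im ((delta_mx a b : M) c e) = 0.
Proof. by rewrite mxE; case: (_ && _). Qed.

Lemma herm_re_Re a b c e : Re (herm_re a b c e) =
  ((c == a) && (e == b))%:R + ((c == b) && (e == a))%:R.
Proof. by rewrite mxE ReD !delta_mx_Re. Qed.
Lemma herm_re_Im a b c e : Im (herm_re a b c e) = 0.
Proof. by rewrite mxE ImD !delta_mx_Im addr0. Qed.
Lemma herm_imE a b c e : herm_im a b c e =
  Complex 0 1 * ((delta_mx a b : M) c e - (delta_mx b a : M) c e).
Proof. by rewrite !mxE. Qed.
Lemma herm_im_Re a b c e : Re (herm_im a b c e) = 0.
Proof. by rewrite herm_imE Re_mul ImB !delta_mx_Im subrr mul0r mulr0 subr0. Qed.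
Lemma herm_im_Im a b c e : Im (herm_im a b c e) =
  ((c == a) && (e == b))%:R - ((c == b) && (e == a))%:R.
Proof. by rewrite herm_imE Im_mul ReB !delta_mx_Re mul0r add0r mul1r. Qed.

Lemma herm_re_herm a b : herm_re a b \is hermsymmx.
Proof.
apply: hermsymm_intro => c e; rewrite ?herm_re_Re ?herm_re_Im ?oppr0//.
by rewrite addrC (andbC (c == b)) (andbC (c == a)).
Qed.

Lemma herm_im_herm a b : herm_im a b \is hermsymmx.
Proof.
apply: hermsymm_intro => c e; rewrite ?herm_im_Re ?herm_im_Im//.
by rewrite opprB (andbC (c == b)) (andbC (c == a)).
Qed.

Lemma herm_dotE A B : herm_dot A B = m%:R * \sum_a \sum_b
  (Re (A a b) * Re (B b a) - Im (A a b) * Im (B b a)).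
Proof.
rewrite /herm_dot /mxtrace Re_sum; congr (_ * _); apply: eq_bigr => a _.
by rewrite mxE Re_sum; apply: eq_bigr => b _; rewrite Re_mul.
Qed.

Lemma sum_delta2 (g : 'I_m -> 'I_m -> R) a b :
  \sum_c \sum_e ((c == a) && (e == b))%:R * g c e = g a b.
Proof.
rewrite (bigD1 a)//= (bigD1 b)//= !eqxx mul1r !big1 ?addr0// => [c ca|e eb].
  by rewrite big1// => e _; rewrite (negbTE ca) mul0r.
by rewrite (negbTE eb) andbF mul0r.
Qed.

Lemma herm_dot_re a b B : B \is hermsymmx ->
  herm_dot (herm_re a b) B = m%:R * (2 * Re (B a b)).
Proof.
move=> hB; rewrite herm_dotE; congr (_ * _).
transitivity (\sum_c \sum_e (((c == a) && (e == b))%:R * Re (B e c) +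
                ((c == b) && (e == a))%:R * Re (B e c))).
  apply: eq_bigr => c _; apply: eq_bigr => e _.
  by rewrite herm_re_Re herm_re_Im mul0r subr0 mulrDl.
under eq_bigr do rewrite big_split /=.
rewrite big_split /= !sum_delta2 (hermsymm_entries b a hB).1.
ring.
Qed.

Lemma herm_dot_im a b B : B \is hermsymmx ->
  herm_dot (herm_im a b) B = m%:R * (2 * Im (B a b)).
Proof.
move=> hB; rewrite herm_dotE; congr (_ * _).
transitivity (\sum_c \sum_e (((c == a) && (e == b))%:R * (- Im (B e c)) +
                ((c == b) && (e == a))%:R * Im (B e c))).
  apply: eq_bigr => c _; apply: eq_bigr => e _.
  by rewrite herm_im_Re herm_im_Im mul0r; ring.
under eq_bigr do rewrite big_split /=.
rewrite big_split /= !sum_delta2 (hermsymm_entries b a hB).2.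
ring.
Qed.

Lemma herm_dotBr A B C : herm_dot A (B - C) = herm_dot A B - herm_dot A C.
Proof. by rewrite /herm_dot mulmxBr raddfB /= ReB mulrBr. Qed.

Lemma herm_dotNl A B : herm_dot (- A) B = - herm_dot A B.
Proof. by rewrite /herm_dot mulNmx raddfN /= ReN mulrN. Qed.

End frobenius.

(** * Increments of Hermitian Brownian motion *)

Section measurability_wrt.
Context (d : measure_display) (T : measurableType d) (R : realType) (G : set (set T)).
Implicit Types X Y : T -> R.

Lemma mfun_wrt_cst c : mfun_wrt G (fun=> c : R).
Proof. exact: (@measurable_cst _ _ (g_sigma_algebraType G)). Qed.

Lemma mfun_wrtD X Y : mfun_wrt G X -> mfun_wrt G Y -> mfun_wrt G (fun w => X w + Y w).
Proof. exact: (@measurable_funD _ (g_sigma_algebraType G)). Qed.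

Lemma mfun_wrtB X Y : mfun_wrt G X -> mfun_wrt G Y -> mfun_wrt G (fun w => X w - Y w).
Proof. exact: (@measurable_funB _ (g_sigma_algebraType G)). Qed.

Lemma mfun_wrtM X Y : mfun_wrt G X -> mfun_wrt G Y -> mfun_wrt G (fun w => X w * Y w).
Proof. exact: (@measurable_funM _ (g_sigma_algebraType G)). Qed.

Lemma mfun_wrtX p X : mfun_wrt G X -> mfun_wrt G (fun w => X w ^+ p).
Proof. exact: (@measurable_funX _ (g_sigma_algebraType G)). Qed.

Lemma mfun_wrtN X : mfun_wrt G X -> mfun_wrt G (fun w => - X w).
Proof.
move=> hX; rewrite (_ : (fun w => - X w) = (fun w => (-1) * X w)).
  by apply: mfun_wrtM => //; exact: mfun_wrt_cst.
by apply/funext => w; rewrite mulN1r.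
Qed.

Lemma mfun_wrt_sum I (s : seq I) (Q : pred I) (X : I -> T -> R) :
  (forall i, mfun_wrt G (X i)) -> mfun_wrt G (fun w => \sum_(i <- s | Q i) X i w).
Proof.
move=> hX; elim: s => [|i s ih].
  by under eq_fun do rewrite big_nil; exact: mfun_wrt_cst.
case: (boolP (Q i)) => Qi; under eq_fun do rewrite big_cons ?Qi ?(negbTE Qi) //.
  exact: mfun_wrtD.
exact: ih.
Qed.

End measurability_wrt.

Section random_matrices.
Context (d : measure_display) (T : measurableType d) (R : realType) (m : nat).
Local Notation M := 'M[R[i]]_m.
Implicit Types (X : T -> M) (G : set (set T)).

Definition entries_wrt G X := forall a b,
  mfun_wrt G (fun w => Re (X w a b)) /\ mfun_wrt G (fun w => Im (X w a b)).

Lemma sigma_mx_sigma X : sigma_algebra setT (sigma_mx X).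
Proof. exact: smallest_sigma_algebra. Qed.

Lemma sigma_mx_idem X : <<s sigma_mx X >> = sigma_mx X.
Proof. exact/sigma_algebra_id/sigma_mx_sigma. Qed.

Lemma sigma_mx_entries X : entries_wrt (sigma_mx X) X.
Proof.
move=> a b; split=> _ B mB; rewrite setTI; apply: sub_sigma_algebra; apply: sub_sigma_algebra.
  by exists a, b, B; split => //; left.
by exists a, b, B; split => //; right.
Qed.

Lemma entries_wrt_mono G1 G2 X : <<s G1 >> `<=` <<s G2 >> -> entries_wrt G1 X -> entries_wrt G2 X.
Proof. by move=> G12 h a b; have [h1 h2] := h a b; split; exact: mfun_wrt_mono G12 _. Qed.

Lemma entries_wrt_sub G X : sigma_mx X `<=` <<s G >> -> entries_wrt G X.
Proof.
by move=> sG; apply: (entries_wrt_mono _ (@sigma_mx_entries X)); rewrite sigma_mx_idem.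
Qed.

Lemma sigma_mx_sub G X : sigma_algebra setT G -> entries_wrt G X -> sigma_mx X `<=` G.
Proof.
move=> sG h; apply: smallest_sub => //.
move=> A [a [b [B [mB [->|->]]]]]; have [h1 h2] := h a b.
  by have := h1 measurableT B mB; rewrite setTI /measurable /= sigma_algebra_id.
by have := h2 measurableT B mB; rewrite setTI /measurable /= sigma_algebra_id.
Qed.

Lemma herm_dot_wrt G A X : entries_wrt G X -> mfun_wrt G (fun w => herm_dot A (X w)).
Proof.
move=> h; under eq_fun do rewrite herm_dotE.
apply: mfun_wrtM; first exact: mfun_wrt_cst.
apply: mfun_wrt_sum => a; apply: mfun_wrt_sum => b; have [h1 h2] := h b a.
by apply: mfun_wrtB; apply: mfun_wrtM => //; exact: mfun_wrt_cst.
Qed.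

Lemma entries_wrtB G X Y : entries_wrt G X -> entries_wrt G Y ->
  entries_wrt G (fun w => X w - Y w).
Proof.
move=> hX hY a b; have [h1 h2] := hX a b; have [h3 h4] := hY a b; split.
- under eq_fun do rewrite !mxE ReB.
  exact: mfun_wrtB.
- under eq_fun do rewrite !mxE ImB.
  exact: mfun_wrtB.
Qed.

End random_matrices.

Section brownian_scaling.
Context (d : measure_display) (T : measurableType d) (R : realType)
        (P : probability T R) (F : R -> set (set T)).

Lemma brownian_scale c k (B B' : R -> T -> R) : brownian_motion P F c B ->
  (forall t w, 0 <= t -> B' t w = k * B t w) -> brownian_motion P F (k ^+ 2 * c) B'.
Proof.
move=> hB e.
have eD s t : 0 <= s -> s <= t ->
    (fun w => B' t w - B' s w) = (fun w => k * (B t w - B s w)).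
  by move=> s0 st; apply/funext => w; rewrite !e// ?(le_trans s0 st)// mulrBr.
split.
- move=> t t0; rewrite (_ : B' t = fun w => k * B t w).
    by apply: mfun_wrtM; [exact: mfun_wrt_cst|exact: (brownian_adapted hB)].
  by apply/funext => w; exact: e.
- move=> s t s0 st; rewrite eD//; have [G [h1 h2 h3]] := brownian_indep hB s0 st.
  by exists G; split => //; apply: mfun_wrtM => //; exact: mfun_wrt_cst.
- move=> s t s0 st; rewrite eD//; apply: all_momentsM; first exact: all_moments_cst.
  exact: (brownian_moments hB).
- move=> s t s0 st; rewrite eD// meanZ; last exact/all_moments_L1/(brownian_moments hB).
  by rewrite (brownian_mean hB)// mulr0.
- move=> s t s0 st.
  have -> : (fun w => (B' t w - B' s w) ^+ 2) = (fun w => k ^+ 2 * (B t w - B s w) ^+ 2).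
    by apply/funext => w; rewrite (congr1 (@^~ w) (eD s t s0 st)) exprMn.
  rewrite meanZ; last exact/all_moments_L1/all_momentsX/(brownian_moments hB).
  by rewrite (brownian_variance hB)// mulrA.
Qed.

Lemma mean_increments (X X' Y Y' : T -> R) :
  L2 P X -> L2 P X' -> L2 P Y -> L2 P Y' ->
  mean P (fun w => (X w - X' w) * (Y w - Y' w)) =
  mean P (fun w => X w * Y w) - mean P (fun w => X w * Y' w) -
  (mean P (fun w => X' w * Y w) - mean P (fun w => X' w * Y' w)).
Proof.
move=> hX hX' hY hY'.
transitivity (mean P (fun w => (X w * Y w - X w * Y' w) - (X' w * Y w - X' w * Y' w))).
  by apply: eq_Rintegral => w _; ring.
by rewrite !meanB//; try (apply: L1B); exact: L2M.
Qed.

End brownian_scaling.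

Section hermitian_brownian.
Context (d : measure_display) (T : measurableType d) (R : realType)
        (P : probability T R) (m : nat) (F : R -> set (set T)) (H : R -> T -> 'M[R[i]]_m).
Hypotheses (hH : hermitian_brownian_motion P H) (hF : filtration F)
  (adH : adapted F H) (indH : independent_increments P F H).

Lemma adapted_entries (X : R -> T -> 'M[R[i]]_m) t : adapted F X -> 0 <= t -> entries_wrt (F t) (X t).
Proof.
move=> adX t0; apply: entries_wrt_sub; rewrite filtration_sigmaE//; exact: adX.
Qed.

Lemma entries_wrt_le s t (X : T -> 'M[R[i]]_m) : 0 <= s -> s <= t ->
  entries_wrt (F s) X -> entries_wrt (F t) X.
Proof.
move=> s0 st; apply: entries_wrt_mono; rewrite !filtration_sigmaE//.
  exact: filtration_mono.
exact: le_trans st.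
Qed.

Lemma increment_entries s t : 0 <= s -> s <= t ->
  entries_wrt (F t) (fun w => H t w - H s w).
Proof.
move=> s0 st; apply: entries_wrtB.
  by apply: adapted_entries => //; exact: le_trans st.
by apply: (entries_wrt_le s0 st); exact: adapted_entries.
Qed.

Lemma increment_class s t : 0 <= s -> s <= t ->
  let G := sigma_mx (fun w => H t w - H s w) in
  <<s G >> `<=` measurable /\ indep_classes P G (F s).
Proof.
move=> s0 st G; rewrite /G; split.
  rewrite sigma_mx_idem; apply: subset_trans (filtration_measurable hF (le_trans s0 st)).
  apply: sigma_mx_sub; first by apply: filtration_sigma => //; exact: le_trans st.
  exact: increment_entries.
move=> A B; rewrite sigma_mx_idem filtration_sigmaE// => hA hB.
exact: indH hA hB.
Qed.

Let herm_moments A t : A \is hermsymmx -> 0 <= t ->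
  all_moments P (fun w => herm_dot A (H t w)).
Proof.
move=> hA t0.
have := @hbm_gauss _ _ _ _ _ _ hH 1 (fun=> t) (fun=> A) (fun=> t0) (fun=> hA).
by move=> /centered_gaussian_moments[]; under eq_fun do rewrite big_ord1.
Qed.

Let herm_incr A s t : A \is hermsymmx -> 0 <= s -> 0 <= t ->
  centered_gaussian P (fun w => herm_dot A (H t w) - herm_dot A (H s w)).
Proof.
move=> hA s0 t0.
have hN : - A \is hermsymmx.
  by apply: hermsymm_intro => a b; rewrite !mxE ?ReN ?ImN; have [h1 h2] := hermsymm_entries a b hA;
     rewrite ?h1 ?h2.
(* The increment is the two-term combination of [A] at time [t] and [- A] at time [s], hence
   Gaussian. *)
have := @hbm_gauss _ _ _ _ _ _ hH 2 (fun i => if i == ord0 then t else s)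
  (fun i => if i == ord0 then A else - A).
move=> h; have {}h := h _ _.
under eq_fun => w do rewrite -[X in _ - X]opprK -herm_dotNl.
have : centered_gaussian P (fun w => \sum_(i < 2)
  herm_dot (if i == ord0 then A else - A) (H (if i == ord0 then t else s) w)).
  by apply: h => i; case: ifP.
under eq_fun do rewrite big_ord_recl big_ord1 /=.
by under [X in _ -> centered_gaussian _ X]eq_fun do rewrite opprK.
Qed.

Lemma herm_covariance A B s t : A \is hermsymmx -> B \is hermsymmx -> 0 <= s -> s <= t ->
  mean P (fun w => (herm_dot A (H t w) - herm_dot A (H s w)) *
                   (herm_dot B (H t w) - herm_dot B (H s w))) =
  (t - s) * herm_dot A B.
Proof.
move=> hA hB s0 st; have t0 := le_trans s0 st.
have cov u v : 0 <= u -> 0 <= v ->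
   mean P (fun w => herm_dot A (H u w) * herm_dot B (H v w)) = Num.min u v * herm_dot A B.
  move=> u0 v0; have := hbm_cov hH hA hB u0 v0; rewrite unlock => e.
  by rewrite /mean /Rintegral e.
rewrite mean_increments; try by apply/all_moments_L2/herm_moments.
by rewrite !cov// !minxx (min_idPr st) (min_idPl st) subrr subr0 -mulrBl.
Qed.

Lemma herm_dot_brownian A : A \is hermsymmx ->
  brownian_motion P F (herm_dot A A) (fun t w => herm_dot A (H t w)).
Proof.
move=> hA; split.
- by move=> t t0; apply: herm_dot_wrt; exact: adapted_entries.
- move=> s t s0 st; have [h1 h2] := increment_class s0 st.
  exists (sigma_mx (fun w => H t w - H s w)); split => //.
  rewrite (_ : (fun w => _) = (fun w => herm_dot A (H t w - H s w))).
    by apply: herm_dot_wrt; exact: sigma_mx_entries.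
  by apply/funext => w; rewrite herm_dotBr.
- move=> s t s0 st.
  by have [] := centered_gaussian_moments (herm_incr hA s0 (le_trans s0 st)).
- move=> s t s0 st.
  by have [] := centered_gaussian_moments (herm_incr hA s0 (le_trans s0 st)).
- move=> s t s0 st; rewrite mulrC -herm_covariance//.
Qed.

Lemma herm_dot_fourth A s t : A \is hermsymmx -> 0 <= s -> s <= t ->
  mean P (fun w => (herm_dot A (H t w) - herm_dot A (H s w)) ^+ 4) <=
  4096 * ((t - s) * herm_dot A A) ^+ 2.
Proof.
move=> hA s0 st; rewrite -herm_covariance//.
by have [_ _] := centered_gaussian_moments (herm_incr hA s0 (le_trans s0 st)).
Qed.

Hypothesis m0 : (0 < m)%N.
Let mR : (0 : R) < m%:R. Proof. by rewrite ltr0n. Qed.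
Let k : R := (2 * m%:R)^-1.

Lemma entry_Re t w a b : 0 <= t -> Re (H t w a b) = k * herm_dot (herm_re R a b) (H t w).
Proof.
move=> t0; rewrite herm_dot_re ?(hbm_herm hH)// /k; field.
by rewrite ?gt_eqF.
Qed.

Lemma entry_Im t w a b : 0 <= t -> Im (H t w a b) = k * herm_dot (herm_im R a b) (H t w).
Proof.
move=> t0; rewrite herm_dot_im ?(hbm_herm hH)// /k; field.
by rewrite ?gt_eqF.
Qed.

(** The rate is 1/(2m) off the diagonal and 1/m on it; the bound 1 is what turns the isometry into
    an inequality with a constant common to all entries. *)
Lemma entry_Re_brownian a b : exists2 c, 0 <= c <= 1 &
  brownian_motion P F c (fun t w => Re (H t w a b)).
Proof.
exists (k ^+ 2 * herm_dot (herm_re R a b) (herm_re R a b)); last first.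
  by apply: brownian_scale (herm_dot_brownian (herm_re_herm R a b)) _ => t w; exact: entry_Re.
rewrite herm_dot_re ?herm_re_herm// herm_re_Re !eqxx /= /k.
set x := 1 + _; have /andP[x0 x2] : 0 <= x <= 1 + 1.
  by rewrite /x addr_ge0//= lerD2l lern1 leq_b1.
have -> : (2 * m%:R)^-1 ^+ 2 * (m%:R * (2 * x)) = x / (2 * m%:R) :> R.
  by field; rewrite gt_eqF.
rewrite divr_ge0 ?mulr_ge0//= ler_pdivrMr ?mulr_gt0// mul1r.
by apply: (le_trans x2); rewrite -[X in X <= _]mulr1 ler_pM2l// ler1n.
Qed.

Lemma entry_Im_brownian a b : exists2 c, 0 <= c <= 1 &
  brownian_motion P F c (fun t w => Im (H t w a b)).
Proof.
exists (k ^+ 2 * herm_dot (herm_im R a b) (herm_im R a b)); last first.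
  by apply: brownian_scale (herm_dot_brownian (herm_im_herm R a b)) _ => t w; exact: entry_Im.
rewrite herm_dot_im ?herm_im_herm// herm_im_Im !eqxx /= /k.
set x := 1 - _; have /andP[x0 x1] : 0 <= x <= 1.
  by rewrite /x subr_ge0 lern1 leq_b1 gerBl ler0n.
have -> : (2 * m%:R)^-1 ^+ 2 * (m%:R * (2 * x)) = x / (2 * m%:R) :> R.
  by field; rewrite gt_eqF.
rewrite divr_ge0 ?mulr_ge0//= ler_pdivrMr ?mulr_gt0// mul1r.
apply: (le_trans x1); rewrite -natrM ler1n muln_gt0//.
Qed.

End hermitian_brownian.

(** * Complex random variables with all moments *)

Section complex_variables.
Context (d : measure_display) (T : measurableType d) (R : realType)
        (P : probability T R).
Implicit Types (G : set (set T)) (X Y : T -> R) (Z : T -> R[i]).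

Definition nice_wrt G X := mfun_wrt G X /\ all_moments P X.
Definition cnice_wrt G Z := nice_wrt G (fun w => Re (Z w)) /\ nice_wrt G (fun w => Im (Z w)).
Definition cmean Z : R[i] := Complex (mean P (fun w => Re (Z w))) (mean P (fun w => Im (Z w))).

Lemma nice_cst G c : nice_wrt G (fun=> c).
Proof. by split; [exact: mfun_wrt_cst|exact: all_moments_cst]. Qed.
Lemma niceD G X Y : nice_wrt G X -> nice_wrt G Y -> nice_wrt G (fun w => X w + Y w).
Proof. by move=> [? ?] [? ?]; split; [exact: mfun_wrtD|exact: all_momentsD]. Qed.
Lemma niceB G X Y : nice_wrt G X -> nice_wrt G Y -> nice_wrt G (fun w => X w - Y w).
Proof. by move=> [? ?] [? ?]; split; [exact: mfun_wrtB|exact: all_momentsB]. Qed.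
Lemma niceM G X Y : nice_wrt G X -> nice_wrt G Y -> nice_wrt G (fun w => X w * Y w).
Proof. by move=> [? ?] [? ?]; split; [exact: mfun_wrtM|exact: all_momentsM]. Qed.
Lemma niceN G X : nice_wrt G X -> nice_wrt G (fun w => - X w).
Proof. by move=> [? ?]; split; [exact: mfun_wrtN|exact: all_momentsN]. Qed.
Lemma niceX p G X : nice_wrt G X -> nice_wrt G (fun w => X w ^+ p).
Proof. by move=> [? ?]; split; [exact: mfun_wrtX|exact: all_momentsX]. Qed.
Lemma nice_sum G I (s : seq I) (Q : pred I) (X : I -> T -> R) :
  (forall i, nice_wrt G (X i)) -> nice_wrt G (fun w => \sum_(i <- s | Q i) X i w).
Proof.
move=> h; split; first by apply: mfun_wrt_sum => i; case: (h i).
by apply: all_moments_sum => i _; case: (h i).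
Qed.
Lemma nice_L1 G X : nice_wrt G X -> L1 P X.
Proof. by move=> [_ /all_moments_L1]. Qed.
Lemma nice_mono G1 G2 X : <<s G1 >> `<=` <<s G2 >> -> nice_wrt G1 X -> nice_wrt G2 X.
Proof. by move=> h [? ?]; split => //; exact: mfun_wrt_mono h _. Qed.

Lemma cnice_cst G c : cnice_wrt G (fun=> c).
Proof. by split; exact: nice_cst. Qed.
Lemma cnice_real G X : nice_wrt G X -> cnice_wrt G (fun w => Complex (X w) 0).
Proof. by move=> h; split => //; exact: nice_cst. Qed.
Lemma cniceD G Z Z' : cnice_wrt G Z -> cnice_wrt G Z' -> cnice_wrt G (fun w => Z w + Z' w).
Proof.
move=> [? ?] [? ?]; split.
  by under eq_fun do rewrite ReD; exact: niceD.
by under eq_fun do rewrite ImD; exact: niceD.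
Qed.
Lemma cniceM G Z Z' : cnice_wrt G Z -> cnice_wrt G Z' -> cnice_wrt G (fun w => Z w * Z' w).
Proof.
move=> [? ?] [? ?]; split.
  by under eq_fun do rewrite Re_mul; apply: niceB; exact: niceM.
by under eq_fun do rewrite Im_mul; apply: niceD; exact: niceM.
Qed.
Lemma cnice_conj G Z : cnice_wrt G Z -> cnice_wrt G (fun w => Num.conj (Z w)).
Proof.
move=> [? ?]; split.
  by under eq_fun do rewrite conjCE.
by under eq_fun do rewrite conjCE /=; exact: niceN.
Qed.
Lemma cnice_sum G I (s : seq I) (Q : pred I) (Z : I -> T -> R[i]) :
  (forall i, cnice_wrt G (Z i)) -> cnice_wrt G (fun w => \sum_(i <- s | Q i) Z i w).
Proof.
move=> h; split.
  by under eq_fun do rewrite Re_sum; apply: nice_sum => i; case: (h i).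
by under eq_fun do rewrite Im_sum; apply: nice_sum => i; case: (h i).
Qed.
Lemma cnice_mono G1 G2 Z : <<s G1 >> `<=` <<s G2 >> -> cnice_wrt G1 Z -> cnice_wrt G2 Z.
Proof. by move=> h [? ?]; split; exact: nice_mono h _. Qed.
Lemma nice_sqmod G Z : cnice_wrt G Z -> nice_wrt G (fun w => sqmod (Z w)).
Proof.
by move=> [? ?]; under eq_fun do rewrite sqmodE; apply: niceD; exact: niceX.
Qed.

Definition cL1 Z := L1 P (fun w => Re (Z w)) /\ L1 P (fun w => Im (Z w)).

Lemma cmean_sum I (s : seq I) (Q : pred I) (Z : I -> T -> R[i]) :
  (forall i, cL1 (Z i)) ->
  cmean (fun w => \sum_(i <- s | Q i) Z i w) = \sum_(i <- s | Q i) cmean (Z i).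
Proof.
move=> h; apply: complex_ext; rewrite ?Re_sum ?Im_sum /=.
  rewrite -mean_sum; last by move=> i _; case: (h i).
  by apply: eq_Rintegral => w _; rewrite Re_sum.
rewrite -mean_sum; last by move=> i _; case: (h i).
by apply: eq_Rintegral => w _; rewrite Im_sum.
Qed.

Lemma cmean_indep G1 G2 Z Z' : <<s G1 >> `<=` measurable -> <<s G2 >> `<=` measurable ->
  indep_classes P G1 G2 -> cnice_wrt G1 Z -> cnice_wrt G2 Z' ->
  cL1 (fun w => Z w * Z' w) /\ cmean (fun w => Z w * Z' w) = cmean Z * cmean Z'.
Proof.
move=> s1 s2 ind [h1 h2] [h3 h4].
have ind_mul X Y : nice_wrt G1 X -> nice_wrt G2 Y -> L1 P (fun w => X w * Y w) /\
    mean P (fun w => X w * Y w) = mean P X * mean P Y.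
  by move=> [? /all_moments_L1 ?] [? /all_moments_L1 ?]; apply: (indep_mul s1 s2 ind).
have [k1 e1] := ind_mul _ _ h1 h3; have [k2 e2] := ind_mul _ _ h2 h4.
have [k3 e3] := ind_mul _ _ h1 h4; have [k4 e4] := ind_mul _ _ h2 h3.
split; first split.
- by under eq_fun do rewrite Re_mul; exact: L1B.
- by under eq_fun do rewrite Im_mul; exact: L1D.
apply: complex_ext; rewrite ?Re_mul ?Im_mul /=.
  by rewrite -e1 -e2 -meanB//; apply: eq_Rintegral => w _; rewrite Re_mul.
by rewrite -e3 -e4 -meanD//; apply: eq_Rintegral => w _; rewrite Im_mul.
Qed.

End complex_variables.

Section increments.
Context (d : measure_display) (T : measurableType d) (R : realType)
        (P : probability T R) (m : nat) (F : R -> set (set T)) (H : R -> T -> 'M[R[i]]_m).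
Hypotheses (hH : hermitian_brownian_motion P H) (hF : filtration F)
  (adH : adapted F H) (indH : independent_increments P F H) (m0 : (0 < m)%N).

Let mR : (0 : R) < m%:R. Proof. by rewrite ltr0n. Qed.

Section increment.
Variables (s t : R).
Hypotheses (s0 : 0 <= s) (st : s <= t).
Let t0 : 0 <= t. Proof. exact: le_trans st. Qed.
Local Notation D := (fun w => H t w - H s w).
Local Notation h := (t - s).
Local Notation k := ((2 * m%:R)^-1 : R).

Lemma increment_Re a b : (fun w => Re (D w a b)) =
  (fun w => k * (herm_dot (herm_re R a b) (H t w) - herm_dot (herm_re R a b) (H s w))).
Proof.
apply/funext => w; rewrite mxE mxE ReB (entry_Re hH m0)// (entry_Re hH m0)//.
by rewrite mulrBr.
Qed.

Lemma increment_Im a b : (fun w => Im (D w a b)) =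
  (fun w => k * (herm_dot (herm_im R a b) (H t w) - herm_dot (herm_im R a b) (H s w))).
Proof.
apply/funext => w; rewrite mxE mxE ImB (entry_Im hH m0)// (entry_Im hH m0)//.
by rewrite mulrBr.
Qed.

Lemma increment_herm w : D w \is hermsymmx.
Proof.
have [ht hs] := (hbm_herm hH w t0, hbm_herm hH w s0).
apply: hermsymm_intro => a b; rewrite !mxE ?ReB ?ImB.
  by rewrite (hermsymm_entries a b ht).1 (hermsymm_entries a b hs).1.
by rewrite (hermsymm_entries a b ht).2 (hermsymm_entries a b hs).2 opprB opprK addrC.
Qed.

Let moments A : A \is hermsymmx ->
  all_moments P (fun w => herm_dot A (H t w) - herm_dot A (H s w)).
Proof. by move=> hA; apply: (brownian_moments (herm_dot_brownian hH hF adH indH hA)). Qed.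

Lemma increment_nice a b : cnice_wrt P (sigma_mx D) (fun w => D w a b).
Proof.
have [h1 h2] := @sigma_mx_entries _ _ _ _ D a b.
split; split => //.
  by rewrite increment_Re; apply: all_momentsM; [exact: all_moments_cst|apply/moments/herm_re_herm].
by rewrite increment_Im; apply: all_momentsM; [exact: all_moments_cst|apply/moments/herm_im_herm].
Qed.

Lemma increment_mean a b : cmean P (fun w => D w a b) = 0.
Proof.
apply: complex_ext => /=.
  rewrite increment_Re meanZ; last by apply/all_moments_L1/moments/herm_re_herm.
  by rewrite (brownian_mean (herm_dot_brownian hH hF adH indH (herm_re_herm R a b)))// mulr0.
rewrite increment_Im meanZ; last by apply/all_moments_L1/moments/herm_im_herm.
by rewrite (brownian_mean (herm_dot_brownian hH hF adH indH (herm_im_herm R a b)))// mulr0.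
Qed.

Let cov A B : A \is hermsymmx -> B \is hermsymmx ->
  mean P (fun w => (k * (herm_dot A (H t w) - herm_dot A (H s w))) *
                   (k * (herm_dot B (H t w) - herm_dot B (H s w)))) =
  k ^+ 2 * (h * herm_dot A B).
Proof.
move=> hA hB; rewrite -(herm_covariance hH hA hB s0 st) -meanZ; last first.
  by apply: L2M; apply/all_moments_L2/moments.
by apply: eq_Rintegral => w _; rewrite mulrACA expr2.
Qed.

(** Only transposed positions are correlated: in the real part of the product the [a = c, b = e]
    contributions of Re Re and Im Im cancel, while those of [a = e, b = c] add up. The mixed terms
    vanish. *)
Lemma increment_cov a b c e : cmean P (fun w => D w a b * D w c e) =
  Complex (((a == e) && (b == c))%:R * (h / m%:R)) 0.
Proof.
have [n1 n2] := increment_nice a b; have [n3 n4] := increment_nice c e.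
have Lp X Y : nice_wrt P (sigma_mx D) X -> nice_wrt P (sigma_mx D) Y -> L1 P (fun w => X w * Y w).
  by move=> [_ /all_moments_L2 ?] [_ /all_moments_L2 ?]; exact: L2M.
have eRe : mean P (fun w => Re (D w a b) * Re (D w c e)) =
    k ^+ 2 * (h * (m%:R * (2 * Re (herm_re R c e a b)))).
  rewrite -herm_dot_re ?herm_re_herm// -cov ?herm_re_herm//.
  apply: eq_Rintegral => w _.
  by rewrite -(congr1 (@^~ w) (increment_Re a b)) -(congr1 (@^~ w) (increment_Re c e)).
have eIm : mean P (fun w => Im (D w a b) * Im (D w c e)) =
    k ^+ 2 * (h * (m%:R * (2 * Im (herm_im R c e a b)))).
  rewrite -herm_dot_im ?herm_im_herm// -cov ?herm_im_herm//.
  apply: eq_Rintegral => w _.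
  by rewrite -(congr1 (@^~ w) (increment_Im a b)) -(congr1 (@^~ w) (increment_Im c e)).
have eRI : mean P (fun w => Re (D w a b) * Im (D w c e)) =
    k ^+ 2 * (h * (m%:R * (2 * Re (herm_im R c e a b)))).
  rewrite -herm_dot_re ?herm_im_herm// -cov ?herm_im_herm ?herm_re_herm//.
  apply: eq_Rintegral => w _.
  by rewrite -(congr1 (@^~ w) (increment_Re a b)) -(congr1 (@^~ w) (increment_Im c e)).
have eIR : mean P (fun w => Im (D w a b) * Re (D w c e)) =
    k ^+ 2 * (h * (m%:R * (2 * Im (herm_re R c e a b)))).
  rewrite -herm_dot_im ?herm_re_herm// -cov ?herm_im_herm ?herm_re_herm//.
  apply: eq_Rintegral => w _.
  by rewrite -(congr1 (@^~ w) (increment_Im a b)) -(congr1 (@^~ w) (increment_Re c e)).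
have mN : (m%:R : R) != 0 by rewrite gt_eqF.
apply: complex_ext => /=.
  transitivity (mean P (fun w => Re (D w a b) * Re (D w c e)) -
                mean P (fun w => Im (D w a b) * Im (D w c e))).
    by rewrite -meanB; [apply: eq_Rintegral => w _; rewrite Re_mul|exact: Lp|exact: Lp].
  rewrite eRe eIm herm_re_Re herm_im_Im.
  by move: ((a == c) && _)%:R ((a == e) && _)%:R => x y; field.
transitivity (mean P (fun w => Re (D w a b) * Im (D w c e)) +
              mean P (fun w => Im (D w a b) * Re (D w c e))).
  by rewrite -meanD; [apply: eq_Rintegral => w _; rewrite Im_mul|exact: Lp|exact: Lp].
by rewrite eRI eIR herm_im_Re herm_re_Im !mulr0 addr0.
Qed.

Let ind := increment_class hF adH indH s0 st.
Let sFs : <<s F s >> `<=` measurable. Proof. exact: filtration_sigma_sub. Qed.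

Lemma increment_mul1 a b Y : cnice_wrt P (F s) Y ->
  cL1 P (fun w => D w a b * Y w) /\ cmean P (fun w => D w a b * Y w) = 0.
Proof.
move=> hY; have [h1 h2] := cmean_indep ind.1 sFs ind.2 (increment_nice a b) hY.
by split => //; rewrite h2 increment_mean mul0r.
Qed.

Lemma increment_mul2 a b c e Y : cnice_wrt P (F s) Y ->
  cL1 P (fun w => (D w a b * D w c e) * Y w) /\
  cmean P (fun w => (D w a b * D w c e) * Y w) =
  Complex (((a == e) && (b == c))%:R * (h / m%:R)) 0 * cmean P Y.
Proof.
move=> hY; have nD := cniceM (increment_nice a b) (increment_nice c e).
have [h1 h2] := cmean_indep ind.1 sFs ind.2 nD hY.
by split => //; rewrite h2 increment_cov.
Qed.

Lemma increment_frob_nice : nice_wrt P (sigma_mx D) (fun w => frob2 (D w)).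
Proof.
by apply: nice_sum => a; apply: nice_sum => b; apply: nice_sqmod; exact: increment_nice.
Qed.

End increment.

(** Cauchy-Schwarz over rows, over columns and over the two parts of an entry costs m * (m * 2) and
    leaves fourth moments of Gaussian increments, of order (t - s)^2. What matters later is that [K]
    does not depend on the times. *)
Lemma increment_frob_moment : exists2 K : R, 0 <= K & forall s t, 0 <= s -> s <= t ->
  mean P (fun w => frob2 (H t w - H s w) ^+ 2) <= K * (t - s) ^+ 2.
Proof.
pose k : R := (2 * m%:R)^-1.
pose C (A : 'M[R[i]]_m) : R := k ^+ 4 * (4096 * herm_dot A A ^+ 2).
pose K : R := m%:R * (m%:R * 2) * \sum_a \sum_b (C (herm_re R a b) + C (herm_im R a b)).
have C0 A : 0 <= C A.
  apply: mulr_ge0; first by rewrite -[4%N]/(2 * 2)%N exprM sqr_ge0.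
  by apply: mulr_ge0; [exact: ler0n|exact: sqr_ge0].
exists K.
  apply: mulr_ge0; first by rewrite !mulr_ge0// ler0n.
  by apply: sumr_ge0 => a _; apply: sumr_ge0 => b _; apply: addr_ge0.
move=> s t s0 st.
pose D w := H t w - H s w.
have nD a b : cnice_wrt P (sigma_mx D) (fun w => D w a b) by exact: increment_nice.
have n4 a b : L1 P (fun w => Re (D w a b) ^+ 4 + Im (D w a b) ^+ 4).
  by have [[_ h1] [_ h2]] := nD a b; apply: L1D; apply/all_moments_L1/all_momentsX.
have m4 a b : mean P (fun w => Re (D w a b) ^+ 4 + Im (D w a b) ^+ 4) <=
    (t - s) ^+ 2 * (C (herm_re R a b) + C (herm_im R a b)).
  have mom A : A \is hermsymmx -> L1 P (fun w => (herm_dot A (H t w) - herm_dot A (H s w)) ^+ 4).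
    move=> hA; apply/all_moments_L1/all_momentsX.
    exact: (brownian_moments (herm_dot_brownian hH hF adH indH hA)).
  have bnd A : A \is hermsymmx ->
     mean P (fun w => (k * (herm_dot A (H t w) - herm_dot A (H s w))) ^+ 4) <= (t - s) ^+ 2 * C A.
    move=> hA; have -> : (t - s) ^+ 2 * C A = k ^+ 4 * (4096 * ((t - s) * herm_dot A A) ^+ 2).
      rewrite /C [((t - s) * _) ^+ 2]exprMn; move: (k ^+ 4) ((t - s) ^+ 2) (herm_dot A A ^+ 2) => u v z.
      by ring.
    have -> : mean P (fun w => (k * (herm_dot A (H t w) - herm_dot A (H s w))) ^+ 4) =
        k ^+ 4 * mean P (fun w => (herm_dot A (H t w) - herm_dot A (H s w)) ^+ 4).
      by rewrite -meanZ; [apply: eq_Rintegral => w _; rewrite exprMn|exact: mom].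
    apply: ler_wpM2l (herm_dot_fourth hH hA s0 st).
    by rewrite -[4%N]/(2 * 2)%N exprM sqr_ge0.
  rewrite mulrDr meanD; last 2 first.
  - by have [[_ h1] _] := nD a b; apply/all_moments_L1/all_momentsX.
  - by have [_ [_ h1]] := nD a b; apply/all_moments_L1/all_momentsX.
  apply: lerD.
    apply: le_trans (bnd _ (herm_re_herm R a b)).
    rewrite le_eqVlt; apply/orP; left; apply/eqP; apply: eq_Rintegral => w _.
    by rewrite -(congr1 (@^~ w) (increment_Re s0 st a b)).
  apply: le_trans (bnd _ (herm_im_herm R a b)).
  rewrite le_eqVlt; apply/orP; left; apply/eqP; apply: eq_Rintegral => w _.
  by rewrite -(congr1 (@^~ w) (increment_Im s0 st a b)).
apply: (@le_trans _ _ (mean P (fun w => m%:R * (m%:R * 2) *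
   \sum_a \sum_b (Re (D w a b) ^+ 4 + Im (D w a b) ^+ 4)))).
  apply: mean_le.
  - by apply: nice_L1; apply: niceX; exact: increment_frob_nice.
  - by apply: L1Z; apply: L1_sum => a _; apply: L1_sum.
  move=> w; rewrite frob2_real; apply: (le_trans (sqr_sum_le _)); rewrite card_ord.
  rewrite -mulrA ler_wpM2l// mulr_sumr; apply: ler_sum => a _.
  apply: (le_trans (sqr_sum_le _)); rewrite card_ord.
  rewrite -mulrA ler_wpM2l// mulr_sumr; apply: ler_sum => b _.
  rewrite -/(D w); move: (Re (D w a b)) (Im (D w a b)) => x y.
  have -> : x ^+ 4 = (x ^+ 2) ^+ 2 by rewrite -exprM.
  have -> : y ^+ 4 = (y ^+ 2) ^+ 2 by rewrite -exprM.
  by move: (x ^+ 2) (y ^+ 2) => {}x {}y; have := sqr_ge0 (x - y); nra.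
rewrite meanZ; last by apply: L1_sum => a _; apply: L1_sum.
rewrite /K -[X in _ <= X]mulrA; apply: ler_wpM2l; first by rewrite !mulr_ge0// ler0n.
rewrite mean_sum; last by move=> a _; apply: L1_sum.
rewrite mulr_suml; apply: ler_sum => a _; rewrite mean_sum// mulr_suml.
by apply: ler_sum => b _; rewrite mulrC.
Qed.

End increments.

(** * One step of the Euler scheme *)

Section euler_step.
Context (d : measure_display) (T : measurableType d) (R : realType)
        (P : probability T R) (m : nat) (F : R -> set (set T)) (H : R -> T -> 'M[R[i]]_m).
Hypotheses (hH : hermitian_brownian_motion P H) (hF : filtration F)
  (adH : adapted F H) (indH : independent_increments P F H) (m0 : (0 < m)%N).

Variables (s t : R).
Hypotheses (s0 : 0 <= s) (st : s <= t).
Let t0 : 0 <= t. Proof. exact: le_trans st. Qed.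
Local Notation D := (fun w => H t w - H s w).
Local Notation h := (t - s).
Variable x : 'I_m -> T -> R[i].
Hypothesis hx : forall a, cnice_wrt P (F s) (x a).

Definition noise_image a w := \sum_c (H t w - H s w) a c * x c w.
Definition euler_step a w : R[i] :=
  Complex (1 - h / 2) 0 * x a w + Complex 0 1 * noise_image a w.
Local Notation alpha := (1 - h / 2).
Local Notation p a := (fun w => sqmod (x a w)).
Local Notation q a := (fun w => sqmod (noise_image a w)).
Local Notation mi a := (fun w => Im (Num.conj (x a w) * noise_image a w)).
Local Notation W := (fun w => \sum_a sqmod (x a w)).
Local Notation Q := (fun w => \sum_a sqmod (noise_image a w)).

Lemma euler_step_sqmod a w :
  sqmod (euler_step a w) = alpha ^+ 2 * p a w - 2 * alpha * mi a w + q a w.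
Proof.
rewrite /euler_step !sqmodE !(ReD, ImD, Re_mul, Im_mul, conjCE) /=.
by move: (Re _) (Im _) (Re _) (Im _) => *; ring.
Qed.

(** The sum is the imaginary part of <x, D x>, which is real because [D] is Hermitian: the noise is
    tangent to the sphere. Exchanging the two summation indices turns the sum into its opposite. *)
Lemma noise_tangent w : \sum_a mi a w = 0.
Proof.
have hD := increment_herm hH s0 st w.
set S := \sum_a _; suff : S = - S by lra.
have SE : S = \sum_a \sum_c Im (Num.conj (x a w) * ((H t w - H s w) a c * x c w)).
  by apply: eq_bigr => a _; rewrite /noise_image mulr_sumr Im_sum.
rewrite {1}SE exchange_big SE /= -sumrN; apply: eq_bigr => a _.
rewrite -sumrN; apply: eq_bigr => c _.
have [] := hermsymm_entries c a hD; move: (_ c a) (_ a c) => y z.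
rewrite !(Re_mul, Im_mul, conjCE) /= => -> ->; ring.
Qed.

Lemma noise_image_le w : Q w <= (m%:R * frob2 (D w)) * W w.
Proof.
rewrite /frob2 mulrAC mulr_sumr; apply: ler_sum => a _.
have -> : m%:R * W w * \sum_k sqmod (D w a k) = m%:R * \sum_k (sqmod (D w a k) * W w).
  by rewrite -mulr_suml -mulrA [W w * _]mulrC.
apply: (@le_trans _ _ (m%:R * \sum_c sqmod (D w a c * x c w))).
  rewrite sqmodE /noise_image Re_sum Im_sum.
  have h1 := sqr_sum_le (fun c => Re ((H t w - H s w) a c * x c w)).
  have h2 := sqr_sum_le (fun c => Im ((H t w - H s w) a c * x c w)).
  apply: le_trans (lerD h1 h2) _; rewrite card_ord -mulrDr -big_split /=.
  by apply: ler_wpM2l => //; apply: ler_sum => c _; rewrite sqmodE.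
apply: ler_wpM2l => //; apply: ler_sum => c _; rewrite sqmodM.
apply: ler_wpM2l; first exact: sqmod_ge0.
by rewrite (bigD1 c)//= lerDl; apply: sumr_ge0 => e _; exact: sqmod_ge0.
Qed.

Let sub_st : <<s F s >> `<=` <<s F t >>.
Proof. by rewrite !filtration_sigmaE//; exact: filtration_mono. Qed.

Let hxt a : cnice_wrt P (F t) (x a).
Proof. exact: cnice_mono sub_st _. Qed.

Let hDt a b : cnice_wrt P (F t) (fun w => D w a b).
Proof.
have [[_ h1] [_ h2]] := increment_nice hH hF adH indH m0 s0 st a b.
have [h3 h4] := increment_entries hF adH s0 st a b.
by split; split.
Qed.

Lemma noise_image_nice a : cnice_wrt P (F t) (noise_image a).
Proof. by apply: cnice_sum => c; apply: cniceM. Qed.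

Let hN := noise_image_nice.

Lemma euler_step_nice a : cnice_wrt P (F t) (euler_step a).
Proof.
apply: cniceD; apply: cniceM => //; exact: cnice_cst.
Qed.

Let np a : nice_wrt P (F t) (p a). Proof. exact: nice_sqmod. Qed.
Let nps a : nice_wrt P (F s) (p a). Proof. exact: nice_sqmod. Qed.
Let nq a : nice_wrt P (F t) (q a). Proof. exact: nice_sqmod. Qed.
Let nW : nice_wrt P (F t) W. Proof. exact: nice_sum. Qed.
Let nWs : nice_wrt P (F s) W. Proof. exact: nice_sum. Qed.
Let nQ : nice_wrt P (F t) Q. Proof. exact: nice_sum. Qed.
Let nmi a : nice_wrt P (F t) (mi a).
Proof. by have [_] : cnice_wrt P (F t) (fun w => Num.conj (x a w) * noise_image a w)
  by apply: cniceM => //; exact: cnice_conj. Qed.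

Let cnY Y : nice_wrt P (F s) Y -> cnice_wrt P (F s) (fun w => Complex (Y w) 0).
Proof. exact: cnice_real. Qed.

Lemma mean_tangent a Y : nice_wrt P (F s) Y -> mean P (fun w => mi a w * Y w) = 0.
Proof.
move=> hY.
pose y c w := x c w * Num.conj (x a w) * Complex (Y w) 0.
have hy c : cnice_wrt P (F s) (y c).
  by apply: cniceM; [apply: cniceM => //; exact: cnice_conj|exact: cnY].
have : cmean P (fun w => \sum_c (H t w - H s w) a c * y c w) = 0.
  rewrite cmean_sum.
    by apply: big1 => c _; case: (increment_mul1 hH hF adH indH m0 s0 st a c (hy c)).
  by move=> c; case: (increment_mul1 hH hF adH indH m0 s0 st a c (hy c)).
move=> /(congr1 (@complex.Im R)) /= <-; apply: eq_Rintegral => w _.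
rewrite /noise_image mulr_sumr !Im_sum mulr_suml; apply: eq_bigr => c _.
rewrite /y; move: (_ a c) (x c w) (x a w) => u v z.
by rewrite !(Re_mul, Im_mul, conjCE) /=; ring.
Qed.

(** As [D] is Hermitian, the conjugate of D_ae is D_ea, and among the products D_ac D_ea only those
    with e = c have nonzero mean. The weight [Y], known at time s, is there for the pair moments,
    where it is the squared modulus of another entry. *)
Lemma mean_noise a Y : nice_wrt P (F s) Y ->
  mean P (fun w => q a w * Y w) = h / m%:R * mean P (fun w => W w * Y w).
Proof.
move=> hY.
pose y c e w := x c w * Num.conj (x e w) * Complex (Y w) 0.
have hy c e : cnice_wrt P (F s) (y c e).
  by apply: cniceM; [apply: cniceM => //; exact: cnice_conj|exact: cnY].
have i2 c e := increment_mul2 hH hF adH indH m0 s0 st a c e a (hy c e).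
have : cmean P (fun w => \sum_c \sum_e ((H t w - H s w) a c * (H t w - H s w) e a) * y c e w) =
   Complex (h / m%:R) 0 * \sum_c cmean P (y c c).
  rewrite cmean_sum.
    rewrite mulr_sumr; apply: eq_bigr => c _; rewrite cmean_sum.
      rewrite (bigD1 c)//= (i2 c c).2 !eqxx mul1r big1 ?addr0// => e ec.
      by rewrite (i2 c e).2 eqxx eq_sym (negbTE ec) !mul0r.
    by move=> e; case: (i2 c e).
  move=> c; split.
    by under eq_fun do rewrite Re_sum; apply: L1_sum => e _; case: (i2 c e) => -[].
  by under eq_fun do rewrite Im_sum; apply: L1_sum => e _; case: (i2 c e) => -[].
move=> /(congr1 (@complex.Re R)); rewrite Re_mul /= mul0r subr0 Re_sum /=.
have -> : mean P (fun w => W w * Y w) = \sum_c mean P (fun w => Re (y c c w)).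
  rewrite -mean_sum; last by move=> c _; exact: nice_L1 (hy c c).1.
  apply: eq_Rintegral => w _; rewrite mulr_suml; apply: eq_bigr => c _.
  by rewrite /y sqmodE !(Re_mul, Im_mul, conjCE) /=; move: (Re _) (Im _) => *; ring.
move=> <-; apply: eq_Rintegral => w _.
have hD := increment_herm hH s0 st w.
have -> : q a w = Re (noise_image a w * Num.conj (noise_image a w)).
  by rewrite sqmodE !(Re_mul, Im_mul, conjCE) /=; ring.
have -> : Num.conj (noise_image a w) =
    \sum_e (H t w - H s w) e a * Num.conj (x e w).
  rewrite /noise_image rmorph_sum; apply: eq_bigr => e _; rewrite rmorphM; congr (_ * _).
  have [h1 h2] := hermsymm_entries e a hD.
  by rewrite -[LHS]/(Num.conj _) conjCE; apply: complex_ext; rewrite ?h1 ?h2.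
rewrite /noise_image mulr_suml !Re_sum mulr_suml; apply: eq_bigr => c _.
rewrite mulr_sumr !Re_sum mulr_suml; apply: eq_bigr => e _.
rewrite /y; move: (_ a c) (_ e a) (x c w) (Num.conj (x e w)) => u v z z'.
by rewrite !(Re_mul, Im_mul) /=; ring.
Qed.

(** Im u Im v = (Re(u conj v) - Re(u v)) / 2. For j != k the first product involves D_jc D_ek and
    has mean 0; the second involves D_jc D_ke, where the correlated pair c = k, e = j survives. This
    is the source of the 2/N in the decay rate of the pair moment. *)
Lemma mean_tangent2 j k : j != k ->
  mean P (fun w => mi j w * mi k w) = - (h / (2 * m%:R)) * mean P (fun w => p j w * p k w).
Proof.
move=> jk.
pose y c e w := Num.conj (x j w) * x c w * (x k w * Num.conj (x e w)).
pose z c e w := Num.conj (x j w) * x c w * (Num.conj (x k w) * x e w).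
have hy c e : cnice_wrt P (F s) (y c e).
  by apply: cniceM; apply: cniceM => //; exact: cnice_conj.
have hz c e : cnice_wrt P (F s) (z c e).
  by apply: cniceM; apply: cniceM => //; exact: cnice_conj.
have iy c e := increment_mul2 hH hF adH indH m0 s0 st j c e k (hy c e).
have iz c e := increment_mul2 hH hF adH indH m0 s0 st j c k e (hz c e).
have L1y c : cL1 P (fun w => \sum_e ((H t w - H s w) j c * (H t w - H s w) e k) * y c e w).
  split.
    by under eq_fun do rewrite Re_sum; apply: L1_sum => e _; case: (iy c e) => -[].
  by under eq_fun do rewrite Im_sum; apply: L1_sum => e _; case: (iy c e) => -[].
have L1z c : cL1 P (fun w => \sum_e ((H t w - H s w) j c * (H t w - H s w) k e) * z c e w).
  split.
    by under eq_fun do rewrite Re_sum; apply: L1_sum => e _; case: (iz c e) => -[].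
  by under eq_fun do rewrite Im_sum; apply: L1_sum => e _; case: (iz c e) => -[].
pose Ay w := \sum_c \sum_e ((H t w - H s w) j c * (H t w - H s w) e k) * y c e w.
pose Az w := \sum_c \sum_e ((H t w - H s w) j c * (H t w - H s w) k e) * z c e w.
have LAy : cL1 P Ay.
  split.
    by under eq_fun do rewrite Re_sum; apply: L1_sum => c _; case: (L1y c).
  by under eq_fun do rewrite Im_sum; apply: L1_sum => c _; case: (L1y c).
have LAz : cL1 P Az.
  split.
    by under eq_fun do rewrite Re_sum; apply: L1_sum => c _; case: (L1z c).
  by under eq_fun do rewrite Im_sum; apply: L1_sum => c _; case: (L1z c).
have ey : cmean P Ay = 0.
  rewrite cmean_sum//; apply: big1 => c _; rewrite cmean_sum; last by move=> e; case: (iy c e).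
  by apply: big1 => e _; rewrite (iy c e).2 (negbTE jk) !mul0r.
have ez : cmean P Az = Complex (h / m%:R) 0 * cmean P (z k j).
  rewrite cmean_sum// (bigD1 k)//= [X in _ + X]big1 ?addr0; last first.
    move=> c ck; rewrite cmean_sum; last by move=> e; case: (iz c e).
    by apply: big1 => e _; rewrite (iz c e).2 (negbTE ck) andbF !mul0r.
  rewrite cmean_sum; last by move=> e; case: (iz k e).
  rewrite (bigD1 j)//= (iz k j).2 !eqxx mul1r big1 ?addr0// => e ej.
  by rewrite (iz k e).2 eq_sym (negbTE ej) !mul0r.
have -> : mean P (fun w => mi j w * mi k w) = mean P (fun w => 2^-1 * (Re (Ay w) - Re (Az w))).
  apply: eq_Rintegral => w _.
  have hD := increment_herm hH s0 st w.
  have -> : Ay w = (Num.conj (x j w) * noise_image j w) *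
                   Num.conj (Num.conj (x k w) * noise_image k w).
    have -> : Num.conj (Num.conj (x k w) * noise_image k w) =
        x k w * Num.conj (noise_image k w).
      by apply: complex_ext; rewrite !(conjCE, Re_mul, Im_mul) /=; ring.
    have -> : Num.conj (noise_image k w) =
       \sum_e (H t w - H s w) e k * Num.conj (x e w).
      rewrite /noise_image rmorph_sum; apply: eq_bigr => e _; rewrite rmorphM; congr (_ * _).
      have [h1 h2] := hermsymm_entries e k hD.
      by rewrite -[LHS]/(Num.conj _) conjCE; apply: complex_ext; rewrite ?h1 ?h2.
    rewrite /Ay /noise_image [Num.conj (x j w) * _]mulr_sumr mulr_suml.
    apply: eq_bigr => c _; rewrite !mulr_sumr; apply: eq_bigr => e _; rewrite /y; ring.
  have -> : Az w = (Num.conj (x j w) * noise_image j w) *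
                   (Num.conj (x k w) * noise_image k w).
    rewrite /Az /noise_image [Num.conj (x j w) * _]mulr_sumr mulr_suml.
    apply: eq_bigr => c _; rewrite !mulr_sumr; apply: eq_bigr => e _; rewrite /z; ring.
  move: (Num.conj (x j w) * _) (Num.conj (x k w) * _) => u v.
  by rewrite !(Re_mul, Im_mul, conjCE) /=; field.
rewrite meanZ; last by apply: L1B; [case: LAy|case: LAz].
rewrite meanB; [|by case: LAy|by case: LAz].
rewrite (_ : mean P (fun w => Re (Ay w)) = Re (cmean P Ay))//.
rewrite (_ : mean P (fun w => Re (Az w)) = Re (cmean P Az))//.
rewrite ey ez Re_mul /= mul0r subr0.
have -> : mean P (fun w => Re (z k j w)) = mean P (fun w => p j w * p k w).
  apply: eq_Rintegral => w _; rewrite /z !sqmodE !(Re_mul, Im_mul, conjCE) /=.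
  by move: (Re _) (Im _) (Re _) (Im _) => *; ring.
by field; rewrite pnatr_eq0 -lt0n.
Qed.

End euler_step.

Lemma weighted_amgm (R : realType) (k u y a b : R) : 0 < k ->
  u ^+ 2 <= a -> y ^+ 2 <= b -> u * y * 2 <= k * a + b / k.
Proof.
move=> k0 ua yb; have z0 : 0 < k^-1 by rewrite invr_gt0.
have e : k * k^-1 = 1 by rewrite divff// gt_eqF.
apply: (@le_trans _ _ (k * u ^+ 2 + y ^+ 2 / k)); last first.
  by apply: lerD; [rewrite ler_pM2l|rewrite ler_pM2r].
have : 0 <= (k * u - y) ^+ 2 * k^-1 by apply: mulr_ge0; [exact: sqr_ge0|exact: ltW].
have -> : (k * u - y) ^+ 2 * k^-1 =
   (k * k^-1) * (k * u ^+ 2) - 2 * (k * k^-1) * (u * y) + y ^+ 2 / k by ring.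
rewrite e; lra.
Qed.

Section euler_step_moments.
Context (d : measure_display) (T : measurableType d) (R : realType)
        (P : probability T R) (m : nat) (F : R -> set (set T)) (H : R -> T -> 'M[R[i]]_m).
Hypotheses (hH : hermitian_brownian_motion P H) (hF : filtration F)
  (adH : adapted F H) (indH : independent_increments P F H) (m0 : (0 < m)%N).
Variable K : R.
Hypothesis K0 : 0 <= K.
Hypothesis hK : forall s t, 0 <= s -> s <= t ->
  mean P (fun w => frob2 (H t w - H s w) ^+ 2) <= K * (t - s) ^+ 2.
Variables (s t : R).
Hypotheses (s0 : 0 <= s) (st : s <= t) (ts1 : t - s <= 1).
Local Notation h := (t - s).
Variable x : 'I_m -> T -> R[i].
Hypothesis hx : forall a, cnice_wrt P (F s) (x a).
Local Notation alpha := (1 - h / 2).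
Local Notation v := (euler_step H s t x).
Local Notation N := (noise_image H s t x).
Local Notation p a := (fun w => sqmod (x a w)).
Local Notation q a := (fun w => sqmod (N a w)).
Local Notation mi a := (fun w => complex.Im (Num.conj (x a w) * N a w)).
Local Notation W := (fun w => \sum_a sqmod (x a w)).
Local Notation Q := (fun w => \sum_a sqmod (N a w)).
Local Notation C := (m%:R ^+ 2 * K).

Let h0 : 0 <= h. Proof. by rewrite subr_ge0. Qed.
Let sub_st : <<s F s >> `<=` <<s F t >>.
Proof.
rewrite !filtration_sigmaE//; first exact: filtration_mono.
exact: le_trans st.
Qed.
Let hxt a : cnice_wrt P (F t) (x a). Proof. exact: cnice_mono sub_st _. Qed.
Let hDt a b : cnice_wrt P (F t) (fun w => (H t w - H s w) a b).
Proof.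
have [[_ h1] [_ h2]] := increment_nice hH hF adH indH m0 s0 st a b.
have [h3 h4] := increment_entries hF adH s0 st a b.
by split; split.
Qed.
Let hN a : cnice_wrt P (F t) (N a).
Proof. by apply: cnice_sum => c; apply: cniceM. Qed.
Let np a : nice_wrt P (F t) (p a). Proof. exact: nice_sqmod. Qed.
Let nps a : nice_wrt P (F s) (p a). Proof. exact: nice_sqmod. Qed.
Let nq a : nice_wrt P (F t) (q a). Proof. exact: nice_sqmod. Qed.
Let nW : nice_wrt P (F t) W. Proof. by apply: nice_sum => a; exact: nice_sqmod. Qed.
Let nWs : nice_wrt P (F s) W. Proof. by apply: nice_sum => a; exact: nice_sqmod. Qed.
Let nQ : nice_wrt P (F t) Q. Proof. by apply: nice_sum => a; exact: nice_sqmod. Qed.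
Let nmi a : nice_wrt P (F t) (mi a).
Proof. by have [_] : cnice_wrt P (F t) (fun w => Num.conj (x a w) * N a w)
  by apply: cniceM => //; exact: cnice_conj. Qed.
Let W0 w : 0 <= W w. Proof. by apply: sumr_ge0 => a _; exact: sqmod_ge0. Qed.
Let Q0 w : 0 <= Q w. Proof. by apply: sumr_ge0 => a _; exact: sqmod_ge0. Qed.
Let pW a w : p a w <= W w.
Proof. by rewrite /= (bigD1 a)//= lerDl; apply: sumr_ge0 => e _; exact: sqmod_ge0. Qed.
Let qQ a w : q a w <= Q w.
Proof. by rewrite /= (bigD1 a)//= lerDl; apply: sumr_ge0 => e _; exact: sqmod_ge0. Qed.
Let mi_le a w : mi a w ^+ 2 <= W w * Q w.
Proof.
apply: (@le_trans _ _ (p a w * q a w)).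
  have -> : p a w * q a w = sqmod (Num.conj (x a w) * N a w).
    by rewrite sqmodM; congr (_ * _); rewrite !sqmodE conjCE /= sqrrN.
  by rewrite sqmodE lerDr sqr_ge0.
by apply: ler_pM; rewrite ?sqmod_ge0// ?pW ?qQ.
Qed.

Lemma euler_step_mass_eq w : \sum_a sqmod (v a w) = alpha ^+ 2 * W w + Q w.
Proof.
under eq_bigr do rewrite euler_step_sqmod.
rewrite big_split /= sumrB -!mulr_sumr (noise_tangent hH s0 st) mulr0 subr0//.
Qed.

Let mean_QY Y : nice_wrt P (F s) Y ->
  mean P (fun w => Q w * Y w) = h * mean P (fun w => W w * Y w).
Proof.
move=> hY.
have hYt := nice_mono sub_st hY.
transitivity (mean P (fun w => \sum_a q a w * Y w)).
  by apply: eq_Rintegral => w _; rewrite mulr_suml.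
rewrite mean_sum; last by move=> a _; apply: (nice_L1 (niceM (nq a) hYt)).
under eq_bigr do rewrite (mean_noise hH hF adH indH m0 s0 st hx _ hY).
rewrite sumr_const card_ord -[LHS]mulr_natl; field.
by rewrite pnatr_eq0 -lt0n.
Qed.

(** The pathwise bound [noise_image_le] separates the increment from the past, and independence
    splits the mean of the product. *)
Lemma mean_noise_sq : mean P (fun w => Q w ^+ 2) <= C * h ^+ 2 * mean P (fun w => W w ^+ 2).
Proof.
have [i1 i2] := increment_class hF adH indH s0 st.
have nfr := increment_frob_nice hH hF adH indH m0 s0 st.
have [j1 j2] := indep_mul i1 (filtration_sigma_sub hF s0) i2 (niceX 2 nfr).1 (niceX 2 nWs).1
   (nice_L1 (niceX 2 nfr)) (nice_L1 (niceX 2 nWs)).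
apply: (@le_trans _ _ (mean P (fun w => m%:R ^+ 2 *
     (frob2 (H t w - H s w) ^+ 2 * W w ^+ 2)))).
  apply: mean_le; [exact: nice_L1 (niceX 2 nQ)|exact: L1Z|move=> w].
  have := noise_image_le H s t x w => le; rewrite mulrA -!exprMn.
  by rewrite lerXn2r// nnegrE// !mulr_ge0// frob2_ge0.
rewrite meanZ// j2; set M := mean P (fun w => W w ^+ 2).
have M0 : 0 <= M by apply: mean_ge0 => w; exact: sqr_ge0.
have -> : C * h ^+ 2 * M = m%:R ^+ 2 * (K * h ^+ 2 * M) by ring.
by apply: ler_wpM2l; [exact: sqr_ge0|apply: ler_wpM2r => //; exact: hK].
Qed.

(** alpha^2 + h = 1 + h^2 / 4: up to second order, the drift removes the mass h that the noise adds
    in the mean. *)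
Lemma euler_step_mass : mean P (fun w => \sum_a sqmod (v a w)) =
  (1 + h ^+ 2 / 4) * mean P W.
Proof.
transitivity (mean P (fun w => alpha ^+ 2 * W w + Q w)).
  by apply: eq_Rintegral => w _; rewrite euler_step_mass_eq.
rewrite meanD; [|exact: L1Z (nice_L1 nW)|exact: nice_L1 nQ].
rewrite meanZ; last exact: nice_L1 nW.
have := mean_QY (nice_cst P (F s) 1).
rewrite (_ : mean P (fun w => Q w * 1) = mean P Q); last by apply: eq_Rintegral => w _; rewrite mulr1.
rewrite (_ : mean P (fun w => W w * 1) = mean P W); last by apply: eq_Rintegral => w _; rewrite mulr1.
by move=> ->; field.
Qed.

(** Again the terms of order h cancel, since alpha^4 + 2 alpha^2 h = 1 - h^2/2 + h^4/16; what
    remains is the mean of Q^2, of order h^2. *)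
Lemma euler_step_mass2 : mean P (fun w => (\sum_a sqmod (v a w)) ^+ 2) <=
  (1 + (1 + C) * h ^+ 2) * mean P (fun w => W w ^+ 2).
Proof.
have B0 : 0 <= mean P (fun w => W w ^+ 2) by apply: mean_ge0 => w; exact: sqr_ge0.
have e : mean P (fun w => (\sum_a sqmod (v a w)) ^+ 2) =
   alpha ^+ 4 * mean P (fun w => W w ^+ 2) + 2 * alpha ^+ 2 * (h * mean P (fun w => W w ^+ 2)) +
   mean P (fun w => Q w ^+ 2).
  have -> : h * mean P (fun w => W w ^+ 2) = mean P (fun w => Q w * W w).
    by rewrite mean_QY//; congr (_ * _); apply: eq_Rintegral => w _; rewrite expr2.
  rewrite -meanZ; last exact: nice_L1 (niceX 2 nW).
  rewrite -meanZ; last exact: nice_L1 (niceM nQ nW).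
  rewrite -meanD; [|exact: L1Z (nice_L1 (niceX 2 nW))|exact: L1Z (nice_L1 (niceM nQ nW))].
  rewrite -meanD; [|apply: L1D; [exact: L1Z (nice_L1 (niceX 2 nW))|exact: L1Z (nice_L1 (niceM nQ nW))]
                   |exact: nice_L1 (niceX 2 nQ)].
  by apply: eq_Rintegral => w _; rewrite euler_step_mass_eq; ring.
rewrite e; have := mean_noise_sq; move: B0.
move: (mean P (fun w => Q w ^+ 2)) (mean P (fun w => W w ^+ 2)) => Y X B0 h2.
have : (alpha ^+ 4 + 2 * alpha ^+ 2 * h) * X <= (1 + h ^+ 2) * X.
  apply: ler_wpM2r => //.
  have h4 : h ^+ 4 <= h ^+ 2 by rewrite -[4%N]/(2 + 2)%N exprD ler_piMr ?sqr_ge0// expr_le1.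
  have -> : alpha ^+ 4 + 2 * alpha ^+ 2 * h = 1 - h ^+ 2 / 2 + h ^+ 4 / 16 by field.
  have := sqr_ge0 h; lra.
move: h2; move: (h ^+ 2) => hh; nra.
Qed.

Lemma euler_step_p j : mean P (fun w => sqmod (v j w)) =
  alpha ^+ 2 * mean P (p j) + h / m%:R * mean P W.
Proof.
transitivity (mean P (fun w => (alpha ^+ 2 * p j w - 2 * alpha * mi j w) + q j w)).
  by apply: eq_Rintegral => w _; rewrite euler_step_sqmod.
have L1a := L1Z (alpha ^+ 2) (nice_L1 (np j)).
have L1b := L1Z (2 * alpha) (nice_L1 (nmi j)).
rewrite meanD; [|exact: L1B|exact: nice_L1 (nq j)].
rewrite meanB// meanZ; last exact: nice_L1 (np j).
rewrite meanZ; last exact: nice_L1 (nmi j).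
have := mean_noise hH hF adH indH m0 s0 st hx j (nice_cst P (F s) 1).
have := mean_tangent hH hF adH indH m0 s0 st hx j (nice_cst P (F s) 1).
rewrite (_ : mean P (fun w => mi j w * 1) = mean P (mi j)); last by apply: eq_Rintegral => w _; rewrite mulr1.
rewrite (_ : mean P (fun w => q j w * 1) = mean P (q j)); last by apply: eq_Rintegral => w _; rewrite mulr1.
rewrite (_ : mean P (fun w => W w * 1) = mean P W); last by apply: eq_Rintegral => w _; rewrite mulr1.
by move=> -> ->; rewrite mulr0 subr0.
Qed.

(** In the expanded product the terms linear in the noise have mean zero and the quadratic ones are
    computed exactly. The remainder [rho] contains products of size h^(3/2), which are only bounded:
    [kappa] is the weight of Young's inequality, later the square root of h / t. *)
Lemma euler_step_pp j k kappa : j != k -> 0 < kappa ->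
  `|mean P (fun w => sqmod (v j w) * sqmod (v k w)) -
    ((alpha ^+ 4 - 2 * alpha ^+ 2 * (h / m%:R)) * mean P (fun w => p j w * p k w) +
     alpha ^+ 2 * (h / m%:R * (mean P (fun w => W w * p j w) + mean P (fun w => W w * p k w))))|
  <= (2 * (kappa * h + C * h ^+ 2 / kappa) + C * h ^+ 2) * mean P (fun w => W w ^+ 2).
Proof.
move=> jk kp0.
have ha : 0 <= alpha <= 1.
  rewrite subr_ge0 gerBl divr_ge0// andbT ler_pdivrMr// mul1r.
  by apply: (le_trans ts1); rewrite ler1n.
pose rho w := - (2 * alpha) * (mi j w * q k w + mi k w * q j w) + q j w * q k w.
have nrho : nice_wrt P (F t) rho.
  apply: niceD; last exact: niceM.
  by apply: niceM; [exact: nice_cst|apply: niceD; exact: niceM].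
have hL X Y : nice_wrt P (F t) X -> nice_wrt P (F t) Y -> L1 P (fun w => X w * Y w).
  by move=> hX hY; exact: nice_L1 (niceM hX hY).
have e : mean P (fun w => sqmod (v j w) * sqmod (v k w)) =
   alpha ^+ 4 * mean P (fun w => p j w * p k w) +
   4 * alpha ^+ 2 * mean P (fun w => mi j w * mi k w) +
   alpha ^+ 2 * (mean P (fun w => q k w * p j w) + mean P (fun w => q j w * p k w)) -
   2 * alpha ^+ 3 * (mean P (fun w => mi k w * p j w) + mean P (fun w => mi j w * p k w)) +
   mean P rho.
  rewrite -!meanD; try exact: hL.
  rewrite -!meanZ; try exact: hL; try (apply: L1D; exact: hL).
  have l1 := L1Z (alpha ^+ 4) (hL _ _ (np j) (np k)).
  have l2 := L1Z (4 * alpha ^+ 2) (hL _ _ (nmi j) (nmi k)).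
  have l3 := L1Z (alpha ^+ 2) (L1D (hL _ _ (nq k) (np j)) (hL _ _ (nq j) (np k))).
  have l4 := L1Z (2 * alpha ^+ 3) (L1D (hL _ _ (nmi k) (np j)) (hL _ _ (nmi j) (np k))).
  rewrite -meanD// -meanD//; last exact: L1D.
  rewrite -meanB//; last by apply: L1D => //; exact: L1D.
  rewrite -meanD//; last 2 first.
  - by apply: L1B => //; apply: L1D => //; exact: L1D.
  - exact: nice_L1 nrho.
  apply: eq_Rintegral => w _; rewrite !euler_step_sqmod /rho.
  by move: (p j w) (p k w) (q j w) (q k w) (mi j w) (mi k w) => *; ring.
have et1 := mean_tangent hH hF adH indH m0 s0 st hx k (nps j).
have et2 := mean_tangent hH hF adH indH m0 s0 st hx j (nps k).
have en1 := mean_noise hH hF adH indH m0 s0 st hx k (nps j).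
have en2 := mean_noise hH hF adH indH m0 s0 st hx j (nps k).
have emm := mean_tangent2 hH hF adH indH m0 s0 st hx jk.
rewrite e emm et1 et2 en1 en2.
set A := mean P (fun w => p j w * p k w).
set B1 := mean P (fun w => W w * p j w); set B2 := mean P (fun w => W w * p k w).
have -> : alpha ^+ 4 * A + 4 * alpha ^+ 2 * (- (h / (2 * m%:R)) * A) +
    alpha ^+ 2 * (h / m%:R * B1 + h / m%:R * B2) - 2 * alpha ^+ 3 * (0 + 0) + mean P rho -
    ((alpha ^+ 4 - 2 * alpha ^+ 2 * (h / m%:R)) * A + alpha ^+ 2 * (h / m%:R * (B1 + B2))) =
    mean P rho.
  by field; rewrite pnatr_eq0 -lt0n.
apply: le_trans (mean_norm (nice_L1 nrho)) _.
have nWQ := hL _ _ nQ nW.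
have nQQ := nice_L1 (niceX 2 nQ).
apply: (@le_trans _ _ (mean P (fun w => (2 * kappa) * (Q w * W w) + (2 / kappa + 1) * Q w ^+ 2))).
  apply: mean_le.
  - exact: L1_norm (nice_L1 nrho).
  - by apply: L1D; exact: L1Z.
  move=> w; rewrite /rho.
  have [qj qk] := (qQ j w, qQ k w); have [q0j q0k] := (sqmod_ge0 (N j w), sqmod_ge0 (N k w)).
  have amgm (u y : R) : u ^+ 2 <= W w * Q w -> 0 <= y <= Q w ->
      `|u * y| * 2 <= kappa * (Q w * W w) + Q w ^+ 2 / kappa.
    move=> hu /andP[y0 yQ].
    rewrite normrM (ger0_norm y0); apply: weighted_amgm => //.
      by rewrite real_normK ?num_real// [Q w * _]mulrC.
    by rewrite lerXn2r// nnegrE.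
  have a1 := amgm (mi j w) (q k w) (mi_le j w); have a2 := amgm (mi k w) (q j w) (mi_le k w).
  have {}a1 := a1 _; have {}a2 := a2 _.
  rewrite q0k qk in a1; rewrite q0j qj in a2; have {}a1 := a1 isT; have {}a2 := a2 isT.
  have a3 : `|q j w * q k w| <= Q w ^+ 2.
    rewrite (ger0_norm (mulr_ge0 q0j q0k)) [X in _ <= X]expr2.
    exact: ler_pM.
  apply: le_trans (ler_normD _ _) _.
  have a4 : `|- (2 * alpha) * (mi j w * q k w + mi k w * q j w)| <=
     2 * (`|mi j w * q k w| + `|mi k w * q j w|).
    rewrite normrM; have := ler_normD (mi j w * q k w) (mi k w * q j w).
    have -> : `|- (2 * alpha)| = 2 * alpha by rewrite normrN ger0_norm//; lra.
    have := normr_ge0 (mi j w * q k w + mi k w * q j w).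
    move: `|_ + _| `|_ * _| `|_ * _| => y1 y2 y3; move/andP: ha => [ha1 ha2]; nra.
  have -> : 2 * kappa * (Q w * W w) + (2 / kappa + 1) * Q w ^+ 2 =
      2 * (kappa * (Q w * W w) + Q w ^+ 2 / kappa) + Q w ^+ 2.
    by move: (\sum_a sqmod (N a w)) (\sum_a sqmod (x a w)) => ? ?; ring.
  move: a1 a2 a3 a4.
  move: (kappa * (Q w * W w) + Q w ^+ 2 / kappa) (Q w ^+ 2) => X1 X2.
  by move: `|_| `|_| `|_| `|_| => y1 y2 y3 y4; lra.
rewrite meanD; [|exact: L1Z|exact: L1Z].
rewrite meanZ// meanZ// mean_QY//.
have -> : mean P (fun w => W w * W w) = mean P (fun w => W w ^+ 2).
  by apply: eq_Rintegral => w _; rewrite expr2.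
have := mean_noise_sq; set X := mean P (fun w => Q w ^+ 2); set Y := mean P (fun w => W w ^+ 2).
move=> hXY.
have c0 : 0 <= 2 / kappa + 1 by rewrite addr_ge0// divr_ge0// ltW.
have -> : (2 * (kappa * h + C * h ^+ 2 / kappa) + C * h ^+ 2) * Y =
    2 * kappa * (h * Y) + (2 / kappa + 1) * (C * h ^+ 2 * Y) by ring.
by rewrite lerD2l; exact: ler_wpM2l.
Qed.

End euler_step_moments.

(** * Error propagation in scalar recursions *)

Section linear_recursions.
Context (R : realType).

Lemma expRN_linear (x : R) : 0 <= x <= 1 -> `|(1 - x) - expR (- x)| <= x ^+ 2.
Proof.
move=> /andP[x0 x1].
have lo : 1 + - x <= expR (- x) by exact: expR_ge1Dx.
have hi : expR (- x) <= 1 - x + x ^+ 2.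
  have e1 : 1 + x <= expR x by exact: expR_ge1Dx.
  have e2 : expR x * expR (- x) = 1 by rewrite -expRD subrr expR0.
  have e3 := expR_gt0 (- x).
  have : (1 + x) * expR (- x) <= 1.
    by apply: (@le_trans _ _ (expR x * expR (- x))); rewrite ?ler_pM2r ?e2.
  have : 0 <= x ^+ 3 by rewrite exprn_ge0.
  have -> : x ^+ 3 = (1 + x) * (1 - x + x ^+ 2) - 1 by ring.
  move: (expR (- x)) (1 - x + x ^+ 2) => e b h1 h2.
  have : (1 + x) * (b - e) >= 0 by lra.
  by rewrite pmulr_rge0 ?subr_ge0//; lra.
by rewrite ler_norml; apply/andP; split; lra.
Qed.

(** Compare with the exact factor exp(-lambda h): a step adds the local error [rho] and the defect
    of 1 - lambda h, at most (lambda h)^2 Y, while earlier errors are not amplified because the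
    factor is at most 1. *)
Lemma perturbed_decay (y : nat -> R) (lambda h rho Y : R) (L : nat) :
  0 <= lambda * h <= 1 -> 0 <= rho -> 0 <= Y ->
  (forall i, (i < L)%N -> `|y i| <= Y) ->
  (forall i, (i < L)%N -> `|y i.+1 - (1 - lambda * h) * y i| <= rho) ->
  `|y L - expR (- (lambda * h * L%:R)) * y 0%N| <= L%:R * (rho + (lambda * h) ^+ 2 * Y).
Proof.
move=> lh rho0 Y0 hY hy; set x := lambda * h in lh hy *.
have hx := expRN_linear lh.
have e0 : 0 < expR (- x) by exact: expR_gt0.
have e1 : expR (- x) <= 1 by rewrite expR_le1 oppr_le0; case/andP: lh.
have : forall i, (i <= L)%N ->
    `|y i - expR (- (x * i%:R)) * y 0%N| <= i%:R * (rho + x ^+ 2 * Y); last exact.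
elim=> [_|i ih iL]; first by rewrite mulr0 oppr0 expR0 mul1r subrr normr0 mul0r.
have -> : y i.+1 - expR (- (x * i.+1%:R)) * y 0%N =
   (y i.+1 - (1 - x) * y i) + ((1 - x) - expR (- x)) * y i +
   expR (- x) * (y i - expR (- (x * i%:R)) * y 0%N).
  have -> : - (x * i.+1%:R) = - x + - (x * i%:R) by rewrite -natr1; ring.
  by rewrite expRD; ring.
apply: le_trans (ler_normD _ _) _.
have -> : i.+1%:R * (rho + x ^+ 2 * Y) = (rho + x ^+ 2 * Y) + i%:R * (rho + x ^+ 2 * Y).
  by rewrite -natr1 mulrDl mul1r addrC.
apply: lerD.
  apply: le_trans (ler_normD _ _) _; apply: lerD; first exact: hy.
  by rewrite normrM; apply: ler_pM => //; exact: hY.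
rewrite normrM (ger0_norm (ltW e0)); apply: le_trans (ih (ltnW iL)).
exact: ler_piMl.
Qed.

End linear_recursions.

Section moment_recursion.
Context (R : realType).
Variables (N h kappa t B D E : R).
Hypotheses (N1 : 1 <= N) (h0 : 0 <= h) (h4 : 4 * h <= 1) (kp0 : 0 <= kappa <= 1)
  (t0 : 0 <= t) (hE : h = t * kappa ^+ 2) (B0 : 0 <= B) (D0 : 0 <= D) (E0 : 0 <= E).
Local Notation alpha := (1 - h / 2).
Local Notation lambda := (2 + 2 / N).

Let N0 : 0 < N. Proof. exact: lt_le_trans N1. Qed.
Let Ninv : 0 < N^-1 <= 1. Proof. by rewrite invr_gt0 N0 invf_le1. Qed.
Let h1 : h <= 1. Proof. by have := h4; have := h0; lra. Qed.
Let hk : h <= t * kappa.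
Proof.
rewrite hE; apply: ler_wpM2l => //; rewrite expr2.
by case/andP: kp0 => k0 k1; exact: ler_piMr.
Qed.

(** alpha^2 = 1 - h + h^2/4 and the equilibrium is 1/N; left over are the term in h^2 and the
    deviation of the total mass [w] from 1. *)
Lemma mass_recursion_error (b b' w : R) : 0 <= b <= B -> 0 <= w - 1 <= E * h ->
  b' = alpha ^+ 2 * b + h / N * w ->
  `|(b' - N^-1) - (1 - h) * (b - N^-1)| <= h * (kappa * (t * (B + E))).
Proof.
move=> /andP[b0 bB] /andP[w0 wE] ->; have h0' := h0.
have /andP[n0 n1] := Ninv.
have -> : alpha ^+ 2 * b + h / N * w - N^-1 - (1 - h) * (b - N^-1) =
   h * (h / 4 * b + N^-1 * (w - 1)).
  by field; rewrite gt_eqF.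
rewrite normrM (ger0_norm h0); apply: ler_wpM2l => //.
have p1 : 0 <= h / 4 * b by rewrite mulr_ge0// divr_ge0.
have p2 : 0 <= N^-1 * (w - 1) by rewrite mulr_ge0// ltW.
rewrite ger0_norm ?addr_ge0//.
have -> : kappa * (t * (B + E)) = (t * kappa) * B + (t * kappa) * E by ring.
apply: lerD.
  apply: (@le_trans _ _ (h * b)).
    by apply: ler_wpM2r => //; lra.
  by apply: ler_pM.
apply: (@le_trans _ _ (w - 1)); first by apply: ler_piMl => //; exact: ltW.
apply: le_trans wE _; rewrite mulrC; exact: ler_wpM2r.
Qed.

(** Up to h^2 the coefficient of [a] is 1 - lambda h. Besides second order terms, bounded through h
    <= t kappa, the error comes from the weight by the total mass: [wj] stands for E[W |z_j|^2] and
    [bj] for E|z_j|^2. *)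
Lemma pair_recursion_error (a a' bj bk wj wk : R) :
  0 <= a <= B -> 0 <= bj <= B -> 0 <= bk <= B ->
  `|wj - bj| <= D * kappa -> `|wk - bk| <= D * kappa ->
  `|a' - ((alpha ^+ 4 - 2 * alpha ^+ 2 * (h / N)) * a +
           alpha ^+ 2 * (h / N * (wj + wk)))| <= h * (kappa * E) ->
  `|a' - ((1 - lambda * h) * a + h / N * (bj + bk))| <=
   h * (kappa * (E + 2 * D + 6 * t * B)).
Proof.
move=> /andP[a0 aB] /andP[bj0 bjB] /andP[bk0 bkB] hj hk' ha'.
have [h0' h4'] := (h0, h4).
have /andP[n0 n1] := Ninv.
have -> : a' - ((1 - lambda * h) * a + h / N * (bj + bk)) =
  (a' - ((alpha ^+ 4 - 2 * alpha ^+ 2 * (h / N)) * a + alpha ^+ 2 * (h / N * (wj + wk)))) +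
  (h * (h * ((3 / 2 - h / 2 + h ^+ 2 / 16) + 2 / N * (1 - h / 4)) * a) +
   h * (N^-1 * (alpha ^+ 2 * ((wj - bj) + (wk - bk))) -
        h * (N^-1 * (1 - h / 4) * (bj + bk)))).
  by field; rewrite gt_eqF.
have al : 0 <= alpha ^+ 2 <= 1.
  by rewrite sqr_ge0 /= expr_le1//; lra.
apply: le_trans (ler_normD _ _) _.
have -> : h * (kappa * (E + 2 * D + 6 * t * B)) =
  h * (kappa * E) + (h * (4 * (t * kappa) * B) + h * (2 * (D * kappa) + t * kappa * (2 * B))) by ring.
apply: lerD => //; apply: le_trans (ler_normD _ _) _; apply: lerD.
  rewrite !normrM (ger0_norm h0) (ger0_norm a0); apply: ler_wpM2l => //.
  apply: ler_pM => //; first by rewrite mulr_ge0.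
  rewrite mulrC; apply: ler_pM => //.
  have c1 : 0 <= 2 / N * (1 - h / 4) <= 2.
    rewrite mulr_ge0 ?mulr_ge0//=; [|exact: ltW|lra].
    rewrite -mulrA -[X in _ <= X]mulr1; apply: ler_wpM2l => //.
    by apply: mulr_ile1 => //; [exact: ltW|lra|lra].
  have hh : 0 <= h ^+ 2 <= h by rewrite sqr_ge0 expr2 ler_piMr.
  rewrite ger0_norm; last by lra.
  lra.
rewrite normrM (ger0_norm h0); apply: ler_wpM2l => //.
apply: le_trans (ler_normB _ _) _; apply: lerD.
  rewrite normrM (ger0_norm (ltW n0)) normrM (ger0_norm (sqr_ge0 alpha)).
  apply: (@le_trans _ _ (1 * (1 * `|wj - bj + (wk - bk)|))).
    apply: ler_pM => //; [exact: ltW|by rewrite mulr_ge0// sqr_ge0|].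
    by apply: ler_wpM2r => //; case/andP: al.
  by rewrite !mul1r; apply: le_trans (ler_normD _ _) _; lra.
rewrite !normrM (ger0_norm h0); apply: ler_pM => //.
rewrite (ger0_norm (ltW n0)) ger0_norm; last lra.
rewrite ger0_norm ?addr_ge0//; apply: (@le_trans _ _ (1 * (bj + bk))); last lra.
apply: ler_wpM2r; first exact: addr_ge0.
by apply: mulr_ile1 => //; [exact: ltW|lra|lra].
Qed.

(** This combination diagonalises the triangular recursion. The first moments decay at rate 1
    towards 1/N, so their coefficient is (1/N) / (lambda - 1) = 1/(N + 2), and the constant is
    (2/N^2) / lambda = 1/(N (N + 1)). *)
Lemma gamma_recursion_error (a a' bj bk bj' bk' e1 e2 : R) :
  `|(bj' - N^-1) - (1 - h) * (bj - N^-1)| <= e1 ->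
  `|(bk' - N^-1) - (1 - h) * (bk - N^-1)| <= e1 ->
  `|a' - ((1 - lambda * h) * a + h / N * (bj + bk))| <= e2 ->
  `|(a' - (N + 2)^-1 * (bj' + bk' - 2 / N) - (N * (N + 1))^-1) -
    (1 - lambda * h) * (a - (N + 2)^-1 * (bj + bk - 2 / N) - (N * (N + 1))^-1)| <=
   e2 + 2 * e1.
Proof.
move=> hj hk' ha; have N1' := N1.
have -> : (a' - (N + 2)^-1 * (bj' + bk' - 2 / N) - (N * (N + 1))^-1) -
    (1 - lambda * h) * (a - (N + 2)^-1 * (bj + bk - 2 / N) - (N * (N + 1))^-1) =
  (a' - ((1 - lambda * h) * a + h / N * (bj + bk))) -
  (N + 2)^-1 * (((bj' - N^-1) - (1 - h) * (bj - N^-1)) + ((bk' - N^-1) - (1 - h) * (bk - N^-1))).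
  by field; rewrite !gt_eqF//; lra.
have i0 : 0 <= (N + 2)^-1 <= 1.
  by rewrite invr_ge0 invf_le1; lra.
apply: le_trans (ler_normB _ _) _; apply: lerD => //.
rewrite normrM ger0_norm; last by case/andP: i0.
move: hj hk'; move: (_ - _ * _) (_ - _ * _) => u v hj hk'.
apply: (@le_trans _ _ `|v + u|); first by apply: ler_piMl => //; case/andP: i0.
by apply: le_trans (ler_normD _ _) _; lra.
Qed.

End moment_recursion.

(** * Moments along the Euler scheme *)

(** Growth of order h^2 over at most t/h steps is of order h: the power is at most exp(y) with y = c
    t h, and exp(y) (1 - y) <= 1 gives exp(y) <= 1 + y exp(y). *)
Lemma expr_growth_le (R : realType) (c h t : R) (i : nat) : 0 <= c -> 0 <= h <= 1 -> i%:R * h <= t ->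
  (1 + c * h ^+ 2) ^+ i <= 1 + (c * t * expR (c * t)) * h.
Proof.
move=> c0 /andP[h0 h1] iht.
have t0 : 0 <= t by apply: le_trans iht; rewrite mulr_ge0.
have y0 : 0 <= c * t * h by rewrite !mulr_ge0.
apply: (@le_trans _ _ (expR (c * t * h))).
  apply: (@le_trans _ _ (expR (c * h ^+ 2) ^+ i)).
    rewrite lerXn2r ?nnegrE ?expR_ge0 ?expR_ge1Dx// addr_ge0// mulr_ge0// sqr_ge0//.
  rewrite -expRM_natr ler_expR.
  have -> : c * h ^+ 2 * i%:R = (c * h) * (i%:R * h) by ring.
  have -> : c * t * h = (c * h) * t by ring.
  by apply: ler_wpM2l => //; exact: mulr_ge0.
have e1 : 1 + - (c * t * h) <= expR (- (c * t * h)) by exact: expR_ge1Dx.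
have e2 : expR (c * t * h) * expR (- (c * t * h)) = 1 by rewrite -expRD subrr expR0.
have e3 := expR_gt0 (c * t * h).
have e4 : expR (c * t * h) * (1 - c * t * h) <= 1.
  by rewrite -[X in _ <= X]e2 ler_pM2l.
have e5 : expR (c * t * h) <= expR (c * t) by rewrite ler_expR ler_piMr// mulr_ge0.
have : c * t * h * expR (c * t * h) <= c * t * h * expR (c * t) by apply: ler_wpM2l.
have -> : c * t * expR (c * t) * h = c * t * h * expR (c * t) by ring.
move: e4; rewrite mulrBr mulr1 [expR _ * (c * t * h)]mulrC; lra.
Qed.

(** The noise multiplies from the left, so each column of the matrix scheme is a chain of vectors of
    its own. *)
Fixpoint euler_chain (d : measure_display) (T : measurableType d) (R : realType) (m : nat) (H : R -> T -> 'M[R[i]]_m)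
    (x0 : 'I_m -> R[i]) (h : R) (i : nat) : 'I_m -> T -> R[i] :=
  if i is i'.+1 then euler_step H (i'%:R * h) (i'.+1%:R * h) (euler_chain H x0 h i')
  else fun a _ => x0 a.

Section euler_chain_moments.
Context (d : measure_display) (T : measurableType d) (R : realType)
        (P : probability T R) (m : nat) (F : R -> set (set T)) (H : R -> T -> 'M[R[i]]_m).
Hypotheses (hH : hermitian_brownian_motion P H) (hF : filtration F)
  (adH : adapted F H) (indH : independent_increments P F H) (m0 : (0 < m)%N).
Variable K : R.
Hypothesis K0 : 0 <= K.
Hypothesis hK : forall s t, 0 <= s -> s <= t ->
  mean P (fun w => frob2 (H t w - H s w) ^+ 2) <= K * (t - s) ^+ 2.
Variable x0 : 'I_m -> R[i].
Hypothesis hx0 : \sum_a sqmod (x0 a) = 1.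

Section fixed_step.
Variable h : R.
Hypothesis h01 : 0 <= h <= 1.
Let h0 : 0 <= h. Proof. by case/andP: h01. Qed.
Local Notation x := (euler_chain H x0 h).
Local Notation W i := (fun w => \sum_a sqmod (x i a w)).
Local Notation p i a := (fun w => sqmod (x i a w)).

Let stepE i : i.+1%:R * h - i%:R * h = h.
Proof. by rewrite -natr1 mulrDl mul1r addrAC subrr add0r. Qed.
Let ti0 i : 0 <= i%:R * h. Proof. exact: mulr_ge0. Qed.
Let tiS i : i%:R * h <= i.+1%:R * h. Proof. by rewrite -subr_ge0 stepE. Qed.
Let step1 i : i.+1%:R * h - i%:R * h <= 1. Proof. by rewrite stepE; case/andP: h01. Qed.

Lemma euler_chain_nice i a : cnice_wrt P (F (i%:R * h)) (x i a).
Proof.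
elim: i a => [|i ih] a; first exact: cnice_cst.
exact: (euler_step_nice hH hF adH indH m0).
Qed.

Let np i a : nice_wrt P (F (i%:R * h)) (p i a).
Proof. by apply: nice_sqmod; exact: euler_chain_nice. Qed.
Let nW i : nice_wrt P (F (i%:R * h)) (W i).
Proof. by apply: nice_sum => a; exact: np. Qed.

Lemma euler_chain_mass i : mean P (W i) = (1 + h ^+ 2 / 4) ^+ i.
Proof.
elim: i => [|i ih]; first by rewrite expr0 /= hx0 mean_cst.
rewrite exprS -ih -{2}(stepE i).
exact: (euler_step_mass hH hF adH indH m0 (ti0 i) (tiS i) (euler_chain_nice i)).
Qed.

Lemma euler_chain_mass2 i :
  mean P (fun w => W i w ^+ 2) <= (1 + (1 + m%:R ^+ 2 * K) * h ^+ 2) ^+ i.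
Proof.
elim: i => [|i ih]; first by rewrite expr0 /= hx0 expr1n mean_cst.
have := euler_step_mass2 hH hF adH indH m0 hK (ti0 i) (tiS i) (step1 i) (euler_chain_nice i).
move=> h2; apply: (le_trans h2); rewrite stepE [X in _ <= X]exprS.
have c0 : 0 <= 1 + (1 + m%:R ^+ 2 * K) * h ^+ 2.
  by rewrite addr_ge0// mulr_ge0 ?sqr_ge0// addr_ge0// mulr_ge0// sqr_ge0.
exact: (ler_wpM2l c0 ih).
Qed.

Variable t : R.
Local Notation C2 := (1 + m%:R ^+ 2 * K).
Local Notation C1 := (C2 * t * expR (C2 * t)).
Let C20 : 0 <= C2. Proof. by rewrite addr_ge0// mulr_ge0// sqr_ge0. Qed.

(** E[W^2] <= 1 + O(h) together with E[W] >= 1 bounds E[(W - 1)^2] = E[W^2] - 2 E[W] + 1: the mass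
    concentrates at 1 by its first two moments alone. *)
Lemma euler_chain_mass_bounds i : i%:R * h <= t ->
  [/\ 0 <= mean P (W i) - 1 <= C1 * h, mean P (fun w => W i w ^+ 2) <= 1 + C1 * h &
      mean P (fun w => (W i w - 1) ^+ 2) <= C1 * h].
Proof.
move=> it.
have m2 : mean P (fun w => W i w ^+ 2) <= 1 + C1 * h.
  by apply: (le_trans (euler_chain_mass2 i)); exact: expr_growth_le.
have h2 : 0 <= h ^+ 2 by exact: sqr_ge0.
have m1 : 1 <= mean P (W i).
  by rewrite euler_chain_mass exprn_ege1// lerDl divr_ge0.
have m1' : mean P (W i) <= 1 + C1 * h.
  rewrite euler_chain_mass; apply: le_trans (expr_growth_le C20 h01 it).
  rewrite lerXn2r ?nnegrE ?addr_ge0 ?divr_ge0 ?mulr_ge0// lerD2l mulrC.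
  apply: ler_wpM2r => //; apply: (@le_trans _ _ 1); first by rewrite invf_le1// ler1n.
  by rewrite lerDl mulr_ge0// sqr_ge0.
split => //; first by apply/andP; split; lra.
have -> : mean P (fun w => (W i w - 1) ^+ 2) =
    mean P (fun w => W i w ^+ 2) - (2 * mean P (W i) - 1).
  rewrite -[X in _ - (_ - X)](mean_cst P 1) -meanZ; last exact: nice_L1 (nW i).
  rewrite -meanB; [|exact: L1Z (nice_L1 (nW i))|exact: L1_cst].
  rewrite -meanB; [|exact: nice_L1 (niceX 2 (nW i))|].
    by apply: eq_Rintegral => w _; ring.
  by apply: L1B; [exact: L1Z (nice_L1 (nW i))|exact: L1_cst].
lra.
Qed.

Let pW i a w : p i a w <= W i w.
Proof. by rewrite /= (bigD1 a)//= lerDl; apply: sumr_ge0 => e _; exact: sqmod_ge0. Qed.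
Let W0 i w : 0 <= W i w. Proof. by apply: sumr_ge0 => a _; exact: sqmod_ge0. Qed.

Variable kappa : R.
Hypotheses (kp0 : 0 < kappa) (kp1 : kappa <= 1) (hE : h = t * kappa ^+ 2) (t0 : 0 <= t).
Let C10 : 0 <= C1. Proof. by rewrite !mulr_ge0// expR_ge0. Qed.

(** |y| <= kappa + y^2 / kappa, and a second moment of order h divided by kappa is of order kappa,
    as h = t kappa^2. *)
Lemma euler_chain_mass_dev i : i%:R * h <= t ->
  mean P (fun w => `|W i w - 1|) <= kappa * (1 + C1 * t).
Proof.
move=> it; have [_ _ v] := euler_chain_mass_bounds it.
have nV : nice_wrt P (F (i%:R * h)) (fun w => W i w - 1) by apply: niceB => //; exact: nice_cst.
have L1V := nice_L1 (niceX 2 nV).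
apply: (@le_trans _ _ (mean P (fun w => kappa + kappa^-1 * (W i w - 1) ^+ 2))).
  apply: mean_le; [exact: L1_norm (nice_L1 nV)|by apply: L1D; [exact: L1_cst|exact: L1Z]|].
  move=> w; have := @weighted_amgm R kappa 1 `|W i w - 1| 1 ((W i w - 1) ^+ 2) kp0.
  rewrite expr1n real_normK ?num_real// => /(_ (lexx _) (lexx _)).
  rewrite !mul1r mulr1 [_ / kappa]mulrC.
  have := normr_ge0 (W i w - 1); move: `|_| (kappa^-1 * _) => u y; lra.
rewrite meanD ?mean_cst ?meanZ//; [|exact: L1_cst|exact: L1Z].
rewrite mulrDr mulr1 lerD2l.
apply: (@le_trans _ _ (kappa^-1 * (C1 * h))).
  by apply: ler_wpM2l => //; rewrite invr_ge0 ltW.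
rewrite hE; have -> : kappa^-1 * (C1 * (t * kappa ^+ 2)) = (kappa * kappa^-1) * (kappa * (C1 * t)) by ring.
by rewrite divff ?gt_eqF// mul1r.
Qed.

(** |W p - p| = p |W - 1| with p <= W, and W |W - 1| <= |W - 1| + (W - 1)^2. *)
Lemma euler_chain_mass_weight i a : i%:R * h <= t ->
  `|mean P (fun w => W i w * p i a w) - mean P (p i a)| <= (1 + 2 * C1 * t) * kappa.
Proof.
move=> it; have [_ _ v] := euler_chain_mass_bounds it; have dev := euler_chain_mass_dev it.
have nV : nice_wrt P (F (i%:R * h)) (fun w => W i w - 1) by apply: niceB => //; exact: nice_cst.
have L1V := nice_L1 (niceX 2 nV).
rewrite -meanB; [|exact: nice_L1 (niceM (nW i) (np i a))|exact: nice_L1 (np i a)].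
apply: le_trans (mean_norm _) _.
  exact: nice_L1 (niceB (niceM (nW i) (np i a)) (np i a)).
apply: (@le_trans _ _ (mean P (fun w => `|W i w - 1| + (W i w - 1) ^+ 2))).
  apply: mean_le.
  - exact: L1_norm (nice_L1 (niceB (niceM (nW i) (np i a)) (np i a))).
  - by apply: L1D => //; exact: L1_norm (nice_L1 nV).
  move=> w; have -> : W i w * p i a w - p i a w = p i a w * (W i w - 1) by ring.
  rewrite normrM (ger0_norm (sqmod_ge0 _)).
  apply: (@le_trans _ _ (W i w * `|W i w - 1|)); first by apply: ler_wpM2r => //; exact: pW.
  rewrite -(real_normK (num_real (W i w - 1))).
  have := ler_norm (W i w - 1); have := normr_ge0 (W i w - 1).
  rewrite /=; move: (\sum_a0 _) => y; move: `|y - 1| => u u0 yu.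
  have := mulr_ge0 u0 (_ : 0 <= u - (y - 1)); rewrite subr_ge0 => /(_ yu).
  have -> : u * (u - (y - 1)) = (u + u ^+ 2) - y * u by ring.
  by rewrite subr_ge0.
rewrite meanD//; last exact: L1_norm (nice_L1 nV).
have hk : C1 * h <= kappa * (C1 * t).
  have -> : kappa * (C1 * t) = C1 * (t * kappa) by ring.
  rewrite [X in _ * X <= _]hE; apply: ler_wpM2l; first exact: C10.
  by apply: ler_wpM2l => //; rewrite expr2 ler_piMr// ltW.
have -> : (1 + 2 * C1 * t) * kappa = kappa * (1 + C1 * t) + kappa * (C1 * t) by ring.
by apply: lerD => //; exact: le_trans hk.
Qed.

Hypothesis h4 : 4 * h <= 1.
Local Notation N := (m%:R : R).
Local Notation B := (1 + C1).
Let B0 : 0 <= B. Proof. by rewrite addr_ge0. Qed.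
Let N1 : 1 <= N. Proof. by rewrite ler1n. Qed.
Let kp01 : 0 <= kappa <= 1. Proof. by rewrite (ltW kp0). Qed.
Let meanW_B i : i%:R * h <= t -> mean P (W i) <= B /\ mean P (fun w => W i w ^+ 2) <= B.
Proof.
move=> it; have [/andP[_ a1] a2 _] := euler_chain_mass_bounds it.
have c : C1 * h <= C1 by rewrite ler_piMr//; case/andP: h01.
split; lra.
Qed.

Let mean_p i a : i%:R * h <= t -> 0 <= mean P (p i a) <= B.
Proof.
move=> it; rewrite mean_ge0/=; last by move=> w; exact: sqmod_ge0.
apply: le_trans (meanW_B it).1; apply: mean_le (pW i a).
  exact: nice_L1 (np i a).
exact: nice_L1 (nW i).
Qed.

Let mean_pp i a b : i%:R * h <= t -> 0 <= mean P (fun w => p i a w * p i b w) <= B.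
Proof.
move=> it; rewrite mean_ge0/=; last by move=> w; apply: mulr_ge0; exact: sqmod_ge0.
apply: le_trans (meanW_B it).2; apply: mean_le.
- exact: nice_L1 (niceM (np i a) (np i b)).
- exact: nice_L1 (niceX 2 (nW i)).
by move=> w; rewrite expr2; apply: ler_pM; rewrite ?sqmod_ge0 ?pW.
Qed.

Let beta_step i a : i%:R * h <= t ->
  `|(mean P (p i.+1 a) - N^-1) - (1 - h) * (mean P (p i a) - N^-1)| <=
   h * (kappa * (t * (B + C1))).
Proof.
move=> it; have [a1 _ _] := euler_chain_mass_bounds it.
apply: (mass_recursion_error N1 h0 kp01 t0 hE C10 (mean_p a it) a1).
have := euler_step_p hH hF adH indH m0 (ti0 i) (tiS i) (euler_chain_nice i) a.
by rewrite stepE.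
Qed.

Local Notation lambda := (2 + 2 / N).
Local Notation E := ((2 + 3 * (N ^+ 2 * K) * t) * B).
Local Notation D := (1 + 2 * C1 * t).
Local Notation gamma i j k := (mean P (fun w => p i j w * p i k w) -
  (N + 2)^-1 * (mean P (p i j) + mean P (p i k) - 2 / N) - (N * (N + 1))^-1).

Let gamma_step i j k : j != k -> i%:R * h <= t ->
  `|gamma i.+1 j k - (1 - lambda * h) * gamma i j k| <=
  h * (kappa * (E + 2 * D + 6 * t * B)) + 2 * (h * (kappa * (t * (B + C1)))).
Proof.
move=> jk it; have [a1 _ _] := euler_chain_mass_bounds it.
have NK : 0 <= N ^+ 2 * K by rewrite mulr_ge0// sqr_ge0.
have E0 : 0 <= E.
  by apply: mulr_ge0 => //; rewrite addr_ge0// mulr_ge0// mulr_ge0.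
have D0 : 0 <= D by rewrite addr_ge0// !mulr_ge0// expR_ge0.
apply: (gamma_recursion_error N1); try exact: beta_step.
apply: (pair_recursion_error N1 h0 h4 kp01 t0 hE (mean_pp _ _ it) (mean_p _ it) (mean_p _ it)).
- exact: euler_chain_mass_weight.
- exact: euler_chain_mass_weight.
have := euler_step_pp hH hF adH indH m0 hK (ti0 i) (tiS i) (step1 i) (euler_chain_nice i) jk kp0.
rewrite stepE => /le_trans; apply.
(* Since h^2 / kappa = h t kappa and h^2 <= h t kappa, the remainder of [euler_step_pp] is at most h
   kappa (2 + 3 N^2 K t) times the second moment of the mass; this is the origin of [E]. *)
have -> : h * (kappa * E) = h * kappa * (2 + 3 * (N ^+ 2 * K) * t) * B by ring.
apply: ler_pM; [| |  |exact: (meanW_B it).2].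
- have kk : 0 <= kappa by exact: ltW.
  by rewrite addr_ge0 ?mulr_ge0 ?addr_ge0 ?mulr_ge0 ?invr_ge0 ?sqr_ge0.
- by apply: mean_ge0 => w; exact: sqr_ge0.
have e1 : h ^+ 2 / kappa = h * (t * kappa).
  by rewrite hE; field; rewrite gt_eqF.
have e2 : h ^+ 2 <= h * (t * kappa).
  rewrite expr2; apply: ler_wpM2l => //; rewrite hE; apply: ler_wpM2l => //.
  by rewrite expr2 ler_piMr// ltW.
rewrite -[_ * h ^+ 2 / kappa]mulrA e1.
have := ler_wpM2l NK e2; move: (N ^+ 2 * K) => c ce.
have -> : h * kappa * (2 + 3 * c * t) = 2 * (kappa * h + c * (h * (t * kappa))) + c * (h * (t * kappa)) by ring.
lra.
Qed.

Variable L : nat.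
Hypothesis hL : L%:R * h = t.
Let iL i : (i < L)%N -> i%:R * h <= t.
Proof. by move=> il; rewrite -hL; apply: ler_wpM2r => //; rewrite ler_nat ltnW. Qed.
Let hk : h <= t * kappa.
Proof. by rewrite hE; apply: ler_wpM2l => //; rewrite expr2 ler_piMr// ltW. Qed.

Lemma euler_chain_p a :
  `|mean P (p L a) - N^-1 - expR (- t) * (sqmod (x0 a) - N^-1)| <=
  kappa * (t * (t * (B + C1)) + t * (t * (B + 1))).
Proof.
have NI : 0 < N^-1 <= 1 by rewrite invr_gt0 invf_le1 ?N1 ?ltr0n ?m0.
have lh : 0 <= 1 * h <= 1 by rewrite mul1r.
have r0 : 0 <= h * (kappa * (t * (B + C1))).
  by rewrite mulr_ge0// mulr_ge0 ?(ltW kp0)// mulr_ge0// addr_ge0.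
have B1 : 0 <= B + 1 by rewrite addr_ge0.
have := @perturbed_decay R (fun i => mean P (p i a) - N^-1) 1 h _ (B + 1) L lh r0 B1.
rewrite /= mean_cst !mul1r [h * L%:R]mulrC hL.
move=> pd; apply: le_trans (pd _ _) _ => [i il|i il|].
- have /andP[b0 b1] := mean_p a (iL il); have /andP[n0 n1] := NI.
  by apply: le_trans (ler_normB _ _) _; rewrite (ger0_norm b0) (ger0_norm (ltW n0)); exact: lerD.
- by apply: beta_step; exact: iL.
rewrite mulrDr.
have -> : L%:R * (h * (kappa * (t * (B + C1)))) = (L%:R * h) * (kappa * (t * (B + C1))) by ring.
have -> : L%:R * (h ^+ 2 * (B + 1)) = (L%:R * h) * h * (B + 1) by ring.
rewrite hL.
have -> : kappa * (t * (t * (B + C1)) + t * (t * (B + 1))) =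
  t * (kappa * (t * (B + C1))) + t * (t * kappa) * (B + 1) by ring.
by rewrite lerD2l; apply: ler_wpM2r => //; exact: ler_wpM2l.
Qed.

Lemma euler_chain_pp j k : j != k ->
  `|gamma L j k - expR (- (t * lambda)) *
     (sqmod (x0 j) * sqmod (x0 k) - (N + 2)^-1 * (sqmod (x0 j) + sqmod (x0 k) - 2 / N) -
      (N * (N + 1))^-1)| <=
  kappa * (t * (E + 2 * D + 6 * t * B + 2 * (t * (B + C1))) + 16 * (t * (t * (3 * B + 3)))).
Proof.
move=> jk.
have [h0' h4'] := (h0, h4).
have Np : 0 < N by rewrite ltr0n.
have NI : 0 < N^-1 <= 1 by rewrite invr_gt0 invf_le1 ?N1 ?Np.
have /andP[n0 n1] := NI.
have l0 : 0 <= lambda <= 4 by apply/andP; split; lra.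
have lh : 0 <= lambda * h <= 1.
  have /andP[l1 l2] := l0; rewrite mulr_ge0//=; apply: le_trans h4'.
  exact: ler_wpM2r.
have NK : 0 <= N ^+ 2 * K by rewrite mulr_ge0// sqr_ge0.
have E0 : 0 <= E.
  by apply: mulr_ge0 => //; rewrite addr_ge0// mulr_ge0// mulr_ge0.
have D0 : 0 <= D by rewrite addr_ge0// !mulr_ge0// expR_ge0.
have kk : 0 <= kappa by exact: ltW.
have r0 : 0 <= h * (kappa * (E + 2 * D + 6 * t * B)) + 2 * (h * (kappa * (t * (B + C1)))).
  apply: addr_ge0; first (apply: mulr_ge0 => //; apply: mulr_ge0 => //;
    by apply: addr_ge0; [apply: addr_ge0 => //; exact: mulr_ge0|apply: mulr_ge0 => //; exact: mulr_ge0]).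
  by rewrite !mulr_ge0 ?addr_ge0.
(* The combination is bounded by B + (2 B + 2) + 1. The 16 in the conclusion bounds lambda^2. *)
have B3 : 0 <= 3 * B + 3 by rewrite addr_ge0// mulr_ge0.
have := @perturbed_decay R (fun i => gamma i j k) lambda h _ (3 * B + 3) L lh r0 B3.
rewrite /= !mean_cst -[lambda * h * L%:R]mulrA [h * L%:R]mulrC hL [lambda * t]mulrC.
move=> pd; apply: le_trans (pd _ _) _ => [i il|i il|].
- have /andP[a0 a1] := mean_pp j k (iL il).
  have /andP[b0 b1] := mean_p j (iL il); have /andP[c0 c1] := mean_p k (iL il).
  have i2 : 0 <= (N + 2)^-1 <= 1 by rewrite invr_ge0 invf_le1; have := N1; lra.
  have i3 : 0 <= (N * (N + 1))^-1 <= 1.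
    by rewrite invr_ge0 invf_le1 ?mulr_ge0 ?mulr_gt0 ?addr_gt0//= ?addr_ge0// mulr_ege1// lerDr ltW.
  move: a0 a1 b0 b1 c0 c1.
  set u1 := mean P (fun w => _ * _); set u2 := mean P (p i j); set u3 := mean P (p i k).
  move: u1 u2 u3 => u1 u2 u3 a0 a1 b0 b1 c0 c1.
  have s1 : `|(N + 2)^-1 * (u2 + u3 - 2 / N)| <= 2 * B + 2.
    rewrite normrM ger0_norm; last by case/andP: i2.
    apply: (@le_trans _ _ `|u2 + u3 - 2 / N|); first by apply: ler_piMl => //; case/andP: i2.
    by rewrite ler_norml; apply/andP; split; lra.
  apply: le_trans (ler_normB _ _) _; rewrite [X in _ + X <= _]ger0_norm; last by case/andP: i3.
  have := ler_normB u1 ((N + 2)^-1 * (u2 + u3 - 2 / N)); rewrite (ger0_norm a0).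
  case/andP: i3 => _ i3; move: s1; move: `|_| `|_| => y1 y2; lra.
- by apply: gamma_step => //; exact: iL.
rewrite mulrDr.
have -> : L%:R * (h * (kappa * (E + 2 * D + 6 * t * B)) + 2 * (h * (kappa * (t * (B + C1))))) =
  (L%:R * h) * (kappa * (E + 2 * D + 6 * t * B + 2 * (t * (B + C1)))) by ring.
have -> : L%:R * ((lambda * h) ^+ 2 * (3 * B + 3)) = lambda ^+ 2 * ((L%:R * h) * h * (3 * B + 3)) by ring.
rewrite hL.
have -> : kappa * (t * (E + 2 * D + 6 * t * B + 2 * (t * (B + C1))) + 16 * (t * (t * (3 * B + 3)))) =
  t * (kappa * (E + 2 * D + 6 * t * B + 2 * (t * (B + C1)))) +
  16 * (t * (t * kappa) * (3 * B + 3)) by ring.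
rewrite lerD2l; apply: ler_pM.
- exact: sqr_ge0.
- by rewrite mulr_ge0// mulr_ge0.
- have -> : 16 = 4 ^+ 2 :> R by ring.
  by case/andP: l0 => l1 l2; rewrite lerXn2r// nnegrE.
by apply: ler_wpM2r => //; exact: ler_wpM2l.
Qed.

End fixed_step.
End euler_chain_moments.

(** * The matrix Ito inequality *)

Section measurable_matrices.
Context (d : measure_display) (T : measurableType d) (R : realType).

Definition cmeasurable (Z : T -> R[i]) :=
  measurable_fun setT (fun w => Re (Z w)) /\ measurable_fun setT (fun w => Im (Z w)).

Lemma cmeasurable_cst c : cmeasurable (fun=> c).
Proof. by split; exact: measurable_cst. Qed.

Lemma cmeasurableD Y Z : cmeasurable Y -> cmeasurable Z -> cmeasurable (fun w => Y w + Z w).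
Proof.
move=> [? ?] [? ?]; split.
  by under eq_fun do rewrite ReD; exact: measurable_funD.
by under eq_fun do rewrite ImD; exact: measurable_funD.
Qed.

Lemma cmeasurableM Y Z : cmeasurable Y -> cmeasurable Z -> cmeasurable (fun w => Y w * Z w).
Proof.
move=> [? ?] [? ?]; split.
  by under eq_fun do rewrite Re_mul; apply: measurable_funB; exact: measurable_funM.
by under eq_fun do rewrite Im_mul; apply: measurable_funD; exact: measurable_funM.
Qed.

Lemma cmeasurable_sum I (s : seq I) (Z : I -> T -> R[i]) :
  (forall i, cmeasurable (Z i)) -> cmeasurable (fun w => \sum_(i <- s) Z i w).
Proof.
move=> h; elim: s => [|i s ih].
  by under eq_fun do rewrite big_nil; exact: cmeasurable_cst.
by under eq_fun do rewrite big_cons; exact: cmeasurableD.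
Qed.

Variable m : nat.
Local Notation M := 'M[R[i]]_m.
Implicit Types X Y : T -> M.

Definition mx_measurable X := forall a b, cmeasurable (fun w => X w a b).

Lemma mx_measurableD X Y : mx_measurable X -> mx_measurable Y -> mx_measurable (fun w => X w + Y w).
Proof. by move=> h1 h2 a b; under eq_fun do rewrite mxE; exact: cmeasurableD. Qed.

Lemma mx_measurableZ Z X : cmeasurable Z -> mx_measurable X -> mx_measurable (fun w => Z w *: X w).
Proof. by move=> h1 h2 a b; under eq_fun do rewrite mxE; exact: cmeasurableM. Qed.

Lemma mx_measurableB X Y : mx_measurable X -> mx_measurable Y -> mx_measurable (fun w => X w - Y w).
Proof.
move=> hX hY; under eq_fun do rewrite -[X in _ + X]scaleN1r.
by apply: mx_measurableD => //; apply: mx_measurableZ => //; exact: cmeasurable_cst.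
Qed.

Lemma mx_measurableM X Y : mx_measurable X -> mx_measurable Y -> mx_measurable (fun w => X w *m Y w).
Proof.
move=> hX hY a b; under eq_fun do rewrite mxE.
by apply: cmeasurable_sum => c; exact: cmeasurableM.
Qed.

Lemma mx_measurable_sum I (s : seq I) (X : I -> T -> M) :
  (forall i, mx_measurable (X i)) -> mx_measurable (fun w => \sum_(i <- s) X i w).
Proof.
move=> h a b; under eq_fun do rewrite summxE.
by apply: cmeasurable_sum => i; exact: h.
Qed.

Lemma measurable_sqmod Z : cmeasurable Z -> measurable_fun setT (fun w => sqmod (Z w)).
Proof.
by move=> [? ?]; under eq_fun do rewrite sqmodE; apply: measurable_funD; exact: measurable_funX.
Qed.

Lemma measurable_frob2 X : mx_measurable X -> measurable_fun setT (fun w => frob2 (X w)).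
Proof.
move=> h; rewrite /frob2; apply: measurable_sum => a; apply: measurable_sum => b.
exact: measurable_sqmod.
Qed.

Lemma measurable_EFin_frob2 X : mx_measurable X ->
  measurable_fun setT (fun w => (frob2 (X w))%:E).
Proof. by move=> h; apply/measurable_EFinP; exact: measurable_frob2. Qed.

Lemma mx_measurable_wrt G X : <<s G >> `<=` measurable -> entries_wrt G X -> mx_measurable X.
Proof. by move=> sG h a b; have [h1 h2] := h a b; split; exact: mfun_wrt_sub sG _. Qed.

End measurable_matrices.

Section ito_inequality.
Context (d : measure_display) (T : measurableType d) (R : realType)
        (P : probability T R) (m : nat) (F : R -> set (set T)) (H : R -> T -> 'M[R[i]]_m).
Hypotheses (hH : hermitian_brownian_motion P H) (hF : filtration F)
  (adH : adapted F H) (indH : independent_increments P F H) (m0 : (0 < m)%N).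
Local Notation M := 'M[R[i]]_m.
Local Notation mu := (@lebesgue_measure R).

Lemma L2_entries (X : T -> M) : mx_measurable X -> (\int[P]_w (frob2 (X w))%:E < +oo)%E ->
  forall a b, L2 P (fun w => Re (X w a b)) /\ L2 P (fun w => Im (X w a b)).
Proof.
move=> mX iX a b; have [mR mI] := mX a b.
have L1X : L1 P (fun w => frob2 (X w)).
  by apply: L1_ge0 => //; [exact: measurable_frob2|move=> w; exact: frob2_ge0].
have le w : sqmod (X w a b) <= frob2 (X w) by exact: sqmod_le_frob2.
split; split => //.
  apply: L1_le L1X; first exact: measurable_funX.
  move=> w; rewrite ger0_norm ?sqr_ge0//; apply: le_trans (le w).
  by rewrite sqmodE lerDl sqr_ge0.
apply: L1_le L1X; first exact: measurable_funX.
move=> w; rewrite ger0_norm ?sqr_ge0//; apply: le_trans (le w).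
by rewrite sqmodE lerDr sqr_ge0.
Qed.

Section pieces.
Variables (I : finType) (a b : I -> R) (r : R).
Hypotheses (a0 : forall i, 0 <= a i) (ab : forall i, a i <= b i) (br : forall i, b i <= r).

(** The Ito isometry, weakened to an inequality because the rate is at most 1. *)
Lemma brownian_ito_le c B (X : I -> T -> R) : 0 <= c <= 1 -> brownian_motion P F c B ->
  (forall i, mfun_wrt (F (a i)) (X i)) -> (forall i, L2 P (X i)) ->
  L1 P (fun w => (\sum_i (B (b i) w - B (a i) w) * X i w) ^+ 2) /\
  (\int[P]_w ((\sum_i (B (b i) w - B (a i) w) * X i w) ^+ 2)%:E <=
   \int[P]_w \int[mu]_(s in `[0%R, r])
     ((\sum_i on_interval (a i) (b i) s * X i w) ^+ 2)%:E)%E.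
Proof.
move=> /andP[c0 c1] hB mX hX.
have hL : L1 P (fun w => (\sum_i (B (b i) w - B (a i) w) * X i w) ^+ 2).
  have : L2 P (fun w => \sum_i (B (b i) w - B (a i) w) * X i w) by
    apply: L2_sum => i _; exact: (brownian_piece_L2 hF hB).
  by case.
split => //; rewrite mean_EFin// (brownian_isometry hF hB)//.
under eq_integral do rewrite integral_step_square//.
rewrite mean_EFin; last first.
  by apply: L1_sum => i _; apply: L1_sum => j _; apply: L1Z; exact: L2M.
rewrite lee_fin; apply: ler_piMl => //; apply: mean_ge0 => w.
rewrite -lee_fin -(integral_step_square (fun i => X i w) a0 br).
by apply: integral_ge0 => s _; rewrite lee_fin sqr_ge0.
Qed.

Lemma Re_step (X : I -> M) s c q :
  Re ((\sum_(i | a i <= s < b i) X i) c q) = \sum_i on_interval (a i) (b i) s * Re (X i c q).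
Proof.
rewrite summxE Re_sum big_mkcond; apply: eq_bigr => i _; rewrite /on_interval.
by case: ifP; rewrite ?mul1r ?mul0r.
Qed.

Lemma Im_step (X : I -> M) s c q :
  Im ((\sum_(i | a i <= s < b i) X i) c q) = \sum_i on_interval (a i) (b i) s * Im (X i c q).
Proof.
rewrite summxE Im_sum big_mkcond; apply: eq_bigr => i _; rewrite /on_interval.
by case: ifP; rewrite ?mul1r ?mul0r.
Qed.

Let ovl (x : I -> R) := \sum_i \sum_j overlap (a i) (b i) (a j) (b j) * (x i * x j).

Let measurable_step_sum (x : I -> R) : measurable_fun (`[0, r]%classic : set (measurableTypeR R))
  (fun s => ((\sum_i on_interval (a i) (b i) s * x i) ^+ 2)%:E).
Proof.
apply/measurable_EFinP/measurable_funTS/measurable_funX/measurable_sum => i.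
by apply: measurable_funM => //; exact: measurable_on_interval.
Qed.

Lemma integral_step_frob (X : I -> M) :
  (\int[mu]_(s in `[0%R, r]) (frob2 (\sum_(i | (a i <= s < b i)%R) X i))%:E =
   (\sum_c \sum_q (ovl (fun i => Re (X i c q)) + ovl (fun i => Im (X i c q))))%:E)%E.
Proof.
have mI : measurable (`[0, r]%classic : set (measurableTypeR R)) by exact: measurable_itv.
under eq_integral => s _.
  rewrite frob2_real -sumEFin; under eq_bigr => c _.
    rewrite -sumEFin; under eq_bigr => q _ do rewrite Re_step Im_step EFinD.
    over.
  over.
have sq0 (x : I -> R) s : (0 <= ((\sum_i on_interval (a i) (b i) s * x i) ^+ 2)%:E)%E.
  by rewrite lee_fin sqr_ge0.
rewrite ge0_integral_sum//; first last.
- by move=> c s _; apply: sume_ge0 => q _; exact: adde_ge0.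
- by move=> c; apply: emeasurable_sum => q; exact: emeasurable_funD.
rewrite -sumEFin; apply: eq_bigr => c _.
rewrite ge0_integral_sum//; first last.
- by move=> q s _; exact: adde_ge0.
- by move=> q; exact: emeasurable_funD.
rewrite -sumEFin; apply: eq_bigr => q _.
by rewrite ge0_integralD//= !integral_step_square.
Qed.

(** An entry (p, q) of the integral is a sum over c of four scalar integrals against the real and
    imaginary parts of an entry of H, each of mean square at most the total energy. Cauchy-Schwarz
    costs 2 m and there are m^3 triples (p, q, c): 2 m * m^3 * 4 = 8 m^4. *)
Lemma ito_le (X : I -> T -> M) :
  (forall i, entries_wrt (F (a i)) (X i)) ->
  (forall i, (\int[P]_w (frob2 (X i w))%:E < +oo)%E) ->
  (\int[P]_w (frob2 (\sum_i (H (b i) w - H (a i) w) *m X i w))%:E <=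
   (8 * m%:R ^+ 4)%:E * \int[P]_w \int[mu]_(s in `[0%R, r])
     (frob2 (\sum_(i | (a i <= s < b i)%R) X i w))%:E)%E.
Proof.
move=> aX iX.
have mX i : mx_measurable (X i).
  by apply: (mx_measurable_wrt _ (aX i)); exact: filtration_sigma_sub.
have L2X i c q := L2_entries (mX i) (iX i) c q.
have L2R c q i : L2 P (fun w => Re (X i w c q)) by case: (L2X i c q).
have L2I c q i : L2 P (fun w => Im (X i w c q)) by case: (L2X i c q).
have wR c q i : mfun_wrt (F (a i)) (fun w => Re (X i w c q)) by case: (aX i c q).
have wI c q i : mfun_wrt (F (a i)) (fun w => Im (X i w c q)) by case: (aX i c q).
under [X in (_ <= _ * X)%E]eq_integral do rewrite integral_step_frob.
have L1o (x : I -> T -> R) : (forall i, L2 P (x i)) -> L1 P (fun w => ovl (fun i => x i w)).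
  by move=> hx; apply: L1_sum => i _; apply: L1_sum => j _; apply: L1Z; exact: L2M.
have o0 (x : I -> R) : 0 <= ovl x.
  rewrite -lee_fin -(integral_step_square x a0 br).
  by apply: integral_ge0 => s _; rewrite lee_fin sqr_ge0.
set G := fun w => \sum_c \sum_q (ovl (fun i => Re (X i w c q)) + ovl (fun i => Im (X i w c q))).
have L1G : L1 P G.
  by apply: L1_sum => c _; apply: L1_sum => q _; apply: L1D; apply: L1o.
have GR c q w : ovl (fun i => Re (X i w c q)) <= G w.
  rewrite /G (bigD1 c)//= (bigD1 q)//= -!addrA lerDl !addr_ge0//.
    by apply: sumr_ge0 => *; exact: addr_ge0.
  by apply: sumr_ge0 => ? _; apply: sumr_ge0 => *; exact: addr_ge0.
have GI c q w : ovl (fun i => Im (X i w c q)) <= G w.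
  rewrite /G (bigD1 c)//= (bigD1 q)//= [X in (X + _) + _]addrC -!addrA lerDl !addr_ge0//.
    by apply: sumr_ge0 => *; exact: addr_ge0.
  by apply: sumr_ge0 => ? _; apply: sumr_ge0 => *; exact: addr_ge0.
rewrite (mean_EFin L1G).
have term c B (x : I -> T -> R) : 0 <= c <= 1 -> brownian_motion P F c B ->
  (forall i, mfun_wrt (F (a i)) (x i)) -> (forall i, L2 P (x i)) ->
  (forall w, ovl (fun i => x i w) <= G w) ->
  L1 P (fun w => (\sum_i (B (b i) w - B (a i) w) * x i w) ^+ 2) /\
  mean P (fun w => (\sum_i (B (b i) w - B (a i) w) * x i w) ^+ 2) <= mean P G.
  move=> c01 hB mx hx xG; have [h1 h2] := brownian_ito_le c01 hB mx hx; split => //.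
  rewrite -lee_fin -mean_EFin//; apply: (le_trans h2).
  under eq_integral do rewrite integral_step_square//.
  by rewrite mean_EFin ?lee_fin; [apply: mean_le => //; exact: L1o|exact: L1o].
pose sq (h x : I -> R) := (\sum_i h i * x i) ^+ 2.
pose hr p c w i := Re (H (b i) w p c) - Re (H (a i) w p c).
pose hi p c w i := Im (H (b i) w p c) - Im (H (a i) w p c).
pose xr c q w i := Re (X i w c q).
pose xi c q w i := Im (X i w c q).
pose S p c q w := sq (hr p c w) (xr c q w) + sq (hi p c w) (xi c q w) +
  (sq (hr p c w) (xi c q w) + sq (hi p c w) (xr c q w)).
have hS p c q : L1 P (S p c q) /\ mean P (S p c q) <= 4 * mean P G.
  have [cr c01r hr'] := entry_Re_brownian hH hF adH indH m0 p c.
  have [ci c01i hi'] := entry_Im_brownian hH hF adH indH m0 p c.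
  have [a1 b1] := term _ _ _ c01r hr' (wR c q) (L2R c q) (GR c q).
  have [a2 b2] := term _ _ _ c01i hi' (wI c q) (L2I c q) (GI c q).
  have [a3 b3] := term _ _ _ c01r hr' (wI c q) (L2I c q) (GI c q).
  have [a4 b4] := term _ _ _ c01i hi' (wR c q) (L2R c q) (GR c q).
  split; first by apply: L1D; apply: L1D.
  rewrite meanD; [|exact: L1D|exact: L1D]; rewrite !meanD//.
  have -> : 4 * mean P G = (mean P G + mean P G) + (mean P G + mean P G) by ring.
  exact: (lerD (lerD b1 b2) (lerD b3 b4)).
have dom w : frob2 (\sum_i (H (b i) w - H (a i) w) *m X i w) <=
    2 * m%:R * \sum_p \sum_q \sum_c S p c q w.
  rewrite frob2_real mulr_sumr; apply: ler_sum => p _; rewrite mulr_sumr; apply: ler_sum => q _.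
  have eR : Re ((\sum_i (H (b i) w - H (a i) w) *m X i w) p q) =
    \sum_c (\sum_i hr p c w i * xr c q w i - \sum_i hi p c w i * xi c q w i).
    rewrite summxE Re_sum; under eq_bigr do rewrite mxE Re_sum.
    rewrite exchange_big; apply: eq_bigr => c _; rewrite -sumrB; apply: eq_bigr => i _.
    by rewrite Re_mul !mxE ReB ImB.
  have eI : Im ((\sum_i (H (b i) w - H (a i) w) *m X i w) p q) =
    \sum_c (\sum_i hr p c w i * xi c q w i + \sum_i hi p c w i * xr c q w i).
    rewrite summxE Im_sum; under eq_bigr do rewrite mxE Im_sum.
    rewrite exchange_big; apply: eq_bigr => c _; rewrite -big_split; apply: eq_bigr => i _.
    by rewrite Im_mul !mxE ReB ImB.
  rewrite eR eI.
  apply: (le_trans (lerD (sqr_sum_le _) (sqr_sum_le _))).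
  rewrite card_ord -mulrDr -big_split /= [2 * _]mulrC -mulrA; apply: ler_wpM2l => //.
  rewrite mulr_sumr; apply: ler_sum => c _.
  rewrite /S /sq; move: (\sum_i hr _ _ _ _ * xr _ _ _ _) (\sum_i hi _ _ _ _ * xi _ _ _ _)
     (\sum_i hr _ _ _ _ * xi _ _ _ _) (\sum_i hi _ _ _ _ * xr _ _ _ _) => u1 u2 u3 u4.
  have := sqr_ge0 (u1 + u2); have := sqr_ge0 (u3 - u4); nra.
have L1S : L1 P (fun w => \sum_p \sum_q \sum_c S p c q w).
  apply: L1_sum => p _; apply: L1_sum => q _; apply: L1_sum => c _; exact: (hS p c q).1.
apply: (@le_trans _ _ (\int[P]_w (2 * m%:R * \sum_p \sum_q \sum_c S p c q w)%:E)%E).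
  apply: ge0_le_integral => //.
  - by move=> w _; rewrite lee_fin frob2_ge0.
  - apply: measurable_EFin_frob2; apply: mx_measurable_sum => i.
    apply: mx_measurableM => //; apply: (mx_measurable_wrt _ (increment_entries hF adH (a0 i) (ab i))).
    by apply: filtration_sigma_sub => //; exact: le_trans (ab i).
  - by have /measurable_int := L1Z (2 * m%:R) L1S.
  by move=> w _; rewrite lee_fin.
rewrite mean_EFin; last exact: L1Z.
rewrite -EFinM lee_fin meanZ// mean_sum; last first.
  move=> p _; apply: L1_sum => q _; apply: L1_sum => c _; exact: (hS p c q).1.
have -> : 8 * m%:R ^+ 4 * mean P G = 2 * m%:R * (m%:R * (m%:R * (m%:R * (4 * mean P G)))) by ring.
apply: ler_wpM2l; first exact: mulr_ge0.
have card y : \sum_(p < m) (y : R) = m%:R * y by rewrite sumr_const card_ord mulr_natl.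
rewrite -card; apply: ler_sum => p _; rewrite mean_sum; last first.
  move=> q _; apply: L1_sum => c _; exact: (hS p c q).1.
rewrite -card; apply: ler_sum => q _; rewrite mean_sum; last first.
  move=> c _; exact: (hS p c q).1.
by rewrite -card; apply: ler_sum => c _; exact: (hS p c q).2.
Qed.

End pieces.
End ito_inequality.

(** * Joint measurability and approximation of Ito integrals *)

Section joint_measurability.
Context (d : measure_display) (T : measurableType d) (R : realType) (P : probability T R) (m : nat).
Local Notation M := 'M[R[i]]_m.
Local Notation mu := (@lebesgue_measure R).
Implicit Types (X Y : R -> T -> M).

Definition jointly_measurable X :=
  mx_measurable (fun p : measurableTypeR R * T => X p.1 p.2).

Lemma jointly_measurableB X Y : jointly_measurable X -> jointly_measurable Y ->
  jointly_measurable (fun s w => X s w - Y s w).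
Proof. exact: mx_measurableB. Qed.

Definition frob_integral (r : R) X w : \bar R :=
  (\int[mu]_(s in `[0%R, r]) (frob2 (X s w))%:E)%E.

Definition frob_energy (r : R) X : \bar R := (\int[P]_w frob_integral r X w)%E.

Lemma jointly_measurable_pair1 X w : jointly_measurable X ->
  mx_measurable (fun s : measurableTypeR R => X s w).
Proof.
move=> mX a b; have [h1 h2] := mX a b; split.
  exact: (measurableT_comp h1 (measurable_pair2 w)).
exact: (measurableT_comp h2 (measurable_pair2 w)).
Qed.

Lemma jointly_measurable_pair2 X s : jointly_measurable X -> mx_measurable (X s).
Proof.
move=> mX a b; have [h1 h2] := mX a b; split.
  exact: (measurableT_comp h1 (measurable_pair1 (s : measurableTypeR R))).
exact: (measurableT_comp h2 (measurable_pair1 (s : measurableTypeR R))).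
Qed.

Lemma frob_integrand_measurable X r w : jointly_measurable X ->
  measurable_fun (`[0, r]%classic : set (measurableTypeR R)) (fun s => (frob2 (X s w))%:E).
Proof.
by move=> mX; apply: measurable_funTS; apply: measurable_EFin_frob2; exact: jointly_measurable_pair1.
Qed.

(** Restricting time by an indicator instead of by the domain puts the integrand on the whole
    product space, where Tonelli applies. *)
Let patched r X (p : measurableTypeR R * T) : \bar R :=
  ((frob2 (X p.1 p.2))%:E * (\1_(`[0, r]%classic) p.1)%:E)%E.

Let patched_measurable r X : jointly_measurable X -> measurable_fun setT (patched r X).
Proof.
move=> mX; apply: emeasurable_funM; first exact: measurable_EFin_frob2.
apply/measurable_EFinP; apply: (measurableT_comp _ measurable_fst).
exact: measurable_indic.
Qed.

Let patched_ge0 r X p : (0 <= patched r X p)%E.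
Proof. by rewrite /patched -EFinM lee_fin mulr_ge0// frob2_ge0. Qed.

Let frob_integralE r X w : frob_integral r X w = (\int[mu]_s patched r X (s, w))%E.
Proof. by rewrite /frob_integral integral_mkcond epatch_indic. Qed.

Lemma frob_integral_ge0 r X w : (0 <= frob_integral r X w)%E.
Proof. by apply: integral_ge0 => s _; rewrite lee_fin frob2_ge0. Qed.

Lemma measurable_frob_integral r X : jointly_measurable X ->
  measurable_fun setT (frob_integral r X).
Proof.
move=> mX; rewrite (_ : frob_integral r X = fubini_G mu (patched r X)).
  by apply: measurable_fun_fubini_tonelli_G => //; exact: patched_measurable.
by apply/funext => w; rewrite frob_integralE.
Qed.

Lemma frob_energy_ge0 r X : (0 <= frob_energy r X)%E.
Proof. by apply: integral_ge0 => w _; exact: frob_integral_ge0. Qed.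

Lemma frob_energy_swap r X : jointly_measurable X ->
  frob_energy r X = (\int[mu]_(s in `[0%R, r]) \int[P]_w (frob2 (X s w))%:E)%E.
Proof.
move=> mX; rewrite /frob_energy.
under eq_integral do rewrite frob_integralE.
rewrite -(fubini_tonelli (patched r X) (patched_measurable r mX) (@patched_ge0 r X)).
rewrite [RHS]integral_mkcond epatch_indic; apply: eq_integral => s _ /=.
rewrite /patched /= ge0_integralZr//.
  by apply: measurable_EFin_frob2; exact: jointly_measurable_pair2.
by move=> w _; rewrite lee_fin frob2_ge0.
Qed.

Lemma measurable_mean_frob X : jointly_measurable X ->
  measurable_fun setT (fun s : measurableTypeR R => \int[P]_w (frob2 (X s w))%:E)%E.
Proof.
move=> mX; pose f (p : measurableTypeR R * T) := (frob2 (X p.1 p.2))%:E.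
apply: (measurable_fun_fubini_tonelli_F (m2 := P) f); first exact: measurable_EFin_frob2.
by move=> p; rewrite lee_fin frob2_ge0.
Qed.

Lemma frob_energy_le r X Y Z : jointly_measurable X -> jointly_measurable Y ->
  jointly_measurable Z ->
  (forall s w, 0 <= s <= r -> frob2 (Z s w) <= 2 * (frob2 (X s w) + frob2 (Y s w))) ->
  (frob_energy r Z <= 2%:E * (frob_energy r X + frob_energy r Y))%E.
Proof.
move=> mX mY mZ le.
have f0 V w s : (0 <= (frob2 (V s w : M))%:E)%E by rewrite lee_fin frob2_ge0.
have mI V : jointly_measurable V -> measurable_fun setT (frob_integral r V).
  exact: measurable_frob_integral.
have i0 := frob_integral_ge0.
rewrite /frob_energy -ge0_integralD//; [|exact: mI|exact: mI].
rewrite -ge0_integralZl//; [|by apply: emeasurable_funD; exact: mI|by move=> w _; exact: adde_ge0].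
apply: ge0_le_integral => //; [exact: mI| |].
  by apply: measurable_funeM; apply: emeasurable_funD; exact: mI.
move=> w _; rewrite /frob_integral -ge0_integralD//;
  [|exact: frob_integrand_measurable|exact: frob_integrand_measurable].
have mS : measurable_fun (`[0, r]%classic : set (measurableTypeR R))
    (fun s => (frob2 (X s w))%:E + (frob2 (Y s w))%:E)%E.
  by apply: emeasurable_funD; exact: frob_integrand_measurable.
rewrite -ge0_integralZl//; [|by move=> s _; exact: adde_ge0].
apply: ge0_le_integral => //.
- exact: frob_integrand_measurable.
- exact: measurable_funeM.
by move=> s /=; rewrite in_itv/= => sr; rewrite -EFinD -EFinM lee_fin; exact: le.
Qed.

(** The endpoint r is a null set, and it has to be left out: an elementary process vanishes at its
    last knot. *)
Lemma eq_frob_energy r X Y : (forall s w, 0 <= s < r -> X s w = Y s w) ->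
  jointly_measurable X -> jointly_measurable Y ->
  frob_energy r X = frob_energy r Y.
Proof.
move=> e mX mY; apply: eq_integral => w _; rewrite /frob_integral.
have mo V : jointly_measurable V ->
    measurable_fun (`[0, r[%classic : set (measurableTypeR R)) (fun s => (frob2 (V s w))%:E).
  by move=> mV; apply: measurable_funTS; apply: measurable_EFin_frob2; exact: jointly_measurable_pair1.
rewrite -!integral_itv_bndo_bndc; [|exact: mo|exact: mo].
by apply: eq_integral => s; rewrite inE/= in_itv/= => sr; rewrite e.
Qed.

Lemma jointly_measurable_elementary (phi : elementary T R m) :
  (forall k, (k < pieces phi)%N -> mx_measurable (value phi k)) ->
  jointly_measurable (elementary_at phi).
Proof.
move=> mv; rewrite /jointly_measurable.
have -> : (fun p : measurableTypeR R * T => elementary_at phi p.1 p.2) =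
  (fun p => \sum_(k < pieces phi)
     Complex (on_interval (knot phi k) (knot phi k.+1) p.1) 0 *: value phi k p.2).
  apply/funext => p; rewrite /elementary_at big_mkcond; apply: eq_bigr => k _.
  by rewrite /on_interval; case: ifP => _; rewrite ?scale0r// scale1r.
apply: mx_measurable_sum => k; apply: mx_measurableZ.
  split => /=; last exact: measurable_cst.
  apply: (measurableT_comp _ measurable_fst); exact: measurable_on_interval.
move=> a b; have [h1 h2] := mv k (ltn_ord k) a b; split.
  exact: (measurableT_comp h1 measurable_snd).
exact: (measurableT_comp h2 measurable_snd).
Qed.

End joint_measurability.

Section ito_approximation.
Context (d : measure_display) (T : measurableType d) (R : realType)
        (P : probability T R) (m : nat) (F : R -> set (set T)) (H : R -> T -> 'M[R[i]]_m).
Hypotheses (hH : hermitian_brownian_motion P H) (hF : filtration F)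
  (adH : adapted F H) (indH : independent_increments P F H) (m0 : (0 < m)%N).
Local Notation mu := (@lebesgue_measure R).
Variable r : R.
Implicit Types phi psi : elementary T R m.

Lemma knot_le phi k l : elementary_process P F r phi -> (k <= l <= pieces phi)%N ->
  knot phi k <= knot phi l.
Proof.
move=> hp /andP[kl lp]; elim: l kl lp => [|l ih]; first by rewrite leqn0 => /eqP->.
rewrite leq_eqVlt => /orP[/eqP->//|kl] lp.
by apply: (le_trans (ih kl (ltnW lp))); exact: (elementary_mono hp).
Qed.

Lemma knot_bounds phi k : elementary_process P F r phi -> (k <= pieces phi)%N ->
  0 <= knot phi k <= r.
Proof.
move=> hp kp; rewrite -(elementary_start hp) -(elementary_end hp).
by rewrite !(knot_le hp)// ?leq0n ?kp ?leqnn.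
Qed.

Lemma value_entries phi k : elementary_process P F r phi -> (k < pieces phi)%N ->
  entries_wrt (F (knot phi k)) (value phi k).
Proof.
move=> hp kp; apply: entries_wrt_sub; rewrite filtration_sigmaE//; first exact: (elementary_adapted hp).
by case/andP: (knot_bounds hp (ltnW kp)).
Qed.

Lemma value_measurable phi k : elementary_process P F r phi -> (k < pieces phi)%N ->
  mx_measurable (value phi k).
Proof.
move=> hp kp; apply: mx_measurable_wrt (value_entries hp kp).
by apply: filtration_sigma_sub => //; case/andP: (knot_bounds hp (ltnW kp)).
Qed.

Lemma elementary_at_measurable phi : elementary_process P F r phi ->
  jointly_measurable (elementary_at phi).
Proof. by move=> hp; apply: jointly_measurable_elementary => k; exact: value_measurable. Qed.

Lemma elementary_integral_measurable phi : elementary_process P F r phi ->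
  mx_measurable (elementary_integral H phi).
Proof.
move=> hp; apply: mx_measurable_sum => k; apply: mx_measurableM; last exact: value_measurable.
have /andP[k0 k1] := knot_bounds hp (ltnW (ltn_ord k)).
have kk : knot phi k <= knot phi k.+1 by exact: (elementary_mono hp).
apply: (mx_measurable_wrt _ (increment_entries hF adH k0 kk)).
by apply: filtration_sigma_sub => //; exact: le_trans kk.
Qed.

Lemma elementary_integral_le phi psi : elementary_process P F r phi ->
  elementary_process P F r psi ->
  (\int[P]_w (frob2 (elementary_integral H phi w - elementary_integral H psi w))%:E <=
  (8 * m%:R ^+ 4)%:E * frob_energy P r (fun s w => (elementary_at phi s w - elementary_at psi s w)%R))%E.
Proof.
move=> hp hq.
(* The pieces of both processes, those of the second with opposite sign, form a single family with
   overlapping intervals. *)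
pose I := ('I_(pieces phi) + 'I_(pieces psi))%type.
pose a (i : I) := match i with inl k => knot phi k | inr k => knot psi k end.
pose b (i : I) := match i with inl k => knot phi k.+1 | inr k => knot psi k.+1 end.
pose X (i : I) w := match i with inl k => value phi k w | inr k => - value psi k w end.
have a0 i : 0 <= a i.
  by case: i => k; [have := knot_bounds hp (ltnW (ltn_ord k))|have := knot_bounds hq (ltnW (ltn_ord k))];
     case/andP.
have ab i : a i <= b i by case: i => k; [exact: (elementary_mono hp)|exact: (elementary_mono hq)].
have br i : b i <= r.
  by case: i => k; [have := knot_bounds hp (ltn_ord k)|have := knot_bounds hq (ltn_ord k)]; case/andP.
have aX i : entries_wrt (F (a i)) (X i).
  case: i => k; first exact: value_entries.
  move=> p q; have [h1 h2] := value_entries hq (ltn_ord k) p q; split.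
    by under eq_fun do rewrite /X mxE ReN; exact: mfun_wrtN.
  by under eq_fun do rewrite /X mxE ImN; exact: mfun_wrtN.
have iX i : (\int[P]_w (frob2 (X i w))%:E < +oo)%E.
  case: i => k; first exact: (elementary_L2 hp).
  by under eq_integral do rewrite frob2N; exact: (elementary_L2 hq).
have := ito_le hH hF adH indH m0 a0 ab br aX iX.
under eq_integral => w _.
  rewrite big_sumType /= [X in frob2 (_ + X)](_ : _ = - elementary_integral H psi w); last first.
    by rewrite -sumrN; apply: eq_bigr => k _; rewrite mulmxN.
  over.
move=> /le_trans; apply; rewrite le_eqVlt; apply/orP; left; apply/eqP; congr (_ * _)%E.
apply: eq_integral => w _; apply: eq_integral => s _; congr (frob2 _)%:E.
by rewrite big_sumType /=; congr (_ + _); rewrite -sumrN.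
Qed.

Lemma frob_energy_elementary phi : elementary_process P F r phi ->
  (frob_energy P r (elementary_at phi) < +oo)%E.
Proof.
move=> hp.
pose a (k : 'I_(pieces phi)) := knot phi k.
pose b (k : 'I_(pieces phi)) := knot phi k.+1.
have a0 i : 0 <= a i by have /andP[] := knot_bounds hp (ltnW (ltn_ord i)).
have br i : b i <= r by have /andP[] := knot_bounds hp (ltn_ord i).
rewrite /frob_energy.
under eq_integral => w _.
  rewrite /frob_integral (integral_step_frob a0 br (fun k => value phi k w)).
  over.
have L2v (k : 'I_(pieces phi)) c q :=
  L2_entries (value_measurable hp (ltn_ord k)) (elementary_L2 hp (ltn_ord k)) c q.
rewrite mean_EFin ?ltry//.
apply: L1_sum => c _; apply: L1_sum => q _; apply: L1D;
  apply: L1_sum => i _; apply: L1_sum => j _; apply: L1Z; apply: L2M.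
- exact: (L2v i c q).1.
- exact: (L2v j c q).1.
- exact: (L2v i c q).2.
- exact: (L2v j c q).2.
Qed.

Variables (U : R -> T -> 'M[R[i]]_m) (Y : T -> 'M[R[i]]_m).
Hypotheses (mU : jointly_measurable U) (hY : is_ito_integral P F H U r Y).

Lemma ito_integral_measurable : mx_measurable Y.
Proof.
have [sY _] := hY; apply: mx_measurable_wrt (@sigma_mx_entries _ _ _ _ Y).
by rewrite sigma_mx_idem.
Qed.

(** Elementary processes have finite energy; were that of [U] infinite, so would be the energy of
    every difference [U] - phi_n, which tends to 0. *)
Lemma ito_energy_finite : (frob_energy P r U < +oo)%E.
Proof.
have [_ [phi [hp cU _]]] := hY.
have g0 n : (0 <= frob_energy P r (fun s w => (U s w - elementary_at (phi n) s w)%R))%E.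
  exact: frob_energy_ge0.
rewrite ltey; apply/negP => /eqP Uoo.
suff : (+oo <= (0 : \bar R))%E by [].
apply: (cvge_to_ge cU); apply: nearW => n.
have mp := elementary_at_measurable (hp n).
have : (frob_energy P r U <= 2%:E *
    (frob_energy P r (fun s w => (U s w - elementary_at (phi n) s w)%R) +
     frob_energy P r (elementary_at (phi n))))%E.
  apply: frob_energy_le => //; first exact: jointly_measurableB.
  by move=> s w _; rewrite -[U s w in X in X <= _](subrK (elementary_at (phi n) s w)); exact: frob2D.
rewrite Uoo -/(frob_energy P r (fun s w => (U s w - elementary_at (phi n) s w)%R)).
have := frob_energy_elementary (hp n); have := frob_energy_ge0 P r (elementary_at (phi n)).
by move: (frob_energy P r (elementary_at _)) (frob_energy P r _) (g0 n) => [x| |] [y| |].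
Qed.

(** For two elementary processes this is the Ito inequality. Passing through phi_n and letting n
    tend to infinity costs 2 in the integral and 2 in the energy: 2 * 8 * 2 = 32. Any version [Y] of
    the integral satisfies the bound, so uniqueness does not enter. *)
Lemma ito_approx_le psi : elementary_process P F r psi ->
  (\int[P]_w (frob2 (Y w - elementary_integral H psi w))%:E <=
   (32 * m%:R ^+ 4)%:E * frob_energy P r (fun s w => (U s w - elementary_at psi s w)%R))%E.
Proof.
move=> hq; have [_ [phi [hp cU cY]]] := hY.
set D := frob_energy P r (fun s w => U s w - elementary_at psi s w).
have D0 : (0 <= D)%E by exact: frob_energy_ge0.
set C : R := 8 * m%:R ^+ 4.
have C0 : 0 < C by rewrite mulr_gt0// exprn_gt0// ltr0n.
set e := fun n => (\int[P]_w (frob2 (Y w - elementary_integral H (phi n) w))%:E)%E in cY.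
set g := fun n => frob_energy P r (fun s w => U s w - elementary_at (phi n) s w).
have g0 n : (0 <= g n)%E by exact: frob_energy_ge0.
have e0 n : (0 <= e n)%E by apply: integral_ge0 => w _; rewrite lee_fin frob2_ge0.
have {}cU : g n @[n --> \oo] --> 0%E by [].
have bound n : (\int[P]_w (frob2 (Y w - elementary_integral H psi w))%:E <=
   2%:E * (e n + C%:E * (2%:E * (g n + D))))%E.
  have mY := ito_integral_measurable.
  have mn := elementary_integral_measurable (hp n).
  have mq := elementary_integral_measurable hq.
  apply: (@le_trans _ _ (2%:E * (e n + \int[P]_w (frob2 (elementary_integral H (phi n) w -
      elementary_integral H psi w))%:E))%E).
    have m1 : measurable_fun setT (fun w => (frob2 (Y w - elementary_integral H (phi n) w))%:E).
      by apply: measurable_EFin_frob2; exact: mx_measurableB.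
    have m2 : measurable_fun setT (fun w => (frob2 (elementary_integral H (phi n) w -
      elementary_integral H psi w))%:E).
      by apply: measurable_EFin_frob2; exact: mx_measurableB.
    rewrite -ge0_integralD//; try by move=> w _; rewrite lee_fin frob2_ge0.
    rewrite -ge0_integralZl//; [|exact: emeasurable_funD|
      by move=> w _; apply: adde_ge0; rewrite lee_fin frob2_ge0].
    apply: ge0_le_integral => //.
    - by move=> w _; rewrite lee_fin frob2_ge0.
    - by apply: measurable_EFin_frob2; exact: mx_measurableB.
    - by apply: measurable_funeM; exact: emeasurable_funD.
    move=> w _; rewrite -EFinD -EFinM lee_fin.
    rewrite -[Y w - _](subrKA (elementary_integral H (phi n) w)); exact: frob2D.
  apply: lee_wpmul2l => //; apply: leeD2l; apply: (le_trans (elementary_integral_le (hp n) hq)).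
  apply: lee_wpmul2l; first by rewrite lee_fin ltW.
  apply: frob_energy_le => [|||s w _].
  - by apply: jointly_measurableB => //; exact: (elementary_at_measurable (hp n)).
  - by apply: jointly_measurableB => //; exact: (elementary_at_measurable hq).
  - by apply: jointly_measurableB; [exact: (elementary_at_measurable (hp n))|exact: (elementary_at_measurable hq)].
  rewrite (frob2_sub_sym (U s w)) -[elementary_at (phi n) s w - _](subrKA (U s w)).
  exact: frob2D.
have -> : (32 * m%:R ^+ 4)%:E = (2%:E * (C%:E * 2%:E))%E :> \bar R.
  by rewrite -!EFinM; congr (_%:E); rewrite /C; ring.
have [->|Dfin] := eqVneq D +oo%E.
  have c0 : (0 < 2%:E * (C%:E * 2%:E))%E by rewrite -!EFinM lte_fin mulr_gt0// mulr_gt0.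
  by rewrite gt0_muley// leey.
have Df : D \is a fin_num by rewrite ge0_fin_numE// lt_neqAle Dfin leey.
have -> : (2%:E * (C%:E * 2%:E) * D = 2%:E * (0 + C%:E * (2%:E * (0 + D))))%E.
  by rewrite !add0e !muleA.
apply: (cvge_to_ge (f := fun n => (2%:E * (e n + C%:E * (2%:E * (g n + D))))%E) (a := \oo)); last first.
  by apply: nearW => n; exact: bound.
apply: cvgeZl => //; apply: cvgeD => //; last first.
  by apply: cvgeZl => //; apply: cvgeZl => //; apply: cvgeD => //; exact: cvg_cst.
Qed.

End ito_approximation.

(** * Continuous paths: joint measurability and time integrals *)

Section continuous_processes.
Context (d : measure_display) (T : measurableType d) (R : realType) (m : nat).
Local Notation M := 'M[R[i]]_m.
Local Notation mu := (@lebesgue_measure R).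

(** Within [0, +oo[ continuity at 0 is one-sided; composing with the maximum extends the path by its
    value at 0, which supplies the missing side. *)
Lemma clamp_continuous (u : R -> R) : {within `[0, +oo[, continuous u} ->
  continuous (fun s : R => u (Num.max 0 s)).
Proof.
move=> /continuous_within_itvcyP[cu ru] x.
have pos (y : R) : 0 < y -> Num.max 0 y = y by move=> /ltW y0; apply/max_idPr.
have neg (y : R) : y <= 0 -> Num.max 0 y = 0 by move=> y0; apply/max_idPl.
case: (ltgtP x 0) => [x0|x0|->].
- apply: cvg_near_cst; near=> y; rewrite !neg ?(ltW x0)//.
  by apply: ltW; near: y; exact: lt_nbhsl.
- rewrite /continuous_at (pos _ x0); apply: (@cvg_trans _ (u @ x)).
    apply: near_eq_cvg; near=> y; rewrite pos//.
    by near: y; exact: lt_nbhsr.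
  by apply: cu; rewrite in_itv/= x0.
apply/left_right_continuousP; rewrite maxxx; split.
  apply: cvg_near_cst; near=> y; rewrite neg//.
apply: (@cvg_trans _ (u @ 0^'+)) => //.
by apply: near_eq_cvg; near=> y; rewrite pos//.
Unshelve. all: by end_near. Qed.

Lemma measurable_step_index (c : R) (f : nat -> T -> R) : 0 < c ->
  (forall k, measurable_fun setT (f k)) ->
  measurable_fun setT (fun p : measurableTypeR R * T => f (Num.truncn (c * p.1)) p.2).
Proof.
move=> c0 mf _ B mB; rewrite setTI.
have -> : (fun p : measurableTypeR R * T => f (Num.truncn (c * p.1)) p.2) @^-1` B =
  \bigcup_k ((fun p => Num.truncn (c * p.1)) @^-1` [set k] `&` (f k \o snd) @^-1` B).
  by apply/seteqP; split => [p /= Bp|p [k _ /= [<- //]]]; exists (Num.truncn (c * p.1)).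
apply: bigcupT_measurable => k; apply: measurableI; last first.
  rewrite -[X in measurable X]setTI; apply: measurableT_comp => //; exact: mf.
have lt_meas (y : R) : measurable [set p : measurableTypeR R * T | c * p.1 < y].
  rewrite -[X in measurable X]setTI.
  apply: (@measurable_fun_ltr _ _ _ setT (fun p => c * p.1) (fun=> y) _ _ measurableT [set true]) => //.
  by apply: measurable_funM => //; exact: measurable_fst.
case: k => [|k].
  rewrite (_ : _ @^-1` _ = [set p | c * p.1 < 1])//.
  apply/seteqP; split=> p /=; first by move=> /eqP; rewrite -leqn0 truncn_le_nat.
  by move=> h; apply/eqP; rewrite -leqn0 truncn_le_nat.
rewrite (_ : _ @^-1` _ = [set p | c * p.1 < k.+2%:R] `\` [set p | c * p.1 < k.+1%:R]).
  exact: measurableD.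
apply/seteqP; split=> p /=.
  by move=> h; rewrite -!truncn_le_nat h leqnn ltnn.
by rewrite -!truncn_le_nat => -[h1 /negP]; rewrite -ltnNge => h2; apply/eqP; rewrite eqn_leq h1.
Qed.

Lemma jointly_measurable_steps (c : R) (X : nat -> T -> M) : 0 < c ->
  (forall k, mx_measurable (X k)) ->
  jointly_measurable (fun s w => X (Num.truncn (c * s)) w).
Proof.
move=> c0 mX a b; split.
  exact: (measurable_step_index c0 (fun k => (mX k a b).1)).
exact: (measurable_step_index c0 (fun k => (mX k a b).2)).
Qed.

(* Paths are continuous on [0, +oo[ only; freezing the process at negative
   times makes it jointly measurable on the whole line. *)
Definition clamp_time (U : R -> T -> M) (s : R) (w : T) : M := U (Num.max 0 s) w.

Lemma clamp_timeE U s w : 0 <= s -> clamp_time U s w = U s w.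
Proof. by move=> /max_idPr s0; rewrite /clamp_time s0. Qed.

Lemma truncn_cvg (s : R) : 0 <= s ->
  (Num.truncn (n.+1%:R * s))%:R / n.+1%:R @[n --> \oo] --> s.
Proof.
move=> s0; apply: (@squeeze_cvgr _ _ _ _ (fun n => s - n.+1%:R^-1) (fun=> s)); last exact: cvg_cst.
  apply: nearW => n; have n0 : 0 < n.+1%:R :> R by rewrite ltr0n.
  have := truncn_itv (mulr_ge0 (ltW n0) s0); move: (Num.truncn _) => k /andP[k1 k2].
  rewrite ler_pdivlMr// ler_pdivrMr// mulrBl mulVf ?gt_eqF// [s * _]mulrC k1 andbT.
  by rewrite lerBlDr natr1 ltW.
rewrite -[X in _ --> X]subr0; apply: cvgB; first exact: cvg_cst.
exact: cvg_harmonic.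
Qed.

(** Sampling at the grid points of mesh 1/(n+1) gives processes whose level sets are countable
    unions of rectangles; by continuity they converge pointwise to the clamped one. *)
Lemma jointly_measurable_clamp U : continuous_paths U ->
  (forall s, 0 <= s -> mx_measurable (U s)) -> jointly_measurable (clamp_time U).
Proof.
move=> cU mU.
have mn n : jointly_measurable (fun s w => U ((Num.truncn (n.+1%:R * s))%:R / n.+1%:R) w).
  apply: (@jointly_measurable_steps n.+1%:R (fun k => U (k%:R / n.+1%:R))) => // k.
  by apply: mU; exact: divr_ge0.
have main (re : R[i] -> R) a b :
    (forall w, continuous (fun s : R => re (U (Num.max 0 s) w a b))) ->
    (forall n, measurable_fun setT (fun p : measurableTypeR R * T =>
       re (U ((Num.truncn (n.+1%:R * p.1))%:R / n.+1%:R) p.2 a b))) ->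
    measurable_fun setT (fun p : measurableTypeR R * T => re (clamp_time U p.1 p.2 a b)).
  move=> cre mre; apply: (measurable_fun_cvg mre) => -[s w] _ /=.
  (* For s < 0 both indices are 0, the value of [truncn] at negative arguments, which matches the
     path frozen at time 0. *)
  have trc n : Num.truncn (n.+1%:R * s) = Num.truncn (n.+1%:R * Num.max 0 s).
    have [s0|//] := ltP s 0; rewrite mulr0 truncn0; apply/eqP.
    by rewrite -leqn0 truncn_le_nat (lt_trans _ ltr01)// pmulr_rlt0.
  have cv := truncn_cvg (_ : 0 <= Num.max 0 s); rewrite le_max lexx in cv.
  have := @continuous_cvg _ _ _ _ _ _ _ _ (cre w _) (cv isT).
  rewrite (_ : Num.max 0 (Num.max 0 s) = Num.max 0 s); last by apply/max_idPr; rewrite le_max lexx.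
  move=> h; apply: cvg_trans (h _); apply: near_eq_cvg; apply: nearW => n /=.
  by rewrite (max_idPr _) ?trc// divr_ge0.
move=> a b; split.
- apply: main => [w|n]; last by case: (mn n a b).
  exact: clamp_continuous (cU w a b).1.
- apply: main => [w|n]; last by case: (mn n a b).
  exact: clamp_continuous (cU w a b).2.
Qed.

Definition entries_integrable (r : R) (X : R -> M) := forall a b,
  mu.-integrable `[0, r] (EFin \o (fun s => Re (X s a b))) /\
  mu.-integrable `[0, r] (EFin \o (fun s => Im (X s a b))).

Lemma clamp_integrable U r w : continuous_paths U ->
  entries_integrable r (fun s => clamp_time U s w).
Proof.
move=> cU a b; split; apply: continuous_compact_integrable; try exact: segment_compact.
  by apply: continuous_subspaceT; exact: clamp_continuous (cU w a b).1.
by apply: continuous_subspaceT; exact: clamp_continuous (cU w a b).2.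
Qed.

(** Cauchy-Schwarz in time, from the nonnegative integral of (f - c)^2 with [c] the average of [f]
    over [0, r]. The cases r = 0, where the average is meaningless, and of an infinite right-hand
    side are treated apart. *)
Lemma integral_square_le (f : R -> R) (r : R) : 0 <= r ->
  mu.-integrable `[0, r] (EFin \o f) ->
  (((\int[mu]_(s in `[0, r]) f s) ^+ 2)%:E <=
   r%:E * \int[mu]_(s in `[0%R, r]) ((f s) ^+ 2)%:E)%E.
Proof.
move=> r0 fi.
have mI : measurable (`[0, r]%classic : set (measurableTypeR R)) by exact: measurable_itv.
have f20 : (0 <= \int[mu]_(s in `[0%R, r]) ((f s) ^+ 2)%:E)%E.
  by apply: integral_ge0 => s _; rewrite lee_fin sqr_ge0.
move: r0; rewrite le_eqVlt => /orP[/eqP<-|r0].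
  by rewrite mul0e set_itv1 Rintegral_set1 expr0n.
have [->|foo] := eqVneq (\int[mu]_(s in `[0%R, r]) ((f s) ^+ 2)%:E)%E +oo%E.
  by rewrite gt0_muley ?lte_fin ?leey.
have mf : measurable_fun (`[0, r]%classic : set (measurableTypeR R)) f.
  by apply/measurable_EFinP; exact: measurable_int fi.
have f2i : mu.-integrable `[0, r] (EFin \o (fun s => f s ^+ 2)).
  apply/integrableP; split; first by apply/measurable_EFinP; exact: measurable_funX.
  under eq_integral do rewrite /= ger0_norm ?sqr_ge0//.
  by rewrite lt_neqAle foo leey.
pose c := (\int[mu]_(s in `[0, r]) f s) / r.
have cst z : mu.-integrable `[0, r] (EFin \o (fun=> z : R)).
  apply: continuous_compact_integrable; first exact: segment_compact.
  by apply: continuous_subspaceT => x; exact: cst_continuous.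
have fineE : \int[mu]_(s in `[0, r]) (f s ^+ 2) = fine (\int[mu]_(s in `[0%R, r]) ((f s) ^+ 2)%:E)%E by [].
have ffin : (\int[mu]_(s in `[0%R, r]) ((f s) ^+ 2)%:E)%E \is a fin_num.
  by rewrite ge0_fin_numE// lt_neqAle foo leey.
rewrite -(fineK ffin) -fineE -EFinM lee_fin.
have fci : mu.-integrable `[0, r] (EFin \o (fun s => (2 * c) * f s)).
  by apply: eq_integrable (integrableZl mI (2 * c) fi) => // s _; rewrite /= EFinM.
have g0 : 0 <= \int[mu]_(s in `[0, r]) (f s ^+ 2 - ((2 * c) * f s - c ^+ 2)).
  apply: Rintegral_ge0 => s _; have -> : f s ^+ 2 - (2 * c * f s - c ^+ 2) = (f s - c) ^+ 2 by ring.
  exact: sqr_ge0.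
have fcci : mu.-integrable `[0, r] (EFin \o (fun s => (2 * c) * f s - c ^+ 2)).
  by apply: eq_integrable (integrableB mI fci (cst (c ^+ 2))) => // s _; rewrite /= EFinB.
move: g0; rewrite RintegralB// RintegralB// RintegralZl// Rintegral_cst//.
rewrite [fine _](_ : _ = r); last first.
  by rewrite /= lebesgue_measure_itv /= lte_fin r0 /= subr0.
have cE : \int[mu]_(s in `[0, r]) f s = c * r by rewrite /c divfK// gt_eqF.
rewrite cE; move: (\int[mu]_(s in _) (f s ^+ 2)) => y h.
have : 0 <= r * (y - (2 * c * (c * r) - c ^+ 2 * r)) by rewrite mulr_ge0// ltW.
have -> : r * (y - (2 * c * (c * r) - c ^+ 2 * r)) = r * y - (c * r) ^+ 2 by ring.
by rewrite subr_ge0.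
Qed.

Lemma Re_time_integral (U : R -> T -> M) r w a b :
  Re (time_integral U r w a b) = \int[mu]_(s in `[0, r]) Re (U s w a b).
Proof. by rewrite mxE. Qed.

Lemma Im_time_integral (U : R -> T -> M) r w a b :
  Im (time_integral U r w a b) = \int[mu]_(s in `[0, r]) Im (U s w a b).
Proof. by rewrite mxE. Qed.

Lemma time_integral_diff_le (U X : R -> T -> M) r w : 0 <= r ->
  entries_integrable r (fun s => U s w) -> entries_integrable r (fun s => X s w) ->
  ((frob2 (time_integral U r w - time_integral X r w))%:E <=
   r%:E * frob_integral r (fun s w => (U s w - X s w)%R) w)%E.
Proof.
move=> r0 hU hX.
have mI : measurable (`[0, r]%classic : set (measurableTypeR R)) by exact: measurable_itv.
pose fr a b s := Re (U s w a b) - Re (X s w a b).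
pose fi a b s := Im (U s w a b) - Im (X s w a b).
have ir a b : mu.-integrable `[0, r] (EFin \o fr a b).
  apply: eq_integrable (integrableB mI (hU a b).1 (hX a b).1) => // s _; by rewrite /= EFinB.
have ii a b : mu.-integrable `[0, r] (EFin \o fi a b).
  apply: eq_integrable (integrableB mI (hU a b).2 (hX a b).2) => // s _; by rewrite /= EFinB.
have m2 (f : R -> R) : mu.-integrable `[0, r] (EFin \o f) ->
  measurable_fun (`[0, r]%classic : set (measurableTypeR R)) (fun s => ((f s) ^+ 2)%:E).
  move=> /measurable_int/measurable_EFinP mf; apply/measurable_EFinP; exact: measurable_funX.
have mr a b := m2 _ (ir a b); have mi a b := m2 _ (ii a b).
have sq0 (x : R) : (0 <= (x ^+ 2)%:E)%E by rewrite lee_fin sqr_ge0.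
rewrite /frob_integral.
under eq_integral => s _.
  rewrite frob2_real -sumEFin; under eq_bigr => a _.
    rewrite -sumEFin; under eq_bigr => b _ do
      rewrite !mxE ReB ImB -/(fr a b s) -/(fi a b s) EFinD.
    over.
  over.
rewrite ge0_integral_sum//; first last.
- by move=> a s _; apply: sume_ge0 => b _; exact: adde_ge0.
- by move=> a; apply: emeasurable_sum => b; exact: emeasurable_funD.
rewrite frob2_real -sumEFin ge0_sume_distrr; last first.
  by move=> a _; apply: integral_ge0 => s _; apply: sume_ge0 => b _; exact: adde_ge0.
apply: lee_sum => a _.
rewrite ge0_integral_sum//; first last.
- by move=> b s _; exact: adde_ge0.
- by move=> b; exact: emeasurable_funD.
rewrite -sumEFin ge0_sume_distrr; last first.
  by move=> b _; apply: integral_ge0 => s _; exact: adde_ge0.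
apply: lee_sum => b _.
rewrite ge0_integralD//= ge0_muleDr; [|by apply: integral_ge0|by apply: integral_ge0].
have -> (A B : M) : (A - B) a b = A a b - B a b by rewrite !mxE.
rewrite EFinD ReB ImB !Re_time_integral !Im_time_integral.
rewrite -!RintegralB//; [|exact: (hU a b).2|exact: (hX a b).2|exact: (hU a b).1|exact: (hX a b).1].
exact: (leeD (integral_square_le r0 (ir a b)) (integral_square_le r0 (ii a b))).
Qed.

(** Stated as a pair so that it serves as one rewrite rule for both parts. *)
Lemma elementary_at_entries (phi : elementary T R m) s w a b :
  (Re (elementary_at phi s w a b) =
   \sum_(k < pieces phi) Re (value phi k w a b) * on_interval (knot phi k) (knot phi k.+1) s) *
  (Im (elementary_at phi s w a b) =
   \sum_(k < pieces phi) Im (value phi k w a b) * on_interval (knot phi k) (knot phi k.+1) s).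
Proof.
split; rewrite summxE ?Re_sum ?Im_sum big_mkcond; apply: eq_bigr => k _; rewrite /on_interval;
  by case: ifP; rewrite ?mulr1 ?mulr0.
Qed.

Section elementary_time_integral.
Variables (phi : elementary T R m) (r : R).
Hypotheses (k0 : forall k, (k < pieces phi)%N -> 0 <= knot phi k <= knot phi k.+1)
  (kr : forall k, (k < pieces phi)%N -> knot phi k.+1 <= r).

Let mI : measurable (`[0, r]%classic : set (measurableTypeR R)). Proof. exact: measurable_itv. Qed.

Let term_integral (x : R) (k : 'I_(pieces phi)) :
  mu.-integrable `[0, r] (EFin \o (fun s => x * on_interval (knot phi k) (knot phi k.+1) s)) /\
  \int[mu]_(s in `[0, r]) (x * on_interval (knot phi k) (knot phi k.+1) s) =
  x * (knot phi k.+1 - knot phi k).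
Proof.
have /andP[a0 ab] := k0 (ltn_ord k).
have [i1 e1] := integral_on_interval a0 (kr (ltn_ord k)).
split; first by apply: eq_integrable (integrableZl mI x i1) => // s _; rewrite /= EFinM.
by rewrite RintegralZl// /Rintegral e1 /= (max_idPr _)// subr_ge0.
Qed.

Let sum_integral (x : 'I_(pieces phi) -> R) :
  mu.-integrable `[0, r] (EFin \o (fun s =>
    \sum_k x k * on_interval (knot phi k) (knot phi k.+1) s)) /\
  \int[mu]_(s in `[0, r]) (\sum_k x k * on_interval (knot phi k) (knot phi k.+1) s) =
  \sum_k x k * (knot phi k.+1 - knot phi k).
Proof.
have it k := (term_integral (x k) k).1.
split.
  apply: eq_integrable (integrable_sum mI (index_enum _) (fun k _ => it k)) => // s _.
  by rewrite /= sumEFin.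
rewrite /Rintegral; under eq_integral do rewrite -sumEFin.
rewrite integral_sum// -[RHS]/(fine (_%:E)); congr fine; rewrite -sumEFin.
apply: eq_bigr => k _; rewrite -(term_integral (x k) k).2 /Rintegral fineK//.
exact: (integrable_fin_num mI (it k)).
Qed.

Lemma elementary_at_integrable w : entries_integrable r (fun s => elementary_at phi s w).
Proof.
move=> a b; split.
  rewrite (_ : (fun s => _) = fun s => \sum_(k < pieces phi) Re (value phi k w a b) *
    on_interval (knot phi k) (knot phi k.+1) s); first exact: (sum_integral _).1.
  by apply/funext => s; rewrite elementary_at_entries.
rewrite (_ : (fun s => _) = fun s => \sum_(k < pieces phi) Im (value phi k w a b) *
  on_interval (knot phi k) (knot phi k.+1) s); first exact: (sum_integral _).1.
by apply/funext => s; rewrite elementary_at_entries.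
Qed.

Lemma time_integral_elementary w : time_integral (elementary_at phi) r w =
  \sum_(k < pieces phi) Complex (knot phi k.+1 - knot phi k) 0 *: value phi k w.
Proof.
apply/matrixP => a b; rewrite summxE; apply: complex_ext.
  rewrite Re_time_integral Re_sum; under eq_Rintegral do rewrite elementary_at_entries.
  rewrite (sum_integral _).2; apply: eq_bigr => k _.
  by rewrite mxE Re_mul /= mul0r subr0 mulrC.
rewrite Im_time_integral Im_sum; under eq_Rintegral do rewrite elementary_at_entries.
rewrite (sum_integral _).2; apply: eq_bigr => k _.
by rewrite mxE Im_mul /= mul0r addr0 mulrC.
Qed.

End elementary_time_integral.

End continuous_processes.

(** * Strong error of the Euler scheme *)

(** The right-hand side contains x_(i+1) because the error within a step will be estimated by the
    energy at its end. Smallness of the step absorbs it: 1/(1 - a h) <= 1 + 2 a h as soon as 2 a h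
    <= 1. The product of these factors is at most exp(2 a t). *)
Lemma implicit_gronwall (R : realType) (x : nat -> R) (a b h t : R) (L : nat) :
  0 <= a -> 0 <= b -> 0 <= h -> 2 * (a * h) <= 1 -> L%:R * h = t -> x 0%N = 0 ->
  (forall i, 0 <= x i) ->
  (forall i, (i < L)%N -> x i.+1 <= x i + h * (a * x i.+1 + b * h)) ->
  x L <= (expR (2 * a * t) * t * b) * h.
Proof.
move=> a0 b0 h0 ah Lh x0 xp step.
have ah0 : 0 <= a * h by exact: mulr_ge0.
have r1 : 1 <= 1 + 2 * (a * h) by rewrite lerDl mulr_ge0.
have rp : 0 <= 1 + 2 * (a * h) by exact: le_trans r1.
have ind i : (i <= L)%N -> x i <= (1 + 2 * (a * h)) ^+ i * (i%:R * (b * h ^+ 2)).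
  elim: i => [_|i ih iL]; first by rewrite x0 mul0r mulr0.
  have := step i iL; have := ih (ltnW iL); have := xp i; have := xp i.+1.
  set r := 1 + 2 * (a * h); set ri := r ^+ i => xS xi h1 h2.
  have bh : 0 <= b * h ^+ 2 by rewrite mulr_ge0// sqr_ge0.
  have h3 : x i.+1 <= r * (x i + b * h ^+ 2).
    have e1 : (1 - a * h) * x i.+1 <= x i + b * h ^+ 2.
      have -> : (1 - a * h) * x i.+1 = x i.+1 - h * (a * x i.+1 + b * h) + b * h ^+ 2 by ring.
      by rewrite lerD2r lerBlDr.
    apply: (@le_trans _ _ (r * ((1 - a * h) * x i.+1))); last exact: ler_wpM2l.
    have -> : r * ((1 - a * h) * x i.+1) = x i.+1 + (a * h) * (1 - 2 * (a * h)) * x i.+1.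
      by rewrite /r; ring.
    by rewrite lerDl !mulr_ge0// subr_ge0.
  apply: (le_trans h3); rewrite [X in _ <= X * _]exprS -natr1 -[X in _ <= X]mulrA; apply: ler_wpM2l => //.
  rewrite mulrDl mul1r mulrDr; apply: lerD => //.
  by rewrite ler_peMl// exprn_ege1.
apply: (le_trans (ind L (leqnn L))).
have -> : expR (2 * a * t) * t * b * h = expR (2 * a * t) * (t * (b * h)) by ring.
have -> : L%:R * (b * h ^+ 2) = t * (b * h) by rewrite -Lh; ring.
have t0 : 0 <= t by rewrite -Lh mulr_ge0.
apply: ler_wpM2r; first by rewrite !mulr_ge0.
apply: (@le_trans _ _ (expR (2 * (a * h)) ^+ L)).
  by rewrite lerXn2r ?nnegrE ?expR_ge0 ?expR_ge1Dx.
by rewrite -expRM_natr -Lh (_ : 2 * (a * h) * L%:R = 2 * a * (L%:R * h))//; ring.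
Qed.

Section euler_scheme.
Context (d : measure_display) (T : measurableType d) (R : realType)
        (P : probability T R) (m : nat) (F : R -> set (set T)) (H : R -> T -> 'M[R[i]]_m).
Hypotheses (hH : hermitian_brownian_motion P H) (hF : filtration F)
  (adH : adapted F H) (indH : independent_increments P F H) (m0 : (0 < m)%N).
Local Notation M := 'M[R[i]]_m.
Local Notation mu := (@lebesgue_measure R).
Variable V : M.
Hypothesis V1 : forall b, \sum_a sqmod (V a b) = 1.
Variable h : R.

Definition chain_mx (i : nat) (w : T) : M :=
  \matrix_(a, b) euler_chain H (V^~ b) h i a w.

(* The scheme interpolated inside its [i]-th step. *)
Definition bridge (i : nat) (s : R) (w : T) : M :=
  \matrix_(a, b) euler_step H (i%:R * h) s (euler_chain H (V^~ b) h i) a w.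

(* For [s] in the [i]-th step of the grid, the knots are cut off at [s], so that
   the process lives on [0, s]. *)
Definition chain_process (i : nat) (s : R) : elementary T R m :=
  Elementary i.+1 (fun l => Num.min (l%:R * h) s) chain_mx.

Definition chain_path (s : R) (w : T) : M := chain_mx (Num.truncn (h^-1 * s)) w.

Lemma bridge_end i w : bridge i (i.+1%:R * h) w = chain_mx i.+1 w.
Proof. by apply/matrixP => a b; rewrite !mxE. Qed.

Lemma bridgeE i s w : bridge i s w = chain_mx i w +
  ((Complex 0 1 : R[i]) *: ((H s w - H (i%:R * h) w) *m chain_mx i w) -
   2^-1 *: (Complex (s - i%:R * h) 0 *: chain_mx i w)).
Proof.
have half : (2^-1 : R[i]) = Complex 2^-1 0.
  apply: (@mulfI _ (2 : R[i])); first by rewrite pnatr_eq0.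
  rewrite divff ?pnatr_eq0//; apply: complex_ext; rewrite ?Re_mul ?Im_mul ReD ImD /=.
    by rewrite mulr0 subr0 divff// (_ : 1 + 1 = 2)// pnatr_eq0.
  by rewrite addr0 mulr0 mul0r addr0.
apply/matrixP => a b; rewrite !mxE /euler_step /noise_image half.
rewrite (_ : \sum_j _ = \sum_c (H s w - H (i%:R * h) w) a c * euler_chain H (V^~ b) h i c w); last first.
  by apply: eq_bigr => c _; rewrite !mxE.
move: (\sum_c _) (euler_chain _ _ _ _ _ _) => q x.
apply: complex_ext; rewrite !(ReD, ImD, ReN, ImN, Re_mul, Im_mul) /=;
  by field.
Qed.

Lemma chain_nice i a b : 0 <= h -> h <= 1 -> cnice_wrt P (F (i%:R * h)) (fun w => chain_mx i w a b).
Proof.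
move=> h0 h1; rewrite /cnice_wrt; under eq_fun do rewrite mxE.
under [X in _ /\ nice_wrt _ _ X]eq_fun do rewrite mxE.
by apply: (euler_chain_nice hH hF adH indH m0); rewrite h0.
Qed.

Hypotheses (h0 : 0 < h) (h1 : h <= 1).
Let ti0 i : 0 <= i%:R * h. Proof. by rewrite mulr_ge0// ltW. Qed.
Let tiS (i j : nat) : (i <= j)%N -> i%:R * h <= j%:R * h.
Proof. by move=> ij; rewrite ler_pM2r// ler_nat. Qed.

Section inside_step.
Variables (i : nat) (s : R).
Hypotheses (sI : i%:R * h <= s <= i.+1%:R * h).
Let s0 : 0 <= s. Proof. by apply: le_trans (ti0 i) _; case/andP: sI. Qed.

Let knot_lt k : (k <= i)%N -> Num.min (k%:R * h) s = k%:R * h.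
Proof. by move=> ki; apply/min_idPl; apply: le_trans (tiS ki) _; case/andP: sI. Qed.
Let knot_last : Num.min (i.+1%:R * h) s = s.
Proof. by apply/min_idPr; case/andP: sI. Qed.

Lemma chain_measurable k : mx_measurable (chain_mx k).
Proof.
move=> a b; have [[c1 _] [c2 _]] := chain_nice k a b (ltW h0) h1.
have sF := filtration_sigma_sub hF (ti0 k).
by split; [exact: mfun_wrt_sub sF c1|exact: mfun_wrt_sub sF c2].
Qed.

Lemma chain_process_elementary : elementary_process P F s (chain_process i s).
Proof.
split => /=.
- by rewrite mul0r; apply/min_idPl; exact: s0.
- exact: knot_last.
- move=> k; rewrite ltnS => ki; rewrite le_min ge_min tiS//=.
  by rewrite ge_min lexx orbT.
- move=> k; rewrite ltnS => ki; rewrite knot_lt//; apply: sigma_mx_sub.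
    exact: filtration_sigma.
  move=> a b; have [[c1 _] [c2 _]] := chain_nice k a b (ltW h0) h1; by split.
move=> k; rewrite ltnS => ki.
rewrite /frob2 mean_EFin ?ltry//.
apply: L1_sum => a _; apply: L1_sum => b _.
exact: nice_L1 (nice_sqmod (chain_nice k a b (ltW h0) h1)).
Qed.

Lemma chain_process_at u w : 0 <= u < s -> elementary_at (chain_process i s) u w = chain_path u w.
Proof.
move=> /andP[u0 us]; rewrite /elementary_at /chain_path /=.
have hu : 0 <= h^-1 * u by rewrite mulr_ge0// invr_ge0 ltW.
have trE (k : nat) : (Num.truncn (h^-1 * u) == k) = (k%:R * h <= u < k.+1%:R * h).
  by rewrite truncn_eq// [h^-1 * u]mulrC ler_pdivlMr// ltr_pdivrMr.
have ki : (Num.truncn (h^-1 * u) < i.+1)%N.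
  rewrite truncn_lt_nat// mulrC ltr_pdivrMr//; apply: lt_le_trans us _; by case/andP: sI.
rewrite (big_pred1 (Ordinal ki))// => k.
rewrite ge_min lt_min us andbT [s <= u]leNgt us orbF -trE.
by rewrite /= -val_eqE /= eq_sym.
Qed.

Lemma bridge_integral w : bridge i s w = V +
  (Complex 0 1 : R[i]) *: elementary_integral H (chain_process i s) w -
  2^-1 *: time_integral (elementary_at (chain_process i s)) s w.
Proof.
have hp := chain_process_elementary.
rewrite time_integral_elementary; first last.
- by move=> k kp; case/andP: (knot_bounds hp kp).
- move=> k kp; rewrite (elementary_mono hp kp) andbT.
  by case/andP: (knot_bounds hp (ltnW kp)).
rewrite /elementary_integral /= !big_ord_recr /= knot_last (knot_lt (leqnn i)).
have split_last (v A A' B B' : M) (x y : R[i]) :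
  v + x *: (A + A') - y *: (B + B') = v + x *: A - y *: B + (x *: A' - y *: B').
  by rewrite !scalerDr opprD [v + (_ + _)]addrA addrACA.
(* At grid points, one more term in both sums is one more step of the chain. *)
have grid k : (k <= i)%N ->
  V + (Complex 0 1 : R[i]) *: (\sum_(l < k) (H (Num.min (l.+1%:R * h) s) w - H (Num.min (l%:R * h) s) w) *m chain_mx l w) -
  2^-1 *: (\sum_(l < k) Complex (Num.min (l.+1%:R * h) s - Num.min (l%:R * h) s) 0 *: chain_mx l w) = chain_mx k w.
  elim: k => [_|k ih ki].
    rewrite !big_ord0 !scaler0 subr0 addr0; apply/matrixP => a b; by rewrite mxE.
  rewrite !big_ord_recr /= split_last (ih (ltnW ki)) -bridge_end bridgeE !knot_lt//.
  exact: ltnW.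
by rewrite split_last (grid i (leqnn i)) bridgeE.
Qed.

Lemma bridge_measurable : mx_measurable (bridge i s).
Proof.
rewrite (_ : bridge i s = fun w => chain_mx i w +
  ((Complex 0 1 : R[i]) *: ((H s w - H (i%:R * h) w) *m chain_mx i w) -
   2^-1 *: (Complex (s - i%:R * h) 0 *: chain_mx i w))); last by apply/funext => w; exact: bridgeE.
have mZ := chain_measurable i.
have /andP[is1 _] := sI.
apply: mx_measurableD => //; apply: mx_measurableB; apply: mx_measurableZ; try exact: cmeasurable_cst.
  apply: mx_measurableM => //; apply: (mx_measurable_wrt _ (increment_entries hF adH (ti0 i) is1)).
  exact: filtration_sigma_sub.
by apply: mx_measurableZ => //; exact: cmeasurable_cst.
Qed.

(** For delta <= h <= 1, drift and noise contribute delta^2 / 2 and 2 delta times the mass of each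
    column, and delta^2 / 2 + 2 delta <= 5 h / 2 <= 3 h. *)
Lemma bridge_increment B : (forall b, mean P (fun w => \sum_a sqmod (chain_mx i w a b)) <= B) ->
  (\int[P]_w (frob2 (bridge i s w - chain_mx i w))%:E <= (3 * m%:R * B * h)%:E)%E.
Proof.
move=> hB; have /andP[is1 is2] := sI.
set delta := s - i%:R * h.
have d0 : 0 <= delta by rewrite subr_ge0.
have dh : delta <= h.
  by rewrite lerBlDl (_ : i%:R * h + h = i.+1%:R * h)// -natr1 mulrDl mul1r.
have h01 : 0 <= h <= 1 by rewrite (ltW h0).
pose x b := euler_chain H (V^~ b) h i.
have hx b a : cnice_wrt P (F (i%:R * h)) (x b a) by exact: (euler_chain_nice hH hF adH indH m0).
pose W b w := \sum_a sqmod (x b a w).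
have nW b : nice_wrt P (F (i%:R * h)) (W b) by apply: nice_sum => a; exact: nice_sqmod.
have WE b : W b = (fun w => \sum_a sqmod (chain_mx i w a b)).
  by apply/funext => w; apply: eq_bigr => a _; rewrite mxE.
pose q b a w := sqmod (noise_image H (i%:R * h) s (x b) a w).
have n1 : nice_wrt P (F (i%:R * h)) (fun=> 1) by exact: nice_cst.
have nn b a : cnice_wrt P (F s) (noise_image H (i%:R * h) s (x b) a).
  exact: (noise_image_nice hH hF adH indH m0 (ti0 i) is1 (hx b)).
have nq b a : L1 P (q b a) by exact: nice_L1 (nice_sqmod (nn b a)).
have mq b a : mean P (q b a) = delta / m%:R * mean P (W b).
  have := mean_noise hH hF adH indH m0 (ti0 i) is1 (hx b) a n1.
  by under eq_fun do rewrite mulr1; under [X in _ = _ * mean P X -> _]eq_fun do rewrite mulr1.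
have B0 b : 0 <= mean P (W b).
  by apply: mean_ge0 => w; apply: sumr_ge0 => a _; exact: sqmod_ge0.
have point w : frob2 (bridge i s w - chain_mx i w) <=
    \sum_b (delta ^+ 2 / 2 * W b w + 2 * \sum_a q b a w).
  rewrite /frob2 exchange_big /=; apply: ler_sum => b _; rewrite /W !mulr_sumr -big_split /=.
  apply: ler_sum => a _; rewrite !mxE /q.
  have -> : euler_step H (i%:R * h) s (euler_chain H (V^~ b) h i) a w - euler_chain H (V^~ b) h i a w =
    Complex (- (delta / 2)) 0 * x b a w + Complex 0 1 * noise_image H (i%:R * h) s (x b) a w.
    rewrite /euler_step -/(x b) -/delta; move: (noise_image _ _ _ _ _ _) (x b a w) => y z.
    by apply: complex_ext; rewrite !(ReD, ImD, ReN, ImN, Re_mul, Im_mul) /=; ring.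
  apply: (le_trans (sqmodD _ _)); rewrite !sqmodM mulrDr.
  rewrite (_ : sqmod (Complex 0 1) = 1) ?mul1r; last by rewrite sqmodE /= expr0n expr1n add0r.
  rewrite (_ : sqmod (Complex (- (delta / 2)) 0) = delta ^+ 2 / 4).
    by rewrite lerD2r (_ : 2 * (_ * _) = delta ^+ 2 / 2 * sqmod (x b a w))//; field.
  by rewrite sqmodE /= expr0n addr0; field.
have L1S b : L1 P (fun w => delta ^+ 2 / 2 * W b w + 2 * \sum_a q b a w).
  by apply: L1D; apply: L1Z; [exact: nice_L1 (nW b)|apply: L1_sum].
apply: (@le_trans _ _ (\int[P]_w (\sum_b (delta ^+ 2 / 2 * W b w + 2 * \sum_a q b a w))%:E)%E).
  apply: ge0_le_integral => //.
  - by move=> w _; rewrite lee_fin frob2_ge0.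
  - by apply: measurable_EFin_frob2; apply: mx_measurableB; [exact: bridge_measurable|exact: chain_measurable].
  - by have /measurable_int : L1 P (fun w => \sum_b (delta ^+ 2 / 2 * W b w + 2 * \sum_a q b a w)) by exact: L1_sum.
  by move=> w _; rewrite lee_fin.
rewrite mean_EFin; last exact: L1_sum.
rewrite lee_fin mean_sum//.
have -> : 3 * m%:R * B * h = \sum_(b < m) (3 * B * h).
  by rewrite sumr_const card_ord -[RHS]mulr_natl; ring.
apply: ler_sum => b _; rewrite meanD; [|exact: L1Z (nice_L1 (nW b))|by apply: L1Z; exact: L1_sum].
rewrite meanZ; last exact: nice_L1 (nW b).
rewrite meanZ; last exact: L1_sum.
have -> : mean P (fun w => \sum_a q b a w) = delta * mean P (W b).
  rewrite mean_sum// (eq_bigr (fun=> delta / m%:R * mean P (W b))); last by move=> a _; exact: mq.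
  by rewrite sumr_const card_ord -[LHS]mulr_natl; field; rewrite pnatr_eq0 -lt0n.
have hBb : mean P (W b) <= B by rewrite WE.
have := B0 b; move: (mean P (W b)) hBb => y yB y0.
have B00 : 0 <= B := le_trans y0 yB.
have d2 : delta ^+ 2 <= h by rewrite expr2; apply: (le_trans _ dh); rewrite ler_piMr//; exact: (le_trans dh h1).
have e1 : delta ^+ 2 * y <= h * B by apply: ler_pM => //; exact: sqr_ge0.
have e2 : delta * y <= h * B by apply: ler_pM.
have : 0 <= h * B by rewrite mulr_ge0// ltW.
move: e1 e2; move: (delta ^+ 2) (delta * y) => u v; rewrite (mulrC h) => e1 e2 e3.
by have := h1; lra.
Qed.

End inside_step.

Variables (U : R -> T -> M) (t K : R) (L : nat).
Hypotheses (mU : jointly_measurable U)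
  (iU : forall r w, entries_integrable r (fun s => U s w))
  (sdeU : forall s, 0 <= s -> exists2 Y : T -> M, is_ito_integral P F H U s Y &
    {ae P, forall w, U s w = V + (Complex 0 1 : R[i]) *: Y w - 2^-1 *: time_integral U s w})
  (K0 : 0 <= K)
  (hK : forall s t, 0 <= s -> s <= t ->
    mean P (fun w => frob2 (H t w - H s w) ^+ 2) <= K * (t - s) ^+ 2)
  (L0 : (0 < L)%N) (Lh : L%:R * h = t).

Let mP : jointly_measurable chain_path.
Proof.
apply: jointly_measurable_steps; first by rewrite invr_gt0.
exact: chain_measurable.
Qed.

Let mUP : jointly_measurable (fun s w => U s w - chain_path s w).
Proof. exact: jointly_measurableB. Qed.

Let t0 : 0 <= t. Proof. by rewrite -Lh ti0. Qed.

Local Notation energy r := (frob_energy P r (fun u v => (U u v - chain_path u v)%R)).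

Let energyE i s : i%:R * h <= s <= i.+1%:R * h ->
  frob_energy P s (fun u w => (U u w - elementary_at (chain_process i s) u w)%R) = energy s.
Proof.
move=> sI; apply: eq_frob_energy => //.
  by move=> u w us; rewrite chain_process_at.
apply: jointly_measurableB => //; exact: (elementary_at_measurable hF (chain_process_elementary sI)).
Qed.

(** By |a - b|^2 <= 2 |a|^2 + 2 |b|^2, the stochastic integral gives 2 * 32 m^4 and the drift 2 *
    (1/4) * t, the last factor coming from Cauchy-Schwarz in time. *)
Definition scheme_rate : R := 64 * m%:R ^+ 4 + t / 2.

Lemma scheme_rate_ge0 : 0 <= scheme_rate.
Proof. by rewrite addr_ge0 ?divr_ge0// mulr_ge0// exprn_ge0. Qed.

Lemma bridge_error i s : i%:R * h <= s <= i.+1%:R * h -> s <= t ->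
  (\int[P]_w (frob2 (U s w - bridge i s w))%:E <= scheme_rate%:E * energy s)%E.
Proof.
move=> sI st; have s0 : 0 <= s by apply: le_trans (ti0 i) _; case/andP: sI.
have hp := chain_process_elementary sI.
have mB := bridge_measurable sI.
have mUs : mx_measurable (U s) by exact: jointly_measurable_pair2.
have me := elementary_at_measurable hF hp.
have mUe : jointly_measurable (fun u w => U u w - elementary_at (chain_process i s) u w).
  exact: jointly_measurableB.
have [Y iY eY] := sdeU s0.
have mY := ito_integral_measurable iY.
have mI := elementary_integral_measurable hF adH hp.
have := ito_approx_le hH hF adH indH m0 mU iY hp.
rewrite (energyE sI); set E := energy s => JE.
have E0 : (0 <= E)%E by exact: frob_energy_ge0.
pose A w := (frob2 (Y w - elementary_integral H (chain_process i s) w))%:E.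
pose B w := frob_integral s (fun u w => (U u w - elementary_at (chain_process i s) u w)%R) w.
have mA : measurable_fun setT A by apply: measurable_EFin_frob2; exact: mx_measurableB.
have mBB : measurable_fun setT B by exact: measurable_frob_integral.
have A0 w : (0 <= A w)%E by rewrite lee_fin frob2_ge0.
have B0 w : (0 <= B w)%E by exact: frob_integral_ge0.
apply: (@le_trans _ _ (\int[P]_w (2%:E * A w + (t / 2)%:E * B w))%E).
  apply: ae_ge0_le_integral => //.
  - by move=> w _; rewrite lee_fin frob2_ge0.
  - by apply: measurable_EFin_frob2; exact: mx_measurableB.
  - by move=> w _; rewrite adde_ge0// mule_ge0// lee_fin divr_ge0.
  - by apply: emeasurable_funD; exact: measurable_funeM.
  have kn k : (k < pieces (chain_process i s))%N ->
     0 <= knot (chain_process i s) k <= knot (chain_process i s) k.+1.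
    move=> kp; rewrite (elementary_mono hp kp) andbT.
    by case/andP: (knot_bounds hp (ltnW kp)).
  have kr k : (k < pieces (chain_process i s))%N -> knot (chain_process i s) k.+1 <= s.
    by move=> kp; case/andP: (knot_bounds hp kp).
  apply: filterS eY => w Uw _.
  have dt := time_integral_diff_le s0 (iU s w) (elementary_at_integrable kn kr w).
  rewrite Uw (bridge_integral sI).
  set Iw := elementary_integral _ _ _; set Tu := time_integral U s w.
  set Tp := time_integral _ s w.
  have -> : V + (Complex 0 1 : R[i]) *: Y w - 2^-1 *: Tu - (V + (Complex 0 1 : R[i]) *: Iw - 2^-1 *: Tp) =
     (Complex 0 1 : R[i]) *: (Y w - Iw) - 2^-1 *: (Tu - Tp).
    by rewrite !scalerBr !opprD !opprK; move: (_ *: Y w) (_ *: Iw) (_ *: Tu) (_ *: Tp) => a b c e;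
       apply/matrixP => p q; rewrite !mxE; ring.
  apply: (@le_trans _ _ (2 * (frob2 (Y w - Iw) + 4^-1 * frob2 (Tu - Tp)))%:E).
    rewrite lee_fin; apply: (le_trans (frob2B _ _)); rewrite !frob2Z.
    rewrite (_ : sqmod (Complex 0 1) = 1) ?mul1r; last by rewrite sqmodE /= expr0n expr1n add0r.
    rewrite (_ : sqmod (2^-1 : R[i]) = 4^-1)//.
    apply: (@mulfI _ (4 : R)); first by rewrite pnatr_eq0.
    rewrite divff ?pnatr_eq0// -[LHS]/(_ * _).
    have -> : 4 = sqmod (2 : R[i]) :> R by rewrite sqmodE ReD ImD /=; ring.
    rewrite -sqmodM divff ?pnatr_eq0// sqmodE /= ; ring.
  rewrite mulrDr EFinD EFinM; apply: leeD => //.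
  rewrite mulrA EFinM.
  have -> : (t / 2)%:E = ((2 / 4)%:E * t%:E)%E :> \bar R by rewrite -EFinM; congr (_%:E); field.
  rewrite -muleA; apply: lee_wpmul2l; first by rewrite lee_fin divr_ge0.
  apply: (le_trans dt); apply: lee_wpmul2r => //; by rewrite lee_fin.
rewrite ge0_integralD//; first last.
- exact: measurable_funeM.
- by move=> w _; rewrite mule_ge0// lee_fin divr_ge0.
- exact: measurable_funeM.
- by move=> w _; rewrite mule_ge0.
rewrite !ge0_integralZl//; last by rewrite lee_fin divr_ge0.
have a0 : (0 <= (64 * m%:R ^+ 4 : R)%:E)%E by rewrite lee_fin mulr_ge0// exprn_ge0.
have b0 : (0 <= (t / 2)%:E)%E by rewrite lee_fin divr_ge0.
have -> : (scheme_rate%:E * E = (64 * m%:R ^+ 4)%:E * E + (t / 2)%:E * E)%E.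
  by rewrite -(ge0_muleDl _ a0 b0).
apply: leeD; last by rewrite /B -/(frob_energy P s _) (energyE sI).
rewrite (_ : 64 * m%:R ^+ 4 = 2 * (32 * m%:R ^+ 4)); last by ring.
by rewrite EFinM -muleA; apply: lee_wpmul2l.
Qed.

Let energy_ge0 s : (0 <= energy s)%E. Proof. exact: frob_energy_ge0. Qed.

Let mean_err_measurable : measurable_fun setT
  (fun s : measurableTypeR R => \int[P]_w (frob2 (U s w - chain_path s w))%:E)%E.
Proof. exact: (measurable_mean_frob P mUP). Qed.

Let mean_err_ge0 s : (0 <= \int[P]_w (frob2 (U s w - chain_path s w))%:E)%E.
Proof. by apply: integral_ge0 => w _; rewrite lee_fin frob2_ge0. Qed.

Let energy_mono r s : r <= s -> (energy r <= energy s)%E.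
Proof.
move=> rs; rewrite !frob_energy_swap//; apply: ge0_subset_integral => //.
  exact: measurable_funTS.
by move=> u /=; rewrite !in_itv/= => /andP[-> /le_trans->].
Qed.

Let C2 : R := 1 + m%:R ^+ 2 * K.
Definition scheme_mass : R := 1 + C2 * t * expR (C2 * t).

Let mass_le i b : i%:R * h <= t -> mean P (fun w => \sum_a sqmod (chain_mx i w a b)) <= scheme_mass.
Proof.
move=> it; have h01 : 0 <= h <= 1 by rewrite (ltW h0).
have [/andP[_ m1] _ _] := euler_chain_mass_bounds hH hF adH indH m0 K0 hK (V1 b) h01 it.
rewrite (_ : (fun w => _) = (fun w => \sum_a sqmod (euler_chain H (V^~ b) h i a w))); last first.
  by apply/funext => w; apply: eq_bigr => a _; rewrite mxE.
move: m1; rewrite lerBlDl => /le_trans; apply; rewrite /scheme_mass -/C2 lerD2l.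
by apply: ler_piMr => //; rewrite !mulr_ge0 ?expR_ge0// addr_ge0// mulr_ge0// sqr_ge0.
Qed.

Definition scheme_noise : R := 3 * m%:R * scheme_mass.

Let mass_ge0 : 0 <= scheme_mass.
Proof.
by rewrite addr_ge0// !mulr_ge0 ?expR_ge0// addr_ge0// mulr_ge0// sqr_ge0.
Qed.

Let chain_path_at i s w : i%:R * h <= s < i.+1%:R * h -> chain_path s w = chain_mx i w.
Proof.
move=> sI; rewrite /chain_path; congr chain_mx; apply: truncn_def.
by rewrite mulrC ler_pdivlMr// ltr_pdivrMr.
Qed.

Let mean_err_le i s : i%:R * h <= s < i.+1%:R * h -> i.+1%:R * h <= t ->
  (\int[P]_w (frob2 (U s w - chain_path s w))%:E <=
   (2 * scheme_rate)%:E * energy (i.+1%:R * h) + (2 * scheme_noise * h)%:E)%E.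
Proof.
move=> sI it; have /andP[s1 s2] := sI.
have sI' : i%:R * h <= s <= i.+1%:R * h by rewrite s1 ltW.
have st : s <= t by exact: le_trans (ltW s2) it.
have rate0 := scheme_rate_ge0.
have mB := bridge_measurable sI'.
have mZ := chain_measurable i.
have mUs : mx_measurable (U s) by exact: jointly_measurable_pair2.
have m1 : measurable_fun setT (fun w => (frob2 (U s w - bridge i s w))%:E).
  by apply: measurable_EFin_frob2; exact: mx_measurableB.
have m2 : measurable_fun setT (fun w => (frob2 (bridge i s w - chain_mx i w))%:E).
  by apply: measurable_EFin_frob2; exact: mx_measurableB.
have f0 (X : T -> M) w : (0 <= (frob2 (X w))%:E)%E by rewrite lee_fin frob2_ge0.
apply: (@le_trans _ _ (2%:E * (\int[P]_w (frob2 (U s w - bridge i s w))%:E +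
     \int[P]_w (frob2 (bridge i s w - chain_mx i w))%:E))%E).
  rewrite -ge0_integralD//; try by move=> w _; exact: (f0 (fun w => _)).
  rewrite -ge0_integralZl//; [|exact: emeasurable_funD|
    by move=> w _; apply: adde_ge0; exact: (f0 (fun w => _))].
  apply: ge0_le_integral => //.
  - by move=> w _; exact: (f0 (fun w => _)).
  - by apply: measurable_EFin_frob2; apply: mx_measurableB => //; exact: (jointly_measurable_pair2 s mP).
  - by apply: measurable_funeM; exact: emeasurable_funD.
  move=> w _; rewrite -EFinD -EFinM lee_fin (chain_path_at w sI).
  rewrite -[U s w - _](subrKA (bridge i s w)); exact: frob2D.
have e1 := bridge_error sI' st.
have e2 := bridge_increment sI' (fun b => mass_le b (le_trans s1 st)).
apply: (@le_trans _ _ (2%:E * (scheme_rate%:E * energy (i.+1%:R * h) + (scheme_noise * h)%:E))%E).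
  apply: lee_wpmul2l; first by rewrite lee_fin.
  apply: leeD; last exact: e2.
  apply: (le_trans e1); apply: lee_wpmul2l; first by rewrite lee_fin.
  by apply: energy_mono; exact: ltW.
have distr (a c : R) (e : \bar R) : 0 <= a -> 0 <= c -> (0 <= e)%E ->
    (2%:E * (a%:E * e + c%:E) = (2 * a)%:E * e + (2 * c)%:E)%E.
  by move=> a0 c0 e0; rewrite ge0_muleDr ?mule_ge0// muleA -!EFinM.
rewrite distr//; first by rewrite mulrA.
by apply: mulr_ge0; [apply: mulr_ge0 => //; exact: mulr_ge0|exact: ltW].
Qed.

Let energy_step i : (i < L)%N ->
  (energy (i.+1%:R * h) <= energy (i%:R * h) +
   h%:E * ((2 * scheme_rate)%:E * energy (i.+1%:R * h) + (2 * scheme_noise * h)%:E))%E.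
Proof.
move=> iL; have it : i.+1%:R * h <= t by rewrite -Lh tiS.
have rate0 := scheme_rate_ge0.
have ih : i%:R * h <= i.+1%:R * h by exact: tiS.
rewrite [X in (X <= _)%E]frob_energy_swap// [X in (_ <= X + _)%E]frob_energy_swap//.
have mo (b : R) : measurable_fun (`[0, b[%classic : set (measurableTypeR R))
    (fun s => \int[P]_w (frob2 (U s w - chain_path s w))%:E)%E by exact: measurable_funTS.
rewrite -!integral_itv_bndo_bndc; [|exact: mo|exact: mo].
have mI1 : measurable (`[0, i%:R * h[%classic : set (measurableTypeR R)) by exact: measurable_itv.
have mI2 : measurable (`[i%:R * h, i.+1%:R * h[%classic : set (measurableTypeR R)) by exact: measurable_itv.
rewrite (_ : [set` `[0, i.+1%:R * h[] = `[0, i%:R * h[ `|` `[i%:R * h, i.+1%:R * h[); last first.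
  by apply: itv_bndbnd_setU; rewrite bnd_simp.
rewrite (ge0_integral_setU _ mI1 mI2)//; first last.
- apply/disj_set2P/seteqP; split=> // u /= []; rewrite !in_itv/= => /andP[_ u1] /andP[u2 _].
  by have := lt_le_trans u1 u2; rewrite ltxx.
- exact: measurable_funTS.
apply: leeD2l.
pose c := ((2 * scheme_rate)%:E * energy (i.+1%:R * h) + (2 * scheme_noise * h)%:E)%E.
apply: (@le_trans _ _ (\int[mu]_(s in `[(i%:R * h)%R, (i.+1%:R * h)%R[) c)%E).
  apply: ge0_le_integral => //.
  - exact: measurable_funTS.
  by move=> s /=; rewrite in_itv/= => sI; exact: mean_err_le.
rewrite -/c; clearbody c.
rewrite integral_cst//= lebesgue_measure_itv /= lte_fin ltr_pM2r// ltr_nat ltnSn.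
rewrite -EFinD (_ : i.+1%:R * h - i%:R * h = h); first by rewrite muleC.
by rewrite -natr1 mulrDl mul1r addrAC subrr add0r.
Qed.

(** Absorbing the energy on the right into the left requires it to be finite. The elementary process
    used for this lives on [0, t], with t seen as the end of step L - 1. *)
Let energy_finite i : (i <= L)%N -> (energy (i%:R * h) < +oo)%E.
Proof.
move=> iL; have it : i%:R * h <= t by rewrite -Lh tiS.
apply: le_lt_trans (energy_mono it) _.
have tI : L.-1%:R * h <= t <= L.-1.+1%:R * h by rewrite prednK// Lh lexx andbT -Lh tiS// leq_pred.
have hp := chain_process_elementary tI.
have [Y iY _] := sdeU t0.
rewrite -(energyE tI).
have me := elementary_at_measurable hF hp.
apply: (@le_lt_trans _ _ (2%:E * (frob_energy P t U + frob_energy P t (elementary_at (chain_process L.-1 t))))%E).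
  apply: frob_energy_le => //; first exact: jointly_measurableB.
  by move=> s w _; exact: frob2B.
have := ito_energy_finite hF mU iY; have := frob_energy_elementary hF hp.
have := frob_energy_ge0 P t U; have := frob_energy_ge0 P t (elementary_at (chain_process L.-1 t)).
by move: (frob_energy _ _ U) (frob_energy _ _ _) => [x| |] [y| |] //= _ _ _ _; rewrite -EFinD -EFinM ltry.
Qed.

Lemma scheme_error : 4 * (scheme_rate * h) <= 1 ->
  (\int[P]_w (frob2 (U t w - chain_mx L w))%:E <=
   (scheme_rate * (expR (4 * scheme_rate * t) * t * (2 * scheme_noise)) * h)%:E)%E.
Proof.
move=> hrate.
have rate0 := scheme_rate_ge0.
have noise0 : 0 <= scheme_noise by rewrite !mulr_ge0.
have tI : L.-1%:R * h <= t <= L.-1.+1%:R * h by rewrite prednK// Lh lexx andbT -Lh tiS// leq_pred.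
have -> : chain_mx L = bridge L.-1 t.
  by apply/funext => w; have := bridge_end L.-1 w; rewrite prednK// Lh.
apply: (le_trans (bridge_error tI (lexx t))).
have fin i : (i <= L)%N -> energy (i%:R * h) \is a fin_num.
  by move=> iL; rewrite ge0_fin_numE// energy_finite.
pose x i := if (i <= L)%N then fine (energy (i%:R * h)) else 0.
have xE i : (i <= L)%N -> energy (i%:R * h) = (x i)%:E.
  by move=> iL; rewrite /x iL fineK// fin.
have xL : x L <= expR (2 * (2 * scheme_rate) * t) * t * (2 * scheme_noise) * h.
  (* With a = 2 [scheme_rate], the smallness condition 2 a h <= 1 reads 4 [scheme_rate] h <= 1. *)
  apply: (@implicit_gronwall _ x (2 * scheme_rate) (2 * scheme_noise) h t L) => //.
  - by rewrite mulr_ge0.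
  - by rewrite mulr_ge0.
  - exact: ltW.
  - by rewrite (_ : 2 * (2 * scheme_rate * h) = 4 * (scheme_rate * h))//; ring.
  - rewrite /x leq0n mul0r /frob_energy integral0_eq// => w _.
    by rewrite /frob_integral set_itv1 integral_set1.
  - by move=> i; rewrite /x; case: ifP => // _; exact: fine_ge0.
  move=> i iL; have := energy_step iL.
  by rewrite !xE// 1?ltnW// -!EFinM -!EFinD -EFinM -EFinD lee_fin.
rewrite -Lh xE// -EFinM lee_fin -[X in _ <= X]mulrA; apply: ler_wpM2l => //.
by rewrite Lh (_ : 4 * scheme_rate = 2 * (2 * scheme_rate))//; ring.
Qed.

End euler_scheme.

(** * Identification of the moments *)

(** An index beyond both C / x and 1 / delta refutes x > 0. All limits of the scheme are taken in
    this form. *)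
Lemma le_harmonic_multiple (R : realType) (x C delta : R) : 0 < delta ->
  (forall n : nat, n.+1%:R^-1 <= delta -> x <= n.+1%:R^-1 * C) -> x <= 0.
Proof.
move=> d0 h; rewrite leNgt; apply/negP => x0.
pose y := Num.max (C / x) delta^-1.
have y1 : y < (Num.truncn y).+1%:R by exact: truncnS_gt.
have n0 : 0 < (Num.truncn y).+1%:R :> R by rewrite ltr0n.
have [c1 c2] : C / x < (Num.truncn y).+1%:R /\ delta^-1 < (Num.truncn y).+1%:R.
  by split; apply: le_lt_trans y1; rewrite /y le_max lexx ?orbT.
have := h (Num.truncn y); rewrite -[delta]invrK lef_pV2 ?posrE ?invr_gt0// => /(_ (ltW c2)).
move: c1; rewrite ltr_pdivrMr// => c1; rewrite leNgt mulrC ltr_pdivrMr//.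
by rewrite mulrC c1.
Qed.

(** |x|^2 - |y|^2 = 2 Re(conj y (x - y)) + |x - y|^2, and Young's inequality splits the cross term.
    In the application [y] is the scheme, whose mass is bounded, and x - y has mean square of order
    k^2, so it can afford the factor 1/k. *)
Lemma sqmod_diff_le (R : realType) (k : R) (x y : R[i]) : 0 < k ->
  `|sqmod x - sqmod y| <= k * sqmod y + (1 + k^-1) * sqmod (x - y).
Proof.
move=> k0.
have amgm (a b : R) : 2 * `|a * b| <= k * a ^+ 2 + k^-1 * b ^+ 2.
  have := @weighted_amgm R k `|a| `|b| (a ^+ 2) (b ^+ 2) k0.
  by rewrite !real_normK ?num_real// => /(_ (lexx _) (lexx _)); rewrite -normrM mulrC [_ / k]mulrC.
have -> : sqmod x - sqmod y =
    2 * (Re y * Re (x - y)) + 2 * (Im y * Im (x - y)) + sqmod (x - y).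
  by rewrite !sqmodE ReB ImB; ring.
have h1 := amgm (Re y) (Re (x - y)); have h2 := amgm (Im y) (Im (x - y)).
apply: (le_trans (ler_normD _ _)); rewrite (ger0_norm (sqmod_ge0 _)).
apply: (le_trans (lerD (ler_normD _ _) (lexx _))).
rewrite 2!(normrM 2) !(ger0_norm (_ : 0 <= 2 :> R))//.
apply: (le_trans (lerD (lerD h1 h2) (lexx _))).
by rewrite !sqmodE; move: (Re y) (Im y) (Re (x - y)) (Im (x - y)) k^-1 => *; lra.
Qed.

(* Since [u1, u2] lie in [0, 1] and the [z]'s sum to about 1, only [y], the
   deviation of that sum, has to absorb the unboundedness of the [z]'s. *)
Lemma product_diff_le (R : realType) (u1 u2 z1 z2 y e : R) :
  0 <= u1 <= 1 -> 0 <= u2 <= 1 -> 0 <= z1 -> 0 <= z2 -> 0 <= y ->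
  z1 + z2 <= 1 + y -> `|u1 - z1| + `|u2 - z2| <= e ->
  `|u1 * u2 - z1 * z2| <= e + 2 * y + y ^+ 2.
Proof.
move=> /andP[a0 a1] /andP[b0 b1] z10 z20 y0 zy he.
have -> : u1 * u2 - z1 * z2 = u2 * (u1 - z1) + z1 * (u2 - z2) by ring.
apply: (le_trans (ler_normD _ _)); rewrite !normrM (ger0_norm b0) (ger0_norm z10).
have h2 : `|u2 - z2| <= 1 + y by rewrite ler_norml; apply/andP; split; lra.
have n1 := normr_ge0 (u1 - z1); have n2 := normr_ge0 (u2 - z2).
move: `|u1 - z1| `|u2 - z2| he h2 n1 n2 => d1 d2 he h2 n1 n2.
have : u2 * d1 <= d1 by rewrite ler_piMl.
have : z1 * d2 <= (1 + y) * d2 by apply: ler_wpM2r => //; lra.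
have : y * d2 <= y * (1 + y) by exact: ler_wpM2l.
rewrite expr2; lra.
Qed.

Section almost_everywhere.
Context (d : measure_display) (T : measurableType d) (R : realType)
        (P : probability T R).
Implicit Types X Y : T -> R.

Lemma ae_mean_norm_le X Y : L1 P X -> L1 P Y -> (forall w, 0 <= Y w) ->
  {ae P, forall w, `|X w| <= Y w} -> `|mean P X| <= mean P Y.
Proof.
move=> hX hY Y0 le; apply: (le_trans (mean_norm hX)).
rewrite -lee_fin -!mean_EFin//; last exact: L1_norm.
apply: ae_ge0_le_integral => //.
- by have /measurable_int := L1_norm hX.
- by move=> w _; rewrite lee_fin.
- by have /measurable_int := hY.
by apply: filterS le => w h _; rewrite lee_fin.
Qed.

Lemma ae_bounded_L1 X (c : R) : measurable_fun setT X -> (forall w, 0 <= X w) ->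
  {ae P, forall w, X w <= c} -> L1 P X.
Proof.
move=> mX X0 le; apply: L1_ge0 => //.
apply: (@le_lt_trans _ _ (\int[P]_w (Num.max 0 c)%:E)%E).
  apply: ae_ge0_le_integral => //.
  - by move=> w _; rewrite lee_fin.
  - exact/measurable_EFinP.
  - by move=> w _; rewrite lee_fin le_max lexx.
  by apply: filterS le => w h _; rewrite lee_fin le_max h orbT.
by rewrite (mean_EFin (L1_cst P _)) ltry.
Qed.

Lemma ae_mean_cst X (c : R) : measurable_fun setT X -> {ae P, forall w, X w = c} -> mean P X = c.
Proof.
move=> mX e; rewrite -[RHS](mean_cst P c) /mean /Rintegral; congr fine.
apply: ae_eq_integral => //; first exact/measurable_EFinP.
by apply: filterS e => w h _ /=; rewrite h.
Qed.

Lemma mean_norm_le0 X : L1 P X -> mean P (fun w => `|X w|) <= 0 -> {ae P, forall w, X w = 0}.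
Proof.
move=> hX le.
have e0 : (\int[P]_w `|(X w)%:E|)%E = 0%E.
  rewrite -[LHS]/(\int[P]_w (`|X w|)%:E)%E (mean_EFin (L1_norm hX)); congr (_%:E).
  by apply/eqP; rewrite eq_le le mean_ge0.
have [/(_ e0) h _] := ae_eq_integral_abs P measurableT (measurable_int _ hX).
by apply: filterS h => w /(_ I) /= [].
Qed.

End almost_everywhere.

Section limit_identification.
Context (d : measure_display) (T : measurableType d) (R : realType)
        (P : probability T R) (m : nat) (u : 'I_m -> T -> R) (C delta : R).
Hypotheses (mu : forall a, measurable_fun setT (u a)) (u0 : forall a w, 0 <= u a w)
  (d0 : 0 < delta).
(** [G] stands for the residual of the explicit formula for the pair moment; being Lipschitz, it
    passes to the limit. *)
Variables (j k : 'I_m) (bj bk : R) (G : R -> R -> R -> R).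
Hypotheses (hG : forall x x' y y' a a' , `|G a x y - G a' x' y'| <= `|a - a'| + `|x - x'| + `|y - y'|)
  (jk : j != k).
(* [z] is an approximation of [u] at scale 1/(n+1), [e] dominates its error. *)
Hypothesis approx : forall n : nat, n.+1%:R^-1 <= delta -> exists z : 'I_m -> T -> R, exists e : T -> R,
  [/\ [/\ forall a w, 0 <= z a w, forall a, L1 P (z a), L1 P (fun w => z j w * z k w),
       L1 P e & L1 P (fun w => (\sum_a z a w - 1) ^+ 2)],
      [/\ forall w, \sum_a `|u a w - z a w| <= e w, mean P e <= n.+1%:R^-1 * C,
       mean P (fun w => `|\sum_a z a w - 1|) <= n.+1%:R^-1 * C &
       mean P (fun w => (\sum_a z a w - 1) ^+ 2) <= n.+1%:R^-1 * C] &
      [/\ `|mean P (z j) - bj| <= n.+1%:R^-1 * C, `|mean P (z k) - bk| <= n.+1%:R^-1 * C &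
       `|G (mean P (fun w => z j w * z k w)) (mean P (z j)) (mean P (z k))| <= n.+1%:R^-1 * C]].

Lemma limit_L1 a : L1 P (u a).
Proof.
pose n := Num.truncn delta^-1.
have nd : n.+1%:R^-1 <= delta.
  by rewrite -[delta]invrK lef_pV2 ?posrE ?invr_gt0 ?ltr0n// ltW// truncnS_gt.
have [z [e [[z0 Lz _ Le _] [ze _ _ _] _]]] := approx nd.
apply: (L1_le _ _ (L1D (Lz a) Le)) => // w.
rewrite ger0_norm// -lerBlDl; apply: le_trans (ze w).
by rewrite (bigD1 a)//= (le_trans (ler_norm _))// lerDl sumr_ge0.
Qed.

Let L1d : L1 P (fun w => \sum_a u a w - 1).
Proof. by apply: L1B; [apply: L1_sum => a _; exact: limit_L1|exact: L1_cst]. Qed.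

(** The deviation of the mass of [u] from 1 is at most the approximation error plus the deviation
    for [z]. Both are O(1/n) in mean, so it vanishes almost surely, and from then on each [u a] is
    bounded by 1. *)
Lemma limit_mass : {ae P, forall w, \sum_a u a w = 1}.
Proof.
suff : {ae P, forall w, \sum_a u a w - 1 = 0}.
  by apply: filterS => w /eqP; rewrite subr_eq0 => /eqP.
apply: mean_norm_le0 => //.
apply: (@le_harmonic_multiple _ _ (2 * C) delta) => // n nd.
have [z [e [[z0 Lz _ Le _] [ze ee zw _] _]]] := approx nd.
have L1w : L1 P (fun w => `|\sum_a z a w - 1|).
  by apply: L1_norm; apply: L1B; [exact: L1_sum|exact: L1_cst].
apply: (@le_trans _ _ (mean P (fun w => e w + `|\sum_a z a w - 1|))); last first.
  by rewrite meanD// mulrA [_ * 2]mulrC -mulrA (_ : 2 * _ = n.+1%:R^-1 * C + n.+1%:R^-1 * C) ?lerD//; ring.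
apply: mean_le; [exact: L1_norm|exact: L1D|move=> w].
have -> : \sum_a u a w - 1 = \sum_a (u a w - z a w) + (\sum_a z a w - 1).
  by rewrite sumrB; ring.
apply: (le_trans (ler_normD _ _)); rewrite lerD2r; apply: le_trans (ze w).
exact: ler_norm_sum.
Qed.

Let u1 : {ae P, forall w, forall a, u a w <= 1}.
Proof.
apply: filterS limit_mass => w e a; rewrite -e (bigD1 a)//= lerDl.
by apply: sumr_ge0.
Qed.

Let mean_close a z e : L1 P (z a) -> L1 P e -> (forall w, \sum_a `|u a w - z a w| <= e w) ->
  `|mean P (u a) - mean P (z a)| <= mean P e.
Proof.
move=> Lz Le ze; rewrite -meanB//; last exact: limit_L1.
have L := L1B (limit_L1 a) Lz.
apply: (le_trans (mean_norm L)); apply: mean_le => //; first exact: L1_norm.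
by move=> w; apply: le_trans (ze w); rewrite (bigD1 a)//= lerDl sumr_ge0.
Qed.

Lemma limit_mean : mean P (u j) = bj /\ mean P (u k) = bk.
Proof.
split; apply/eqP; rewrite -subr_eq0 -normr_le0;
  apply: (@le_harmonic_multiple _ _ (2 * C) delta) => // n nd;
  have [z [e [[z0 Lz _ Le _] [ze ee _ _] [zj zk _]]]] := approx nd;
  rewrite mulrA [_ * 2]mulrC -mulrA (_ : 2 * _ = n.+1%:R^-1 * C + n.+1%:R^-1 * C); try ring.
- rewrite -(subrKA (mean P (z j))); apply: (le_trans (ler_normD _ _)); apply: lerD => //.
  exact: le_trans (mean_close (Lz j) Le ze) ee.
- rewrite -(subrKA (mean P (z k))); apply: (le_trans (ler_normD _ _)); apply: lerD => //.
  exact: le_trans (mean_close (Lz k) Le ze) ee.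
Qed.

(** The factor 7 is 4 + 3. Replacing the product of the [u] by that of the [z] costs 1 for [e], 2
    for the deviation of the mass and 1 for its square; the two first moments and the residual at
    [z] cost 1 each. *)
Lemma limit_pair : G (mean P (fun w => u j w * u k w)) (mean P (u j)) (mean P (u k)) = 0.
Proof.
have Luu : L1 P (fun w => u j w * u k w).
  apply: (@ae_bounded_L1 _ _ _ _ _ 1).
  - exact: measurable_funM.
  - by move=> w; exact: mulr_ge0.
  by apply: filterS u1 => w h; exact: mulr_ile1.
apply/eqP; rewrite -normr_le0.
apply: (@le_harmonic_multiple _ _ (7 * C) delta) => // n nd.
have [z [e [[z0 Lz Lzz Le Lw2] [ze ee w1 w2] [_ _ hz]]]] := approx nd.
have L1w : L1 P (fun w => `|\sum_a z a w - 1|).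
  by apply: L1_norm; apply: L1B; [exact: L1_sum|exact: L1_cst].
have e0 w : 0 <= e w by apply: le_trans (ze w); exact: sumr_ge0.
have LD := L1D (L1D Le (L1Z 2 L1w)) Lw2.
have pairs : `|mean P (fun w => u j w * u k w) - mean P (fun w => z j w * z k w)| <=
    4 * (n.+1%:R^-1 * C).
  apply: (@le_trans _ _ (mean P (fun w => e w + 2 * `|\sum_a z a w - 1| + (\sum_a z a w - 1) ^+ 2))).
    rewrite -meanB//; apply: ae_mean_norm_le => //.
    - exact: L1B.
    - by move=> w; rewrite !addr_ge0 ?sqr_ge0// mulr_ge0.
    apply: filterS u1 => w h; rewrite -(real_normK (num_real (\sum_a z a w - 1))).
    apply: product_diff_le; rewrite ?u0 ?h//.
      rewrite -lerBlDl; apply: le_trans (ler_norm _); rewrite lerD2r.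
      rewrite (bigD1 j)//= (bigD1 k)/=; last by rewrite eq_sym.
      by rewrite addrA lerDl sumr_ge0.
    apply: le_trans (ze w); rewrite (bigD1 j)//= (bigD1 k)/=; last by rewrite eq_sym.
    by rewrite addrA lerDl sumr_ge0.
  rewrite !meanD//; [|exact: L1Z|exact: L1D Le (L1Z 2 L1w)]; rewrite meanZ//.
  by move: ee w1 w2; move: (n.+1%:R^-1 * C) (mean P e) (mean P _) (mean P _) => c x y v; lra.
have cj := le_trans (mean_close (Lz j) Le ze) ee.
have ck := le_trans (mean_close (Lz k) Le ze) ee.
have := hG (mean P (u j)) (mean P (z j)) (mean P (u k)) (mean P (z k))
  (mean P (fun w => u j w * u k w)) (mean P (fun w => z j w * z k w)).
set g := G _ _ _; set g' := G _ _ _ in hz *.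
move=> gg; rewrite -(subrK g' g); apply: (le_trans (ler_normD _ _)).
have -> : n.+1%:R^-1 * (7 * C) = 4 * (n.+1%:R^-1 * C) + n.+1%:R^-1 * C + n.+1%:R^-1 * C + n.+1%:R^-1 * C.
  by ring.
by apply: lerD => //; apply: (le_trans gg); apply: lerD => //; exact: lerD.
Qed.

End limit_identification.

Section unitary_brownian_moments.
Context (d : measure_display) (T : measurableType d) (R : realType)
        (P : probability T R) (m : nat) (F : R -> set (set T)) (H U : R -> T -> 'M[R[i]]_m).
Hypotheses (hH : hermitian_brownian_motion P H) (hF : filtration F)
  (adH : adapted F H) (indH : independent_increments P F H).
Variable V : 'M[R[i]]_m.
Hypothesis V1 : forall b, \sum_a sqmod (V a b) = 1.
Hypotheses (mU : jointly_measurable U)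
  (iU : forall r w, entries_integrable r (fun s => U s w))
  (sdeU : forall s, 0 <= s -> exists2 Y : T -> 'M[R[i]]_m, is_ito_integral P F H U s Y &
    {ae P, forall w, U s w = V + (Complex 0 1 : R[i]) *: Y w - 2^-1 *: time_integral U s w}).
Variables (j k c0 : 'I_m) (t : R).
Hypotheses (jk : j != k) (t0 : 0 < t).
Local Notation N := (m%:R : R).
Local Notation lambda := (2 + 2 / N).
Local Notation x0 := (fun a => V a c0).
Local Notation p a := (fun w => sqmod (U t w a c0)).

Let m0 : (0 < m)%N. Proof. by case: (m) (j) => // -[]. Qed.
Let bj := N^-1 + expR (- t) * (sqmod (x0 j) - N^-1).
Let bk := N^-1 + expR (- t) * (sqmod (x0 k) - N^-1).
Let G (a x y : R) := a - (N + 2)^-1 * (x + y - 2 / N) - (N * (N + 1))^-1 -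
  expR (- (t * lambda)) * (sqmod (x0 j) * sqmod (x0 k) -
    (N + 2)^-1 * (sqmod (x0 j) + sqmod (x0 k) - 2 / N) - (N * (N + 1))^-1).

Let G_lipschitz x x' y y' a a' : `|G a x y - G a' x' y'| <= `|a - a'| + `|x - x'| + `|y - y'|.
Proof.
have N2 : 0 <= (N + 2)^-1 <= 1.
  by rewrite invr_ge0 addr_ge0//= invf_le1 ?ltr_wpDl// (le_trans (_ : 1 <= 2)) ?ler1n ?lerDr.
have -> : G a x y - G a' x' y' = (a - a') - (N + 2)^-1 * ((x - x') + (y - y')) by rewrite /G; ring.
apply: (le_trans (ler_normB _ _)); rewrite -[X in _ <= X]addrA lerD2l normrM ger0_norm; last by case/andP: N2.
apply: (@le_trans _ _ `|(x - x') + (y - y')|); last exact: ler_normD.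
by apply: ler_piMl => //; case/andP: N2.
Qed.

Lemma column_approximation : exists C delta : R, 0 < delta /\
  forall n : nat, n.+1%:R^-1 <= delta -> exists z : 'I_m -> T -> R, exists e : T -> R,
  [/\ [/\ forall a w, 0 <= z a w, forall a, L1 P (z a), L1 P (fun w => z j w * z k w),
       L1 P e & L1 P (fun w => (\sum_a z a w - 1) ^+ 2)],
      [/\ forall w, \sum_a `|sqmod (U t w a c0) - z a w| <= e w, mean P e <= n.+1%:R^-1 * C,
       mean P (fun w => `|\sum_a z a w - 1|) <= n.+1%:R^-1 * C &
       mean P (fun w => (\sum_a z a w - 1) ^+ 2) <= n.+1%:R^-1 * C] &
      [/\ `|mean P (z j) - bj| <= n.+1%:R^-1 * C, `|mean P (z k) - bk| <= n.+1%:R^-1 * C &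
       `|G (mean P (fun w => z j w * z k w)) (mean P (z j)) (mean P (z k))| <= n.+1%:R^-1 * C]].
Proof.
have [K K0 hK] := increment_frob_moment hH hF adH indH m0.
have t00 := ltW t0.
(* [eexists] leaves the constant to be read off from [euler_chain_p]; it may precede kappa, h and L
   because it involves none of them. *)
have [Cp hp] : exists Cp, forall kappa h L, 0 <= h <= 1 -> 0 < kappa -> kappa <= 1 ->
    h = t * kappa ^+ 2 -> L%:R * h = t -> forall a,
    `|mean P (fun w => sqmod (euler_chain H x0 h L a w)) - N^-1 -
      expR (- t) * (sqmod (x0 a) - N^-1)| <= kappa * Cp.
  eexists => kappa h L h01 kp0 kp1 hE hL a.
  exact: (euler_chain_p hH hF adH indH m0 K0 hK (V1 c0) h01 kp0 kp1 hE t00 hL a).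
have [Cq hq] : exists Cq, forall kappa h L, 0 <= h <= 1 -> 0 < kappa -> kappa <= 1 ->
    h = t * kappa ^+ 2 -> 4 * h <= 1 -> L%:R * h = t ->
    `|G (mean P (fun w => sqmod (euler_chain H x0 h L j w) * sqmod (euler_chain H x0 h L k w)))
      (mean P (fun w => sqmod (euler_chain H x0 h L j w)))
      (mean P (fun w => sqmod (euler_chain H x0 h L k w)))| <= kappa * Cq.
  eexists => kappa h L h01 kp0 kp1 hE h4 hL.
  exact: (euler_chain_pp hH hF adH indH m0 K0 hK (V1 c0) h01 kp0 kp1 hE t00 h4 hL jk).
pose C2 := 1 + N ^+ 2 * K; pose C1 := C2 * t * expR (C2 * t).
have C20 : 0 <= C2 by rewrite addr_ge0// mulr_ge0// sqr_ge0.
have C10 : 0 <= C1 by rewrite !mulr_ge0// expR_ge0.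
have rate0 : 0 <= scheme_rate m t by rewrite addr_ge0 ?divr_ge0// mulr_ge0// exprn_ge0.
pose S := scheme_rate m t * (expR (4 * scheme_rate m t * t) * t * (2 * scheme_noise m t K)).
have S0 : 0 <= S.
  by rewrite /S mulr_ge0// !mulr_ge0 ?expR_ge0// -/C2 -/C1 addr_ge0.
pose C := `|Cp| + `|Cq| + (1 + C1) + 2 * (t * S) + (1 + C1 * t).
(* Since h <= kappa t, this choice ensures both 4 h <= 1 and 4 [scheme_rate] h <= 1. *)
pose delta := (4 * t + 4 * (scheme_rate m t * t) + 1)^-1.
have D0 : 0 < 4 * t + 4 * (scheme_rate m t * t) + 1.
  by rewrite ltr_wpDl// addr_ge0// !mulr_ge0.
exists C, delta; split; first by rewrite invr_gt0.
move=> n; set kappa := n.+1%:R^-1 => kd.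
have kp0 : 0 < kappa by rewrite invr_gt0 ltr0n.
have kp1 : kappa <= 1 by rewrite invf_le1 ?ltr0n// ler1n.
have kD : kappa * (4 * t + 4 * (scheme_rate m t * t) + 1) <= 1.
  by rewrite -ler_pdivlMr// div1r.
(* With kappa = 1/(n + 1), exactly (n + 1)^2 steps of length t kappa^2 fill [0, t]. *)
pose h := t * kappa ^+ 2; pose L := (n.+1 ^ 2)%N.
have h0 : 0 < h by rewrite mulr_gt0// exprn_gt0.
have k2 : kappa ^+ 2 <= kappa by rewrite expr2 ler_piMr// ltW.
have Lh : L%:R * h = t.
  by rewrite /L /h natrX mulrCA -exprMn mulfV ?expr1n ?mulr1// pnatr_eq0.
have ht : h <= kappa * t by rewrite /h mulrC; exact: ler_wpM2r.
have h4 : 4 * h <= 1.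
  apply: le_trans kD; apply: (@le_trans _ _ (4 * (kappa * t))); first exact: ler_wpM2l.
  have -> : 4 * (kappa * t) = kappa * (4 * t) by ring.
  by apply: ler_wpM2l; [exact: ltW|rewrite -addrA lerDl addr_ge0// !mulr_ge0].
have hr : 4 * (scheme_rate m t * h) <= 1.
  apply: le_trans kD; apply: (@le_trans _ _ (4 * (scheme_rate m t * (kappa * t)))).
    by apply: ler_wpM2l => //; exact: ler_wpM2l.
  have -> : 4 * (scheme_rate m t * (kappa * t)) = kappa * (4 * (scheme_rate m t * t)) by ring.
  apply: ler_wpM2l; first exact: ltW.
  by rewrite addrAC lerDr addr_ge0// mulr_ge0.
have h1 : h <= 1 by apply: le_trans h4; rewrite ler_peMl ?(ltW h0)// ler1n.
have h01 : 0 <= h <= 1 by rewrite (ltW h0).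
have L0 : (0 < L)%N by rewrite expn_gt0.
have Lt : L%:R * h <= t by rewrite Lh.
pose x := euler_chain H x0 h L.
pose z a w := sqmod (x a w).
have nx a : cnice_wrt P (F (L%:R * h)) (x a) by exact: (euler_chain_nice hH hF adH indH m0).
have nz a : nice_wrt P (F (L%:R * h)) (z a) by exact: nice_sqmod.
have nW : nice_wrt P (F (L%:R * h)) (fun w => \sum_a z a w) by exact: nice_sum.
have nW1 : nice_wrt P (F (L%:R * h)) (fun w => \sum_a z a w - 1).
  by apply: niceB => //; exact: nice_cst.
have Lz a := nice_L1 (nz a).
have err := scheme_error hH hF adH indH m0 V1 h0 h1 mU iU sdeU K0 hK L0 Lh hr.
rewrite -/S in err.
pose D w := frob2 (U t w - chain_mx H V h L w).
have mD : measurable_fun setT D.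
  apply: measurable_frob2; apply: mx_measurableB; first exact: jointly_measurable_pair2.
  exact: (chain_measurable hH hF adH indH m0).
have LD : L1 P D.
  by apply: L1_ge0 => //; [move=> w; exact: frob2_ge0|exact: le_lt_trans err (ltry _)].
have mDS : mean P D <= S * h by rewrite -lee_fin -mean_EFin.
have [/andP[_ w1] _ w2] := euler_chain_mass_bounds hH hF adH indH m0 K0 hK (V1 c0) h01 Lt.
have w3 := euler_chain_mass_dev hH hF adH indH m0 K0 hK (V1 c0) h01 kp0 (erefl h) Lt.
rewrite -/C2 -/C1 in w1 w2 w3.
(* The weight kappa balances the two terms: [D] has mean O(h) = O(kappa^2), so both are O(kappa) in
   mean. *)
pose e w := kappa * (\sum_a z a w) + (1 + kappa^-1) * D w.
have Le : L1 P e by apply: L1D; apply: L1Z => //; exact: nice_L1 nW.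
have tS : 0 <= 2 * (t * S) by apply: mulr_ge0 => //; exact: mulr_ge0.
have kC (y : R) : y <= C -> kappa * y <= kappa * C by apply: ler_wpM2l; exact: ltW.
have CpC : Cp <= C.
  apply: (le_trans (ler_norm _)); rewrite /C -!addrA lerDl.
  by rewrite !addr_ge0// mulr_ge0.
have CqC : Cq <= C.
  apply: (le_trans (ler_norm _)); rewrite /C [`|Cp| + _]addrC -!addrA lerDl.
  by rewrite !addr_ge0// mulr_ge0.
exists z, e; split.
- split => //; first by move=> a w; exact: sqmod_ge0.
  + exact: nice_L1 (niceM (nz j) (nz k)).
  + exact: nice_L1 (niceX 2 nW1).
- split.
  + move=> w; rewrite /e.
    apply: (@le_trans _ _ (\sum_a (kappa * z a w + (1 + kappa^-1) * sqmod (U t w a c0 - x a w)))).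
      by apply: ler_sum => a _; exact: sqmod_diff_le.
    rewrite big_split /= -!mulr_sumr lerD2l; apply: ler_wpM2l.
      by rewrite addr_ge0// invr_ge0 ltW.
    rewrite /D /frob2; apply: ler_sum => a _; rewrite (bigD1 c0)//= !mxE lerDl.
    by apply: sumr_ge0 => b _; exact: sqmod_ge0.
  + rewrite /e meanD; [|exact: L1Z (nice_L1 nW)|exact: L1Z].
    rewrite !meanZ//; last exact: nice_L1 nW.
    apply: (@le_trans _ _ (kappa * (1 + C1) + kappa * (2 * (t * S)))).
      apply: lerD.
        apply: ler_wpM2l; first exact: ltW.
        move: w1; rewrite lerBlDl => /le_trans; apply; rewrite lerD2l ler_piMr//.
      apply: (@le_trans _ _ ((1 + kappa^-1) * (S * h))).
        by apply: ler_wpM2l => //; rewrite addr_ge0// invr_ge0 ltW.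
      have -> : (1 + kappa^-1) * (S * h) = kappa * ((1 + kappa) * (t * S)).
        by rewrite /h; field; rewrite gt_eqF.
      apply: ler_wpM2l; first exact: ltW.
      by apply: ler_wpM2r; [exact: mulr_ge0|rewrite lerD2l].
    rewrite -mulrDr; apply: kC; rewrite /C -addrA; have := normr_ge0 Cp; have := normr_ge0 Cq.
    have := mulr_ge0 C10 t00; move: (C1 * t) (2 * (t * S)) `|Cp| `|Cq| => *; lra.
  + apply: (le_trans w3); apply: kC; rewrite /C lerDr !addr_ge0//.
  apply: (le_trans w2); apply: (@le_trans _ _ (kappa * (C1 * t))).
    by rewrite (mulrCA kappa C1 t); exact: (ler_wpM2l C10 ht).
  apply: kC; rewrite /C; have := normr_ge0 Cp; have := normr_ge0 Cq.
  by move: (C1 * t) (2 * (t * S)) tS `|Cp| `|Cq| => *; have := C10; lra.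
split.
- rewrite /bj opprD addrA; apply: (le_trans (hp _ _ _ h01 kp0 kp1 (erefl h) Lh j)); exact: kC.
- rewrite /bk opprD addrA; apply: (le_trans (hp _ _ _ h01 kp0 kp1 (erefl h) Lh k)); exact: kC.
by apply: (le_trans (hq _ _ _ h01 kp0 kp1 (erefl h) h4 Lh)); exact: kC.
Qed.

Lemma unitary_moments :
  [/\ mean P (p j) = N^-1 + expR (- t) * (sqmod (x0 j) - N^-1),
      mean P (p k) = N^-1 + expR (- t) * (sqmod (x0 k) - N^-1) &
      mean P (fun w => p j w * p k w) = (N + 2)^-1 * (mean P (p j) + mean P (p k) - 2 / N) +
        (N * (N + 1))^-1 + expR (- (t * lambda)) * (sqmod (x0 j) * sqmod (x0 k) -
        (N + 2)^-1 * (sqmod (x0 j) + sqmod (x0 k) - 2 / N) - (N * (N + 1))^-1)].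
Proof.
have [C [delta [d0 approx]]] := column_approximation.
have mp a : measurable_fun setT (p a).
  by apply: measurable_sqmod; exact: (jointly_measurable_pair2 t mU).
have p0 a w : 0 <= p a w by exact: sqmod_ge0.
have [e1 e2] := limit_mean mp p0 d0 approx.
have := limit_pair mp p0 d0 G_lipschitz jk approx.
rewrite /G; set y := mean P (fun w => p j w * p k w) => e3; split => //.
by apply/eqP; rewrite -subr_eq0 -[X in _ == X]e3; apply/eqP; ring.
Qed.

End unitary_brownian_moments.

(** * Unitary initial value, clamped equation and conclusion *)

Lemma unitary_columns (R : realType) (m : nat) (V : 'M[R[i]]_m) :
  V \is unitarymx -> forall b, \sum_a sqmod (V a b) = 1.
Proof.
(* The definition of [unitarymx] makes the rows orthonormal; for a square matrix the two factors
   commute, which gives the columns. *)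
move=> /unitarymxP /mulmx1C /matrixP hV b; have := hV b b.
rewrite !mxE eqxx => /(congr1 (@complex.Re R)) /= <-.
rewrite Re_sum; apply: eq_bigr => a _; rewrite !mxE Re_mul conjCE sqmodE /=; ring.
Qed.

Section clamped_sde.
Context (d : measure_display) (T : measurableType d) (R : realType)
        (P : probability T R) (m : nat) (F : R -> set (set T)) (H U : R -> T -> 'M[R[i]]_m).
Local Notation mu := (@lebesgue_measure R).

Lemma clamp_ito_integral t Y : is_ito_integral P F H U t Y ->
  is_ito_integral P F H (clamp_time U) t Y.
Proof.
move=> [mY [phi [hp cU cY]]]; split; first exact: mY.
exists phi; split; [exact: hp| |exact: cY].
have e : (fun n => \int[P]_w \int[mu]_(s in `[0%R, t])
      (frob2 (clamp_time U s w - elementary_at (phi n) s w)%R)%:E)%E =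
    (fun n => \int[P]_w \int[mu]_(s in `[0%R, t])
      (frob2 (U s w - elementary_at (phi n) s w)%R)%:E)%E.
  apply/funext => n; apply: eq_integral => w _; apply: eq_integral => s.
  by rewrite inE/= in_itv/= => /andP[s0 _]; rewrite clamp_timeE.
rewrite e; exact: cU.
Qed.

Lemma clamp_time_integral t w : time_integral (clamp_time U) t w = time_integral U t w.
Proof.
by apply/matrixP => a b; rewrite !mxE; congr Complex; apply: eq_Rintegral => s;
   rewrite inE/= in_itv/= => /andP[s0 _]; rewrite clamp_timeE.
Qed.

End clamped_sde.

Theorem proposition5p3 (d : measure_display) (T : measurableType d)
    (R : realType) (P : probability T R) (n : nat)
    (psi : 'cV[R[i]]_n.+1) (V : 'M[R[i]]_n.+1)
    (F : R -> set (set T)) (H U : R -> T -> 'M[R[i]]_n.+1)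
    (hpsi : \sum_j sqmod (psi j ord0) = 1)
    (hV : V \is unitarymx) (hVpsi : col ord0 V = psi)
    (hU : unitary_brownian_motion P F H V U)
    (j k : 'I_n.+1) (hjk : j != k) :
  let N : R := n.+1%:R in
  let f := moment1 P U in
  let f2 := moment2 P U j k in
  let rhs := fun t : R => N^-1 * (f j t + f k t) - (2 + 2 / N) * f2 t in
  [/\ forall t : R, 0 < t -> is_derive t (1 : R) f2 (rhs t),
      h^-1 * (f2 h - f2 0) @[h --> 0^'+] --> rhs 0,
      forall t : R, 0 <= t ->
        f2 t =
          (f2 0 - (N + 2)^-1 * (f j 0 + f k 0 - 2 / N) - (N * (N + 1))^-1)
            * expR (- (t * (2 + 2 / N)))
          + (N + 2)^-1 * (f j 0 + f k 0 - 2 / N) * expR (- t)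
          + (N * (N + 1))^-1 &
      [/\ f j 0 = sqmod (psi j ord0), f k 0 = sqmod (psi k ord0) &
          f2 0 = sqmod (psi j ord0) * sqmod (psi k ord0)]].
Proof.
case: hU => hH hF adH indH adU cU iniU sdeU N f f2 rhs.
have fE a t : f a t = mean P (fun w => sqmod (U t w a ord0)).
  by rewrite /f /moment1 unlock.
have f2E t : f2 t = mean P (fun w => sqmod (U t w j ord0) * sqmod (U t w k ord0)).
  by rewrite /f2 /moment2 unlock.
have mxU s : 0 <= s -> mx_measurable (U s).
  move=> s0; apply: (mx_measurable_wrt _ (adapted_entries hF adU s0)).
  exact: filtration_sigma_sub.
(* Nothing is known of [U] at negative times; the clamped process agrees with it on [0, +oo[, so it
   solves the same equation and has the same moments there. *)
have mU := jointly_measurable_clamp cU mxU.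
have Vpsi a : V a ord0 = psi a ord0 by rewrite -hVpsi mxE.
have clampE s w a b : 0 <= s -> clamp_time U s w a b = U s w a b by move=> s0; rewrite clamp_timeE.
have sde s : 0 <= s -> exists2 Y : T -> 'M[R[i]]_n.+1,
    is_ito_integral P F H (clamp_time U) s Y &
    {ae P, forall w, clamp_time U s w =
       V + (Complex 0 1 : R[i]) *: Y w - 2^-1 *: time_integral (clamp_time U) s w}.
  move=> s0; have [Y iY eY] := sdeU s s0; exists Y; first exact: clamp_ito_integral.
  have -> : clamp_time U s = U s by apply/funext => w; rewrite clamp_timeE.
  apply: filterS eY => w e; rewrite clamp_time_integral; exact: e.
have V1 := unitary_columns hV.
pose qj := sqmod (psi j ord0); pose qk := sqmod (psi k ord0).
have mea t a : 0 <= t -> measurable_fun setT (fun w => sqmod (U t w a ord0)).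
  by move=> t0; apply: measurable_sqmod; exact: mxU.
have f0 a : f a 0 = sqmod (psi a ord0).
  rewrite fE; apply: ae_mean_cst; first exact: mea.
  by apply: filterS iniU => w ->; rewrite Vpsi.
have f20 : f2 0 = qj * qk.
  rewrite f2E; apply: ae_mean_cst; first by apply: measurable_funM; exact: mea.
  by apply: filterS iniU => w ->; rewrite !Vpsi.
pose lam := 2 + 2 / N.
pose b (q t : R) := N^-1 + expR (- t) * (q - N^-1).
pose B := (N + 2)^-1 * (qj + qk - 2 / N).
pose c := (N * (N + 1))^-1.
pose g (t : R) := (qj * qk - B - c) * expR (- (t * lam)) + B * expR (- t) + c.
have N0 : N != 0 by rewrite pnatr_eq0.
have N1 : N + 1 != 0 by rewrite natr1 pnatr_eq0.
have N2 : N + 2 != 0 by rewrite -natrD pnatr_eq0.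
(* A grid on [0, t] requires t > 0; at time 0 the formula is checked against the initial condition
   instead. *)
have expl t : 0 < t -> [/\ f j t = b qj t, f k t = b qk t & f2 t = g t].
  move=> t0.
  have [e1 e2 e3] := unitary_moments hH hF adH indH V1 mU
    (fun r w => clamp_integrable r w cU) sde ord0 hjk t0.
  have ce a : (fun w => sqmod (clamp_time U t w a ord0)) = (fun w => sqmod (U t w a ord0)).
    by apply/funext => w; rewrite clampE// ltW.
  have ce2 : (fun w => sqmod (clamp_time U t w j ord0) * sqmod (clamp_time U t w k ord0)) =
     (fun w => sqmod (U t w j ord0) * sqmod (U t w k ord0)).
    by apply/funext => w; rewrite !clampE// ltW.
  rewrite ce2 !ce -!fE -f2E in e1 e2 e3.
  rewrite !Vpsi in e1 e2 e3.
  split => //; rewrite e3 e1 e2 -/qj -/qk /g /B /c -/N -/lam.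
  move: (expR _) (expR _) => x y; field.
  by rewrite nat1r -/N N0 N1 N2.
have expl0 : [/\ f j 0 = b qj 0, f k 0 = b qk 0 & f2 0 = g 0].
  rewrite !f0 f20 /b /g mul0r oppr0 expR0; split; try by rewrite mul1r addrC subrK.
  by rewrite !mulr1 [_ - c + B]addrAC !subrK.
have explW t : 0 <= t -> [/\ f j t = b qj t, f k t = b qk t & f2 t = g t].
  by rewrite le_eqVlt => /orP[/eqP<-//|]; exact: expl.
have dg t : is_derive t (1 : R) g ((qj * qk - B - c) * (- lam * expR (- (t * lam))) + B * (- expR (- t))).
  have -> : g = (qj * qk - B - c) \*: (expR \o (- (lam \*: id))) + B \*: (expR \o (- id)) + cst c.
    by apply/funext => s; rewrite /g /= !fctE /= [lam *: s]mulrC.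
  apply: is_derive_eq.
  rewrite !fctE /= addr0 [lam *: t]mulrC.
  by rewrite -![_ *: _]/(_ * _); ring.
have rhsE t : 0 <= t -> rhs t = (qj * qk - B - c) * (- lam * expR (- (t * lam))) + B * (- expR (- t)).
  move=> t0; have [e1 e2 e3] := explW t t0; rewrite /rhs e1 e2 e3 /b /g /B /c -/lam.
  rewrite /lam; move: (expR _) (expR _) => x y; field.
  by rewrite nat1r -/N N0 ?N1 N2.
split.
- move=> t t0; rewrite rhsE ?ltW//; apply: near_eq_is_derive (dg t).
  near=> s; have [] := expl s; last by [].
  by near: s; exact: lt_nbhsr.
(* At 0 only the right derivative makes sense, [f2] being unconstrained at negative times; it is
   inherited from the two-sided derivative of [g]. *)
- rewrite rhsE//.
  have [dv dE] := dg 0.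
  rewrite -dE; have := cvg_dnbhs_at_right dv.
  apply: cvg_trans; apply: near_eq_cvg; near=> s.
  have s0 : 0 < s by near: s; exact: nbhs_right_gt.
  have [_ _ ->] := expl s s0; have [_ _ ->] := expl0.
  by rewrite /= addr0 [s *: _]mulr1.
- move=> t t0; have [_ _ ->] := explW t t0.
  by rewrite f20 !f0 -/qj -/qk.
- by split; rewrite ?f0.
Unshelve. all: by end_near.
Qed.
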